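(* Assume that $H\in C^1(\mathbb R^d\times\mathbb R^d;\mathbb R)$, that $x\mapsto H(0,x)$ is bounded and that $H=H(p,x)$ is convex in the first variable $p$. Assume that $F:\mathbb R^d\times\mathcal P_1(\mathbb R^d)\to\mathbb R$ is Lipschitz continuous, bounded and monotone. Then weak solutions (as defined in the context) of the first-order master equation $$U(x,m)+H(D_xU(x,m),x)+\int_{\mathbb R^d}D_mU(x,m,y)\cdot D_pH(D_xU(y,m),y)\,m(dy)=F(x,m)\quad\text{in }\mathbb R^d\times\mathcal P_2(\mathbb R^d)$$ are unique up to an $m$-dependent constant: if $U$ and $\tilde U$ are two weak solutions, then there is $c\in C(\mathcal P_2(\mathbb R^d);\mathbb R)$ such that $U(x,m)=\tilde U(x,m)+c(m)$ for all $(x,m)\in\mathbb R^d\times\mathcal P_2(\mathbb R^d)$.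
   Context: **Notation.** $\mathcal P_1(\mathbb R^d),\mathcal P_2(\mathbb R^d)$ are the Borel probability measures on $\mathbb R^d$ with finite first, respectively second, moment, with the Wasserstein distances $\mathbf d_1,\mathbf d_2$. $\mathcal P_2(\mathbb R^d)\cap L^\infty(\mathbb R^d)$ is the set of $m\in\mathcal P_2(\mathbb R^d)$ that are absolutely continuous with respect to Lebesgue measure with a bounded density, also denoted by $m$; $\|m\|_\infty$ is the $L^\infty$ norm of the density. $F$ is monotone if $\int_{\mathbb R^d}(F(x,m)-F(x,m'))(m-m')(dx)\ge 0$ for all $m,m'$. **Weak solution of the first-order master equation.** A bounded function $U\in C(\mathbb R^d\times\mathcal P_2(\mathbb R^d))$ is a weak solution if $U$ is Lipschitz continuous and semiconcave in $x$, both uniformly in $m$, and there exists $C>0$ such that for all $\tilde m\in\mathcal P_2(\mathbb R^d)\cap L^\infty(\mathbb R^d)$, $\hat m\in\mathcal P_2(\mathbb R^d)$, $\phi\in W^{1,\infty}(\mathbb R^d)$ and $\varepsilon>0$ such that the map $$m\mapsto\int_{\mathbb R^d}(U(x,m)-\phi(x))(m(x)-\tilde m(x))dx+\varepsilon(\mathbf d_2(m,\hat m)+\|m\|_\infty)$$ has a local minimum (with respect to $\mathbf d_2$) at $m_0$ in $\mathcal P_2(\mathbb R^d)\cap L^\infty(\mathbb R^d)$, one has $$\begin{aligned}&\int_{\mathbb R^d}U(x,m_0)(m_0(x)-\tilde m(x))dx+\int_{\mathbb R^d}H(D_xU(x,m_0),x)(m_0(x)-\tilde m(x))dx\\&-\int_{\mathbb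 R^d}(D_xU(y,m_0)-D\phi(y))\cdot D_pH(D_xU(y,m_0),y)m_0(y)dy\\&\ge\int_{\mathbb R^d}F(x,m_0)(m_0(x)-\tilde m(x))dx-C\varepsilon(1+\|m_0\|_\infty).\end{aligned}$$ *)

(* Defs.v *)
From HB Require Import structures.
From mathcomp Require Import all_boot all_order all_algebra.
From mathcomp Require Import all_classical all_reals all_analysis.
From mathcomp Require Import measurable_realfun.

Set Implicit Arguments.
Unset Strict Implicit.
Unset Printing Implicit Defensive.

Import Order.TTheory GRing.Theory Num.Theory.
Import numFieldNormedType.Exports.

Local Open Scope classical_set_scope.
Local Open Scope ring_scope.

Definition mx_borel_display : measure_display.
Proof. by constructor. Qed.

Section mx_borel.
Context (R : realType) (m n : nat).

Definition mx_borel : set (set 'M[R]_(m, n)) := <<s @open 'M[R]_(m, n) >>.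

Let mx_borel0 : mx_borel set0. Proof. exact: sigma_algebra0. Qed.

Let mx_borelC A : mx_borel A -> mx_borel (~` A).
Proof. exact: sigma_algebraC. Qed.

Let mx_borel_bigcup (F : (set 'M[R]_(m, n))^nat) :
  (forall i, mx_borel (F i)) -> mx_borel (\bigcup_i F i).
Proof. exact: sigma_algebra_bigcup. Qed.

HB.instance Definition _ := @isMeasurable.Build mx_borel_display
  'M[R]_(m, n) mx_borel mx_borel0 mx_borelC mx_borel_bigcup.

Lemma open_mx_measurable (A : set 'M[R]_(m, n)) : open A -> measurable A.
Proof. exact: sub_sigma_algebra. Qed.

End mx_borel.

Section lebesgue_rV.
Context (R : realType).

Definition cons_rV n (p : measurableTypeR R * 'rV[R]_n) : 'rV[R]_n.+1 :=
  row_mx (const_mx p.1 : 'rV_1) p.2.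

Lemma cons_rV_ball n (p q : measurableTypeR R * 'rV[R]_n) (e : R) :
  0 < e -> ball (p.1 : R) e q.1 -> ball p.2 e q.2 ->
  ball (cons_rV p) e (cons_rV q).
Proof.
move=> e0 pq1 [_ pq2]; split=> // i j; rewrite /cons_rV !mxE.
by case: splitP => k _; rewrite ?mxE.
Qed.

Lemma measurable_cons_rV n : measurable_fun setT (@cons_rV n).
Proof.
apply: (@measurability _ _ _ _ _ _ (@open 'rV[R]_n.+1)) => //.
move=> _ [B oB <-]; rewrite setTI.
pose box (q : rat * 'rV[rat]_n * rat) : set (measurableTypeR R * 'rV[R]_n) :=
  ball (ratr q.1.1 : R) (ratr q.2 : R) `*`
  ball (map_mx ratr q.1.2 : 'rV[R]_n) (ratr q.2 : R).
pose F q := if `[< 0 < q.2 /\ box q `<=` @cons_rV n @^-1` B >]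
  then box q else set0.
have -> : @cons_rV n @^-1` B = \bigcup_q F q.
  apply/seteqP; split; last first.
    move=> x [q _]; rewrite /F; case: ifPn => // /asboolP[_ qB]; exact: qB.
  move=> z /= Bz.
  have /nbhs_ballP[_/posnumP[e] eB] : nbhs (cons_rV z) B.
    by rewrite openE in oB; exact: oB.
  have e2 : 0 < e%:num / 2 by [].
  have [r] := rat_in_itvoo e2; rewrite in_itv /= => /andP[r0 re].
  have approx (x : R) : exists q : rat, ball (ratr q : R) (ratr r : R) x.
    have /rat_in_itvoo[q] : x < x + ratr r by rewrite ltrDl.
    rewrite in_itv /= => /andP[xq qx]; exists q; rewrite /ball /=.
    by rewrite gtr0_norm ?subr_gt0// ltrBlDl.
  have [q1 Hq1] := approx z.1.
  have [q2 Hq2] := choice (fun j => approx (z.2 ord0 j)).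
  exists (q1, \row_j q2 j, r) => //; rewrite /F.
  have bz : box (q1, \row_j q2 j, r) z.
    split; first exact: Hq1.
    by split=> //= i j; rewrite !mxE (ord1 i).
  case: ifPn => // /asboolP; case; split=> /=.
    by rewrite ltr0q in r0.
  case: bz => /= bz1 bz2 w [/= w1 w2]; apply: eB.
  apply: (@le_ball _ _ _ (ratr r + ratr r)).
    by rewrite [leRHS]splitr lerD// ltW.
  apply: cons_rV_ball; first by rewrite addr_gt0.
    exact: ball_triangle (ball_sym bz1) w1.
  exact: ball_triangle (ball_sym bz2) w2.
apply: countable_bigcupT_measurable; first exact: countableP.
move=> q.
rewrite /F; case: ifPn => // /asboolP[q0 _].
have q0' : 0 < ratr q.2 :> R by rewrite ltr0q.
apply: measurableX; first exact: measurable_ball.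
by apply: open_mx_measurable; apply: ball_open.
Qed.

Definition uncons_rV n (v : 'rV[R]_n.+1) : measurableTypeR R * 'rV[R]_n :=
  (v ord0 ord0, rsubmx (v : 'rV[R]_(1 + n))).

Lemma cons_rVK n : cancel (@cons_rV n) (@uncons_rV n).
Proof.
case=> x v; rewrite /uncons_rV /cons_rV /= row_mxKr; congr pair.
by rewrite mxE; case: splitP => // k _; rewrite mxE.
Qed.

Lemma measurable_uncons_rV n : measurable_fun setT (@uncons_rV n).
Proof.
apply: measurable_fun_pair.
  apply: (measurability _ (RGenOInfty.measurableE R)).
  move=> _ [_ [a ->] <-]; rewrite setTI; apply: open_mx_measurable.
  apply: (@open_comp _ _ (fun v : 'rV[R]_n.+1 => v ord0 ord0)).
    by move=> v _; exact: coord_continuous.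
  by rewrite set_itvoy; exact: open_gt.
apply: (@measurability _ _ _ _ _ _ (@open 'rV[R]_n)) => //.
move=> _ [B oB <-]; rewrite setTI; apply: open_mx_measurable.
by apply: open_comp => // v _; exact: (@continuous_rsubmx _ 1 1 n).
Qed.

Section step.
Context n (l : {sigma_finite_measure set (measurableTypeR R) -> \bar R})
  (mu : {sigma_finite_measure set 'rV[R]_n -> \bar R}).

Definition lebesgue_step : set 'rV[R]_n.+1 -> \bar R :=
  pushforward (l \x mu)%E (@cons_rV n).

Let lebesgue_step0 : lebesgue_step set0 = 0%E.
Proof. by rewrite /lebesgue_step /pushforward preimage_set0 measure0. Qed.

Let lebesgue_step_ge0 A : (0 <= lebesgue_step A)%E.
Proof. by rewrite /lebesgue_step /pushforward measure_ge0. Qed.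

Let lebesgue_step_sigma_additive : semi_sigma_additive lebesgue_step.
Proof.
move=> F mF tF mUF; rewrite /lebesgue_step /pushforward preimage_bigcup.
apply: measure_semi_sigma_additive.
- by move=> n0; rewrite -[X in measurable X]setTI; exact: measurable_cons_rV.
- apply/trivIsetP => /= i j _ _ ij; rewrite -preimage_setI.
  by move/trivIsetP : tF => /(_ _ _ _ _ ij) ->//; rewrite preimage_set0.
- by rewrite -preimage_bigcup -[X in measurable X]setTI;
    exact: measurable_cons_rV.
Qed.

HB.instance Definition _ := isMeasure.Build _ _ _ lebesgue_step
  lebesgue_step0 lebesgue_step_ge0 lebesgue_step_sigma_additive.

Let lebesgue_step_sigma_finite : sigma_finite setT lebesgue_step.
Proof.
have /sigma_finiteP[F [TF ndF Foo]] := sigma_finiteT l.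
have /sigma_finiteP[G [TG ndG Goo]] := sigma_finiteT mu.
exists (fun k => @uncons_rV n @^-1` (F k `*` G k)).
  apply/esym; rewrite -subTset => v _.
  have [k _ Fk] : (\bigcup_k F k) (uncons_rV v).1 by rewrite -TF.
  have [k' _ Gk'] : (\bigcup_k G k) (uncons_rV v).2 by rewrite -TG.
  exists (maxn k k') => //; split.
    by move: Fk; exact/subsetPset/ndF/leq_maxl.
  by move: Gk'; exact/subsetPset/ndG/leq_maxr.
move=> k; have [mF lF] := Foo k; have [mG muG] := Goo k.
have mFG : measurable (F k `*` G k) by exact: measurableX.
split.
  by rewrite -[X in measurable X]setTI; exact: measurable_uncons_rV.
rewrite /lebesgue_step /pushforward -comp_preimage.
rewrite (_ : _ \o _ = id) ?preimage_id; last first.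
  by apply/funext => p; exact: cons_rVK.
by rewrite product_measure1E// lte_mul_pinfty// ge0_fin_numE.
Qed.

HB.instance Definition _ := Measure_isSigmaFinite.Build _ _ _ lebesgue_step
  lebesgue_step_sigma_finite.

End step.

Fixpoint lebesgue_rV n : {sigma_finite_measure set 'rV[R]_n -> \bar R} :=
  match n with
  | 0 => \d_(0 : 'rV[R]_0)
  | n.+1 => lebesgue_step lebesgue_measure (lebesgue_rV n)
  end.

End lebesgue_rV.

(* Euclidean structure: the library norm on 'rV[R]_d is the sup norm, so the
   Euclidean norm is written explicitly; the topologies coincide.             *)
Section euclidean.
Context (R : realType) (d : nat).
Implicit Types (u v x : 'rV[R]_d) (f : 'rV[R]_d -> R).

Definition dotv u v : R := \sum_(i < d) u ord0 i * v ord0 i.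

Definition enorm u : R := Num.sqrt (dotv u u).

Definition base i : 'rV[R]_d := delta_mx ord0 i.

(* For a Lipschitz f this is the gradient at almost every point; where a
   partial derivative does not exist, 'D takes the default value of lim.      *)
Definition grad f x : 'rV[R]_d := \row_i 'D_(base i) f x.

(* f - C |.|^2 is concave. *)
Definition semiconcave_with (C : R) f :=
  convex_function [set: 'rV[R]_d] (fun x => C * enorm x ^+ 2 - f x).

Definition test_function f :=
  (forall (s : seq 'rV[R]_d) x,
     differentiable (foldr (fun v g => fun y => 'D_v g y) f s) x) /\
  compact (closure [set x | f x != 0]).

Definition weak_grad f (w : 'rV[R]_d -> 'rV[R]_d) :=
  forall psi, test_function psi -> forall i,
    \int[lebesgue_rV R d]_x (f x * 'D_(base i) psi x) =
    - \int[lebesgue_rV R d]_x (w x ord0 i * psi x).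

(* f is in W^{1,oo} and w is any representative of its weak gradient. *)
Definition W1oo f (w : 'rV[R]_d -> 'rV[R]_d) :=
  [/\ f \in Lfun (lebesgue_rV R d) +oo%E,
      forall i, (fun x => w x ord0 i) \in Lfun (lebesgue_rV R d) +oo%E &
      weak_grad f w].

End euclidean.

Definition C1 (R : realType) (V : normedModType R) (f : V -> R) :=
  (forall z, differentiable f z) /\ (forall v, continuous (fun z => 'D_v f z)).

Section wasserstein.
Context (R : realType) (d : nat).

(* Measures are set functions defined on all sets, so two elements of [prob]
   may agree on Borel sets without being equal; they are then at distance 0,
   and the continuity and Lipschitz conditions below identify them.           *)
Definition prob := probability 'rV[R]_d R.

Implicit Types m : prob.

Definition Pp (p : nat) : set prob :=
  [set m | (\int[m]_x (enorm x ^+ p)%:E < +oo)%E].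

Definition couplings m m' : set (probability ('rV[R]_d * 'rV[R]_d)%type R) :=
  [set g | (forall A, measurable A -> g (A `*` setT) = m A) /\
           (forall A, measurable A -> g (setT `*` A) = m' A)].

Definition wasserstein (p : nat) m m' : R :=
  fine (ereal_inf [set (\int[g]_z (enorm (z.1 - z.2) ^+ p)%:E)%E
                  | g in couplings m m']) `^ (p%:R^-1).

(* rho is a representative of the density of m. *)
Definition Loo_density m (rho : 'rV[R]_d -> R) :=
  [/\ forall x, 0 <= rho x,
      rho \in Lfun (lebesgue_rV R d) +oo%E &
      forall A, measurable A ->
        m A = (\int[lebesgue_rV R d]_(x in A) (rho x)%:E)%E].

Definition Loo_norm (rho : 'rV[R]_d -> R) : R :=
  fine ('N[lebesgue_rV R d]_+oo[EFin \o rho])%E.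

Definition continuous_P2 (c : prob -> R) :=
  forall m, Pp 2 m -> forall e, 0 < e -> exists2 r, 0 < r &
    forall m', Pp 2 m' -> wasserstein 2 m' m < r -> `|c m' - c m| < e.

Definition continuous_RdP2 (U : 'rV[R]_d -> prob -> R) :=
  forall x m, Pp 2 m -> forall e, 0 < e -> exists2 r, 0 < r &
    forall y m', Pp 2 m' -> enorm (y - x) < r -> wasserstein 2 m' m < r ->
      `|U y m' - U x m| < e.

Definition bounded_RdPp p (F : 'rV[R]_d -> prob -> R) :=
  exists M : R, forall x m, Pp p m -> `|F x m| <= M.

Definition lipschitz_RdP1 (F : 'rV[R]_d -> prob -> R) :=
  exists L : R, forall x y m m', Pp 1 m -> Pp 1 m' ->
    `|F x m - F y m'| <= L * (enorm (x - y) + wasserstein 1 m m').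

Definition monotone_P1 (F : 'rV[R]_d -> prob -> R) :=
  forall m m', Pp 1 m -> Pp 1 m' ->
    0 <= \int[m]_x (F x m - F x m') - \int[m']_x (F x m - F x m').

End wasserstein.

Section master_equation.
Context (R : realType) (d : nat).
Local Notation Rd := 'rV[R]_d.
Local Notation prob := (prob R d).
Local Notation leb := (lebesgue_rV R d).
Variables (H : Rd -> Rd -> R) (F : Rd -> prob -> R).

Definition DpH (p x : Rd) : Rd := grad (fun q => H q x) p.

(* Functional of m, where rho is the density of m and rhot that of m~. *)
Definition test_functional (U : Rd -> prob -> R) (phi rhot : Rd -> R)
    (mh : prob) (e : R) (m : prob) (rho : Rd -> R) : R :=
  \int[leb]_x ((U x m - phi x) * (rho x - rhot x)) +
  e * (wasserstein 2 m mh + Loo_norm rho).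

Definition test_local_min U phi rhot mh e (m0 : prob) (rho0 : Rd -> R) :=
  exists2 r, 0 < r & forall m rho, Pp 2 m -> Loo_density m rho ->
    wasserstein 2 m m0 < r ->
    test_functional U phi rhot mh e m0 rho0 <=
    test_functional U phi rhot mh e m rho.

(* The two integrals involving H are required to converge absolutely, since H is
   not assumed to be bounded in x; the other ones have bounded integrands against
   L^1 densities.                                                             *)
Definition test_inequality (C : R) (U : Rd -> prob -> R) (rhot : Rd -> R)
    (Dphi : Rd -> Rd) (e : R) (m0 : prob) (rho0 : Rd -> R) :=
  let DU x := grad (fun y => U y m0) x in
  let f1 x := H (DU x) x * (rho0 x - rhot x) in
  let f2 y := dotv (DU y - Dphi y) (DpH (DU y) y) * rho0 y in
  [/\ leb.-integrable setT (EFin \o f1),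
      leb.-integrable setT (EFin \o f2) &
      \int[leb]_x (F x m0 * (rho0 x - rhot x)) - C * e * (1 + Loo_norm rho0) <=
      \int[leb]_x (U x m0 * (rho0 x - rhot x)) +
      \int[leb]_x f1 x - \int[leb]_y f2 y].

Definition weak_solution (U : Rd -> prob -> R) :=
  [/\ bounded_RdPp 2 U,
      continuous_RdP2 U,
      exists L : R, forall m, Pp 2 m ->
        forall x y, `|U x m - U y m| <= L * enorm (x - y),
      exists C : R, forall m, Pp 2 m -> semiconcave_with C (U ^~ m) &
      exists2 C, 0 < C &
        forall (mt mh : prob) rhot phi Dphi e (m0 : prob) rho0,
          Pp 2 mt -> Loo_density mt rhot -> Pp 2 mh ->
          W1oo phi Dphi -> 0 < e ->
          Pp 2 m0 -> Loo_density m0 rho0 ->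
          test_local_min U phi rhot mh e m0 rho0 ->
          test_inequality C U rhot Dphi e m0 rho0].

End master_equation.

(* Main.v *)
(** For [m], [n] in P_2 with bounded densities, put
    [J(m, n) = int (U(x, m) - Ut(x, n)) (m - n)(dx)].  The core of the proof is
    [J >= 0].  By Ekeland's principle there are near-minimisers of
    [J(m, n) + eps (|m|_oo + |n|_oo)] that become minimisers once
    [eps d_2(., m)] and [eps d_2(., n)] are added.  At such a pair, the
    functionals in the definition of a weak solution are minimal with test
    functions [Ut(., n)] for [U] and [U(., m)] for [Ut]; these are admissible
    because a bounded, Lipschitz, semiconcave function has its pointwise gradient
    as weak gradient.  In the sum of the two resulting inequalities, the
    [H]-terms have a sign by convexity and the [F]-terms by monotonicity, so
    [J(m, n) >= - C eps (1 + |m|_oo + |n|_oo)]; letting [eps] tend to 0 along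
    near-minimisers of [J] yields [J >= 0].

    Applied to [m + t (n2 - m)] and [m + t (n1 - m)], divided by [t], this gives
    [int (U - Ut)(x, m) n1(dx) <= int (U - Ut)(x, m) n2(dx)] for all [n1], [n2]
    with bounded densities; concentrating [n1] and [n2] at two points shows that
    [(U - Ut)(., m)] is constant, first for [m] with a bounded density, then for
    all [m] by smoothing.

    Ekeland's principle is used with a pseudo-distance dominated by [d_2], the
    supremum over 1-Lipschitz [psi] of the difference of the L^2 norms of [psi].
    A Cauchy sequence of measures with uniformly bounded densities converges for
    [d_2]: the limiting density is the a.e. limit of convex combinations of the
    densities, and [d_2]-convergence follows from explicit couplings built on a
    partition of unity. *)

(* P_2 is not locally compact for d_2, so the penalised [J] need not attain its infimum; hence the
   variational principle, whose perturbation [eps d_2(., m)] is what the definition of weak solution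
   admits. The distance in it only has to be dominated by d_2 and complete along sequences on which
   the penalised functional decreases; there the norm penalty bounds the densities uniformly.

   Lipschitz functions are tested in L^2 norm because their squares have quadratic growth: this
   controls second moments uniformly in the tails, and integrals of bounded Lipschitz functions are
   recovered from squares. Densities of mass 1 with a uniform bound are also bounded in L^2 of the
   Lebesgue measure, which supplies the Hilbert geometry behind the convex combinations.

   The error [C eps (1 + |m|_oo)] at the new pair is small because [eps] is chosen after a
   near-minimiser of [J], inversely to its norms, and the norms at the new pair are controlled by
   the decrease of the penalised functional.

   No derivative in the measure is taken at the end: the two mixtures differ by exactly
   [t (n2 - n1)], so dividing by [t] leaves values of [U] and [Ut], which converge by continuity. *)
Require Import Defs.
From mathcomp Require Import all_boot all_order all_algebra.
From mathcomp Require Import all_classical all_reals all_analysis.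
From HB Require Import structures.
From mathcomp Require Import measurable_realfun ess_sup_inf.
From mathcomp Require Import ring lra.
Import Order.TTheory GRing.Theory Num.Theory.
Import numFieldNormedType.Exports.
Local Open Scope classical_set_scope.
Local Open Scope ring_scope.

Set Implicit Arguments.
Unset Strict Implicit.
Unset Printing Implicit Defensive.

(** * Measures with a density *)

Section density.
Local Open Scope ereal_scope.
Context d (T : measurableType d) (R : realType) (mu : {measure set T -> \bar R})
  (k : T -> R).
Hypotheses (mk : measurable_fun setT k) (k0 : forall x, (0 <= k x)%R).

Let dens (A : set T) := \int[mu]_(x in A) (k x)%:E.

Let dens0 : dens set0 = 0. Proof. exact: integral_set0. Qed.

Let dens_ge0 A : 0 <= dens A.
Proof. by apply: integral_ge0 => x _; rewrite lee_fin. Qed.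

Let dens_sigma_additive : semi_sigma_additive dens.
Proof.
move=> F mF tF mUF; rewrite /dens.
rewrite ge0_integral_bigcup//.
- apply: is_cvg_ereal_nneg_natsum => n _; exact: dens_ge0.
- exact/measurable_funTS/measurable_EFinP.
- by move=> x _; rewrite lee_fin.
Qed.

HB.instance Definition _ := isMeasure.Build _ _ _ dens
  dens0 dens_ge0 dens_sigma_additive.

Hypothesis k1 : \int[mu]_x (k x)%:E = 1.

HB.instance Definition _ := Measure_isProbability.Build _ _ _ dens k1.

(** An existence statement, so that couplings and limit measures are later obtained from a density
    alone. *)
Lemma ex_density_probability : exists P : probability T R,
  forall A, measurable A -> P A = \int[mu]_(x in A) (k x)%:E.
Proof. by exists dens. Qed.

End density.

Section integral_density.
Import HBNNSimple.

(** Both sides are limits along simple functions increasing to [f]; on each level set the identity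
    is the hypothesis on [nu]. *)
Lemma ge0_integral_density d (T : measurableType d) (R : realType)
    (mu nu : {measure set T -> \bar R}) (k : T -> R) (f : T -> \bar R) :
  measurable_fun setT k -> (forall x, 0 <= k x) ->
  (forall A, measurable A -> nu A = \int[mu]_(x in A) (k x)%:E)%E ->
  measurable_fun setT f -> (forall x, 0 <= f x)%E ->
  (\int[nu]_x f x = \int[mu]_x (f x * (k x)%:E))%E.
Proof.
move=> mk k0 nuE mf f0.
pose h := nnsfun_approx measurableT mf.
have hf x : (h n x)%:E @[n --> \oo] --> f x by exact: cvg_nnsfun_approx.
have -> : (\int[nu]_x f x = lim (\int[nu]_x (EFin \o h n) x @[n --> \oo]))%E.
  under eq_integral => x _ do rewrite -(cvg_lim _ (hf x))//.
  apply: monotone_convergence => //.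
  - by move=> n; exact/measurable_EFinP.
  - by move=> n x _ //=; rewrite lee_fin.
  - by move=> x _ a b ab; rewrite lee_fin; exact/lefP/nd_nnsfun_approx.
have -> : (\int[mu]_x (f x * (k x)%:E) =
    lim (\int[mu]_x ((h n x)%:E * (k x)%:E) @[n --> \oo]))%E.
  have fg x : ((h n x)%:E * (k x)%:E @[n --> \oo] --> f x * (k x)%:E)%E.
    by apply: cvgeZr => //; exact: hf.
  under eq_integral => x _ do rewrite -(cvg_lim _ (fg x))//.
  apply: monotone_convergence => [//| | |].
  - by move=> n; apply/emeasurable_funM; apply/measurable_EFinP.
  - by move=> n x _ /=; rewrite mule_ge0 ?lee_fin.
  - move=> x _ a b ab/=; rewrite lee_wpmul2r ?lee_fin//.
    exact/lefP/nd_nnsfun_approx.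
congr (lim (_ @ \oo)); apply/funext => n /=.
transitivity (\int[nu]_x
   (\sum_(y \in range (h n)) (y * \1_(h n @^-1` [set y]) x)%:E))%E.
  by apply: eq_integral => t tE; rewrite /= fimfunE -fsumEFin.
rewrite ge0_integral_fsum//; last 2 first.
- by move=> y; exact/measurable_EFinP/measurable_funM.
- by move=> m y Ey; exact: nnfun_muleindic_ge0.
transitivity (\int[mu]_x (\sum_(y \in range (h n))
    (y * \1_(h n @^-1` [set y]) x)%:E * (k x)%:E))%E; last first.
  apply: eq_integral => x _; rewrite -ge0_mule_fsuml; last first.
    by move=> y; exact: nnfun_muleindic_ge0.
  by rewrite fsumEFin // -(fimfunE _ x).
rewrite ge0_integral_fsum//; last 2 first.
- move=> y; apply: emeasurable_funM; last exact/measurable_EFinP.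
  exact/measurable_EFinP/measurable_funM.
- move=> m y Ey; apply: mule_ge0; last by rewrite lee_fin.
  exact: nnfun_muleindic_ge0.
apply: eq_fsbigr => r rhn.
have r0 : 0 <= r by move: rhn; rewrite inE => -[t _ <-].
rewrite integralZl_indic_nnsfun//.
under [RHS]eq_integral do rewrite EFinM -muleA.
rewrite ge0_integralZl//; last 2 first.
- apply: emeasurable_funM; last exact/measurable_EFinP.
  exact/measurable_EFinP.
- by move=> t Et; rewrite mule_ge0 ?lee_fin.
congr (_ * _)%E; rewrite integral_indic// setIT nuE//.
rewrite [LHS]integral_mkcond.
by apply: eq_integral => x _; rewrite epatch_indic muleC.
Qed.

End integral_density.

Lemma integrable_density d (T : measurableType d) (R : realType)
    (mu nu : {measure set T -> \bar R}) (k : T -> R) (f : T -> R) :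
  measurable_fun setT k -> (forall x, 0 <= k x) ->
  (forall A, measurable A -> nu A = \int[mu]_(x in A) (k x)%:E)%E ->
  nu.-integrable setT (EFin \o f) ->
  mu.-integrable setT (fun x => (f x * k x)%:E).
Proof.
move=> mk k0 nuE /integrableP[/measurable_EFinP mf fi].
apply/integrableP; split; first exact/measurable_EFinP/measurable_funM.
move: fi; rewrite (ge0_integral_density mk k0 nuE)//; last first.
  exact/measurableT_comp/measurable_EFinP.
congr (_ < _)%E; apply: eq_integral => x _.
by rewrite /= -EFinM normrM (ger0_norm (k0 x)).
Qed.

(** Positive and negative parts transform separately, so the two sides agree even where the integral
    takes a default value. *)
Lemma Rintegral_density d (T : measurableType d) (R : realType)
    (mu nu : {measure set T -> \bar R}) (k : T -> R) (f : T -> R) :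
  measurable_fun setT k -> (forall x, 0 <= k x) ->
  (forall A, measurable A -> nu A = \int[mu]_(x in A) (k x)%:E)%E ->
  measurable_fun setT f ->
  \int[nu]_x f x = \int[mu]_x (f x * k x).
Proof.
move=> mk k0 nuE mf; rewrite /Rintegral; congr fine.
have mEf : measurable_fun setT (EFin \o f) by exact/measurable_EFinP.
rewrite [LHS]integralE [RHS]integralE.
rewrite !(ge0_integral_density mk k0 nuE)//; last 2 first.
- exact: measurable_funeneg.
- exact: measurable_funepos.
have kE x : (0 <= (k x)%:E)%E by rewrite lee_fin.
congr (_ - _)%E; apply: eq_integral => x _.
- by rewrite !funeposE/= maxe_pMl// mul0e EFinM.
- rewrite !funenegE/= muleC maxe_pMr// mule0; congr maxe.
  by rewrite -EFinM mulrN mulrC.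
Qed.

(** * Norms and Lebesgue measure on R^d *)

Section Rd.
Context (R : realType) (d : nat).
Local Notation Rd := 'rV[R]_d.
Implicit Types (x y v : Rd).

Lemma continuous_measurable_rV (f : Rd -> R) :
  continuous f -> measurable_fun setT f.
Proof.
move=> cf; apply: (measurability _ (RGenOpens.measurableE R)).
move=> _ [_ [a [b ->]] <-]; rewrite setTI; apply: open_mx_measurable.
by apply: open_comp; [move=> x _; exact: cf|exact: interval_open].
Qed.

Lemma measurable_coord (i : 'I_d) :
  measurable_fun setT (fun x : Rd => x ord0 i).
Proof. by apply: continuous_measurable_rV => x; exact: coord_continuous. Qed.

Lemma coord_le_norm x (i : 'I_d) : `|x ord0 i| <= `|x|.
Proof.
rewrite [leRHS]/Num.norm/= mx_normrE.
by apply: (le_bigmax _ (fun ij => `|x ij.1 ij.2|) (ord0, i)).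
Qed.

Lemma norm_le x (a : R) : 0 <= a -> (forall i, `|x ord0 i| <= a) -> `|x| <= a.
Proof.
move=> a0 xa; rewrite [leLHS]/Num.norm/= mx_normrE.
by apply/bigmax_leP; split => // -[i j] _ /=; rewrite (ord1 i).
Qed.

Lemma dotv_ge0 x : 0 <= dotv x x.
Proof. by apply: sumr_ge0 => i _; rewrite -expr2 sqr_ge0. Qed.

Lemma enorm_ge0 x : 0 <= enorm x. Proof. exact: sqrtr_ge0. Qed.

Lemma enorm2 x : enorm x ^+ 2 = dotv x x.
Proof. by rewrite sqr_sqrtr// dotv_ge0. Qed.

Lemma norm_le_enorm x : `|x| <= enorm x.
Proof.
apply: norm_le; first exact: enorm_ge0.
move=> i; rewrite -(ler_pXn2r (ltn0Sn 1)) ?nnegrE ?enorm_ge0//.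
rewrite enorm2 /dotv (bigD1 i)//= real_normK ?num_real// expr2 lerDl.
by apply: sumr_ge0 => j _; rewrite -expr2 sqr_ge0.
Qed.

Lemma enorm2_le x : enorm x ^+ 2 <= d%:R * `|x| ^+ 2.
Proof.
rewrite enorm2 /dotv mulr_natl -[X in _ *+ X]card_ord -sumr_const.
apply: ler_sum => i _; rewrite -expr2 -(real_normK (num_real (x ord0 i))).
by rewrite ler_pXn2r ?nnegrE//; exact: coord_le_norm.
Qed.

(** The factor [d], in place of its square root, avoids roots in later constants. *)
Lemma enorm_le x : enorm x <= d%:R * `|x|.
Proof.
rewrite -(ler_pXn2r (ltn0Sn 1)) ?nnegrE ?enorm_ge0 ?mulr_ge0//.
apply: le_trans (enorm2_le x) _; rewrite exprMn ler_wpM2r ?sqr_ge0//.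
by rewrite -natrX ler_nat; case: (d) => // k; rewrite leq_pmulr.
Qed.

Lemma measurable_enorm d' (T : measurableType d') (f : T -> Rd) :
  (forall i, measurable_fun setT (fun z => f z ord0 i)) ->
  forall p, measurable_fun setT (fun z => enorm (f z) ^+ p).
Proof.
move=> mf p; apply: measurable_funX.
apply: (@measurableT_comp _ _ _ _ _ _ (@Num.sqrt R) _
  (fun z => dotv (f z) (f z))).
  by apply: continuous_measurable_fun; exact: sqrt_continuous.
by rewrite /dotv; apply: measurable_sum => i; exact: measurable_funM.
Qed.

Lemma measurable_norm_rV d' (T : measurableType d') (f : T -> Rd) :
  (forall i, measurable_fun setT (fun z => f z ord0 i)) ->
  measurable_fun setT (fun z => `|f z|).
Proof.
move=> mf; rewrite (_ : (fun z => _) =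
    (fun z => \big[Num.max/0]_(ij : 'I_1 * 'I_d) `|f z ij.1 ij.2|)); last first.
  by apply/funext => z; rewrite [LHS]/Num.norm/= mx_normrE.
elim: (index_enum _) => [|ij s IH].
  under eq_fun do rewrite big_nil; exact: measurable_cst.
under eq_fun do rewrite big_cons.
apply: measurable_maxr => //; apply: measurableT_comp => //.
by rewrite (ord1 ij.1); exact: mf.
Qed.

End Rd.

Lemma lebesgue_measure_shift (R : realType) (v : R) (A : set (measurableTypeR R)) :
  measurable A ->
  lebesgue_measure ((fun x : measurableTypeR R => (x + v : measurableTypeR R)) @^-1` A) = lebesgue_measure A.
Proof.
move=> mA.
have ms : measurable_fun setT
  (fun x : measurableTypeR R => x + v : measurableTypeR R).
  by apply: measurable_funD.
apply/esym/(@lebesgue_measure_unique _ (pushforward lebesgue_measure _)) => //.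
move=> _ [[a b]] _ <-; rewrite /pushforward.
rewrite [X in _ = lebesgue_measure X](_ : _ = `]a - v, b - v]%classic); last first.
  by apply/seteqP; split => x /=; rewrite !in_itv/= ltrBlDr lerBrDr.
rewrite !lebesgue_measure_itv/= !lte_fin ltrD2r.
by case: ifP => // _; congr (_%:E); ring.
Qed.

Section lebesgue_rV_theory.
Context (R : realType).

Lemma measurable_shift_rV n (v : 'rV[R]_n) :
  measurable_fun setT (fun x : 'rV[R]_n => x + v).
Proof.
apply: (@measurability _ _ _ _ _ _ (@open 'rV[R]_n)) => //.
move=> _ [B oB <-]; rewrite setTI; apply: open_mx_measurable.
apply: open_comp => // x _; exact: (@cvgD _ 'rV[R]_n _ (nbhs x) _ id (fun=> v) x v cvg_id (cvg_cst v)).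
Qed.

(** Induction on the dimension: a translation acts on the two factors separately, and a product
    measure is determined by its values on rectangles. *)
Lemma lebesgue_rV_shift n (v : 'rV[R]_n) A : measurable A ->
  lebesgue_rV R n ((fun x => x + v) @^-1` A) = lebesgue_rV R n A.
Proof.
elim: n v A => [|n IH] v A mA.
  by congr (lebesgue_rV R 0 _); apply/seteqP; split => x /=;
    rewrite (_ : x + v = x)//; apply/rowP => -[].
pose v0 : R := v ord0 ord0; pose v' : 'rV[R]_n := rsubmx (v : 'rV_(1 + n)).
pose s (p : measurableTypeR R * 'rV[R]_n) : measurableTypeR R * 'rV[R]_n :=
  (p.1 + v0, p.2 + v').
have ms : measurable_fun setT s.
  apply: measurable_fun_pair.
    by apply: measurable_funD => //; exact: measurable_fst.
  apply: (measurableT_comp (measurable_shift_rV v')).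
  exact: measurable_snd.
have mcA : measurable (@cons_rV R n @^-1` A).
  by rewrite -[X in measurable X]setTI; exact: measurable_cons_rV.
change ((lebesgue_measure \x lebesgue_rV R n)%E
    (@cons_rV R n @^-1` ((fun x => x + v) @^-1` A)) =
  (lebesgue_measure \x lebesgue_rV R n)%E (@cons_rV R n @^-1` A)).
rewrite (product_measure_unique (m' := pushforward
  (lebesgue_measure \x lebesgue_rV R n)%E s) _ mcA).
  rewrite /pushforward; congr (_ _); apply/seteqP.
  have E p : cons_rV p + v = cons_rV (s p).
    apply/rowP => j; rewrite /cons_rV !mxE.
    case: splitP => k jk; rewrite !mxE.
      congr (_ + v _ _); apply/val_inj => /=; rewrite jk.
      by move: k {jk} => [[]].
    by congr (_ + v _ _); apply/val_inj.
  by split => p /=; rewrite E.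
move=> B C mB mC; rewrite /pushforward.
transitivity ((lebesgue_measure \x lebesgue_rV R n)%E
  (((fun x : measurableTypeR R => x + v0 : measurableTypeR R) @^-1` B) `*`
   ((fun x => x + v') @^-1` C))) => //.
rewrite product_measure1E; last 2 first.
- rewrite -[X in measurable X]setTI; apply: measurable_funD => //.
- by rewrite -[X in measurable X]setTI; exact: measurable_shift_rV.
by congr (_ * _)%E; [exact: lebesgue_measure_shift|exact: IH].
Qed.

Lemma ge0_integral_shift n (v : 'rV[R]_n) (f : 'rV[R]_n -> \bar R) :
  measurable_fun setT f -> (forall x, 0 <= f x)%E ->
  (\int[lebesgue_rV R n]_x f (x + v)%R = \int[lebesgue_rV R n]_x f x)%E.
Proof.
move=> mf f0; have ms := measurable_shift_rV v.
rewrite -(ge0_integral_pushforward ms (lebesgue_rV R n) measurableT)//.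
by apply: eq_measure_integral => //= A mA _; exact: lebesgue_rV_shift.
Qed.

Lemma Rintegral_shift n (v : 'rV[R]_n) (f : 'rV[R]_n -> R) :
  measurable_fun setT f ->
  \int[lebesgue_rV R n]_x f (x + v) = \int[lebesgue_rV R n]_x f x.
Proof.
move=> mf; rewrite /Rintegral; congr fine.
have mEf : measurable_fun setT (EFin \o f) by exact/measurable_EFinP.
rewrite [LHS]integralE [RHS]integralE; congr (_ - _)%E.
- rewrite -[RHS](ge0_integral_shift v)//; last exact: measurable_funepos.
  by apply: eq_integral => x _; rewrite !funeposE.
- rewrite -[RHS](ge0_integral_shift v)//; last exact: measurable_funeneg.
  by apply: eq_integral => x _; rewrite !funenegE.
Qed.

(** Balls of the sup norm are cubes, hence products of an interval and a lower-dimensional ball. *)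
Lemma lebesgue_rV_ball n (x : 'rV[R]_n) (r : R) : 0 < r ->
  lebesgue_rV R n (ball x r) = ((r *+ 2) ^+ n)%:E.
Proof.
move=> r0; elim: n x => [|n IH] x.
  by rewrite expr0 /= diracE mem_set//; split => // i [].
change ((lebesgue_measure \x lebesgue_rV R n)%E
    (@cons_rV R n @^-1` ball x r) = ((r *+ 2) ^+ n.+1)%:E).
pose x' : 'rV[R]_n := rsubmx (x : 'rV_(1 + n)).
have -> : @cons_rV R n @^-1` ball x r =
    (ball (x ord0 ord0 : R) r : set (measurableTypeR R)) `*` ball x' r.
  have xE : x = cons_rV (x ord0 ord0, x').
    apply/rowP => j; rewrite /cons_rV !mxE.
    case: splitP => k jk; rewrite !mxE; congr (x _ _); apply/val_inj => //=.
    by rewrite jk; move: k {jk} => [[]].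
  apply/seteqP; split => p /=.
    move=> [_ xp]; split.
      have := xp ord0 ord0; rewrite /cons_rV mxE; case: splitP => // k _.
      by rewrite mxE.
    split => // i j; have := xp ord0 (rshift 1 j).
    have -> : cons_rV p ord0 (rshift 1 j) = p.2 ord0 j.
      exact: (row_mxEr (const_mx p.1 : 'rV_1) p.2 ord0 j).
    by rewrite (ord1 i) mxE.
  by move=> [p1 p2]; rewrite xE; exact: cons_rV_ball.
rewrite product_measure1E.
- rewrite IH exprS EFinM; congr (_ * _)%E.
  by have := lebesgue_measure_ball (x ord0 ord0) (ltW r0).
- exact: measurable_ball.
  by apply: open_mx_measurable; apply: ball_open.
Qed.

Lemma lebesgue_rV_bounded n (A : set 'rV[R]_n) (r : R) : measurable A ->
  (forall x, A x -> `|x| <= r) -> (lebesgue_rV R n A < +oo)%E.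
Proof.
move=> mA Ar; have r1 : 0 < `|r| + 1 by rewrite ltr_wpDl.
apply: (@le_lt_trans _ _ (lebesgue_rV R n (ball 0 (`|r| + 1)))).
  apply: le_measure; rewrite ?inE//.
    by apply: open_mx_measurable; apply: ball_open.
  move=> x /Ar xr; rewrite mx_norm_ball /ball_/= sub0r normrN.
  by rewrite (le_lt_trans xr)// (le_lt_trans (ler_norm _))// ltrDl.
by rewrite lebesgue_rV_ball// ltry.
Qed.

End lebesgue_rV_theory.

(** * Couplings and Wasserstein distance *)

(** Equality with the push-forward is asked on measurable sets only, which is all that a coupling
    provides about its marginals. *)
Lemma ge0_integral_transfer d1 d2 (X : measurableType d1) (Y : measurableType d2)
    (R : realType) (mu : {measure set X -> \bar R})
    (nu : {measure set Y -> \bar R}) (phi : X -> Y) (f : Y -> \bar R) :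
  measurable_fun setT phi ->
  (forall A, measurable A -> mu (phi @^-1` A) = nu A) ->
  measurable_fun setT f -> (forall y, 0 <= f y)%E ->
  (\int[mu]_x f (phi x) = \int[nu]_y f y)%E.
Proof.
move=> mphi munu mf f0.
rewrite -(ge0_integral_pushforward mphi mu measurableT)//.
by apply: eq_measure_integral => //= A mA _; exact: munu.
Qed.

Lemma Rintegral_transfer d1 d2 (X : measurableType d1) (Y : measurableType d2)
    (R : realType) (mu : {measure set X -> \bar R})
    (nu : {measure set Y -> \bar R}) (phi : X -> Y) (f : Y -> R) :
  measurable_fun setT phi ->
  (forall A, measurable A -> mu (phi @^-1` A) = nu A) ->
  measurable_fun setT f ->
  \int[mu]_x f (phi x) = \int[nu]_y f y.
Proof.
move=> mphi munu mf; rewrite /Rintegral; congr fine.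
have mEf : measurable_fun setT (EFin \o f) by exact/measurable_EFinP.
rewrite [LHS]integralE [RHS]integralE; congr (_ - _)%E.
- rewrite -[RHS](ge0_integral_transfer mphi munu)//; last exact: measurable_funepos.
  by apply: eq_integral => x _; rewrite !funeposE.
- rewrite -[RHS](ge0_integral_transfer mphi munu)//; last exact: measurable_funeneg.
  by apply: eq_integral => x _; rewrite !funenegE.
Qed.

Section wasserstein_bounds.
Context (R : realType) (d : nat).
Local Notation Rd := 'rV[R]_d.
Implicit Types (m : prob R d) (g : probability (Rd * Rd)%type R).

Definition cost g := (\int[g]_z (enorm (z.1 - z.2)%R ^+ 2)%:E)%E.

Lemma cost_ge0 g : (0 <= cost g)%E.
Proof. by apply: integral_ge0 => z _; rewrite lee_fin sqr_ge0. Qed.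

Lemma measurable_prod_sub i :
  measurable_fun setT (fun z : Rd * Rd => (z.1 - z.2) ord0 i).
Proof.
under eq_fun do rewrite mxE mxE.
apply: measurable_funB; apply: (measurableT_comp (measurable_coord i)).
  exact: measurable_fst.
exact: measurable_snd.
Qed.

Lemma measurable_cost :
  measurable_fun setT (fun z : Rd * Rd => enorm (z.1 - z.2) ^+ 2).
Proof. apply: measurable_enorm. exact: measurable_prod_sub. Qed.

Lemma measurable_norm : measurable_fun setT (fun x : Rd => `|x|).
Proof. exact: (@measurable_norm_rV _ _ _ _ id (@measurable_coord R d)). Qed.

Lemma measurable_enorm2 : measurable_fun setT (fun x : Rd => enorm x ^+ 2).
Proof. exact: (@measurable_enorm _ _ _ _ id (@measurable_coord R d)). Qed.

Lemma coupling_fst m m' g : couplings m m' g ->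
  forall A, measurable A -> g (fst @^-1` A) = m A.
Proof.
by move=> [gm _] A mA; rewrite -gm//; congr (g _); apply/seteqP; split=> z //= -[].
Qed.

Lemma coupling_snd m m' g : couplings m m' g ->
  forall A, measurable A -> g (snd @^-1` A) = m' A.
Proof.
by move=> [_ gm] A mA; rewrite -gm//; congr (g _); apply/seteqP; split=> z //= -[].
Qed.

Lemma wasserstein_ge0 m m' : 0 <= wasserstein 2 m m'.
Proof. exact: powR_ge0. Qed.

Lemma wasserstein_le m m' g (c : R) : 0 <= c -> couplings m m' g ->
  (cost g <= (c ^+ 2)%:E)%E -> wasserstein 2 m m' <= c.
Proof.
move=> c0 gm gc; rewrite /wasserstein; set I := ereal_inf _.
have I0 : (0 <= I)%E by apply/ereal_infP => _ [h _ <-]; exact: cost_ge0.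
have Ic : (I <= (c ^+ 2)%:E)%E by apply: le_trans gc; apply: ereal_inf_lbound; exists g.
rewrite powR12_sqrt ?fine_ge0//.
rewrite -(ler_pXn2r (ltn0Sn 1)) ?nnegrE ?sqrtr_ge0// sqr_sqrtr ?fine_ge0//.
have If : I \is a fin_num by rewrite ge0_fin_numE// (le_lt_trans Ic)// ltry.
by rewrite -lee_fin fineK.
Qed.

(** The reference measures are free: they are the marginals themselves for the partition coupling,
    and the Lebesgue measure and [m] for the smoothing of [m]. *)
Lemma density_coupling m m' (mu nu : {sigma_finite_measure set Rd -> \bar R})
    (k : Rd * Rd -> R) (c : R) : 0 <= c ->
  measurable_fun setT k -> (forall z, 0 <= k z) ->
  (forall A, measurable A ->
    \int[mu \x nu]_(z in A `*` setT) (k z)%:E = m A)%E ->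
  (forall A, measurable A ->
    \int[mu \x nu]_(z in setT `*` A) (k z)%:E = m' A)%E ->
  (\int[mu \x nu]_z (enorm (z.1 - z.2) ^+ 2 * k z)%R%:E <= (c ^+ 2)%:E)%E ->
  wasserstein 2 m m' <= c.
Proof.
move=> c0 mk k0 km km' kc.
have k1 : (\int[mu \x nu]_z (k z)%:E = 1)%E.
  by rewrite -setXTT km ?probability_setT.
have [g gE] := ex_density_probability mk k0 k1.
apply: (@wasserstein_le _ _ g) => //.
  split => A mA; rewrite gE ?km ?km'//; exact: measurableX.
rewrite /cost (ge0_integral_density mk k0 gE)//; last 2 first.
- apply/measurable_EFinP; exact: measurable_cost.
- by move=> z; rewrite lee_fin sqr_ge0.
Qed.

Lemma Pp2_integrable m (f : Rd -> R) (C : R) : Pp 2 m ->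
  measurable_fun setT f -> (forall x, `|f x| <= C * (1 + `|x| ^+ 2)) ->
  m.-integrable setT (EFin \o f).
Proof.
move=> m2 mf fC.
apply: (@le_integrable _ _ _ _ _ _ _ (fun x => C%:E * (1 + (enorm x ^+ 2)%:E))%E) => //.
- exact/measurable_EFinP.
- move=> x _ /=; rewrite lee_fin (le_trans (fC x))//.
  have C0 : 0 <= C.
    have := le_trans (normr_ge0 _) (fC 0).
    by rewrite normr0 expr0n/= addr0 mulr1.
  rewrite ger0_norm ?mulr_ge0 ?addr_ge0 ?sqr_ge0//.
  by rewrite ler_wpM2l// lerD2l ler_pXn2r ?nnegrE ?enorm_ge0// norm_le_enorm.
- apply: integrableZl => //; apply: integrableD => //.
    exact: finite_measure_integrable_cst.
  apply/integrableP; split.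
    apply/measurable_EFinP; exact: measurable_enorm2.
  move: m2; rewrite /Pp/=; congr (_ < _)%E; apply: eq_integral => x _ /=.
  by rewrite ger0_norm ?sqr_ge0.
Qed.

Lemma bounded_integrable m (f : Rd -> R) (C : R) :
  measurable_fun setT f -> (forall x, `|f x| <= C) ->
  m.-integrable setT (EFin \o f).
Proof.
move=> mf fC; apply: (@le_integrable _ _ _ _ _ _ _ (fun=> C%:E)%E) => //.
- exact/measurable_EFinP.
- move=> x _ /=; rewrite lee_fin (le_trans (fC x))// ler_norm//.
- exact: finite_measure_integrable_cst.
Qed.

Lemma prob_Rintegral_cst m (c : R) : \int[m]_x c = c.
Proof.
by rewrite Rintegral_cst// (_ : fine _ = 1) ?mulr1//; have /(congr1 fine) := probability_setT m.
Qed.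

(** The product coupling has finite cost, so the infimum is finite; an infinite one would be turned
    into 0 by [fine] and the distance would say nothing about couplings. *)
Lemma wasserstein_coupling m m' (e : R) : Pp 2 m -> Pp 2 m' -> 0 < e ->
  exists2 g, couplings m m' g & (cost g <= ((wasserstein 2 m m' + e) ^+ 2)%:E)%E.
Proof.
move=> m2 m2' e0.
have [g gE] : exists g : probability (Rd * Rd)%type R,
    forall A, measurable A -> g A = (\int[m \x m']_(z in A) 1%:E)%E.
  apply: ex_density_probability => //.
  transitivity ((m \x m')%E (setT `*` setT)).
    by rewrite setXTT integral_cst// mul1e.
  rewrite product_measure1E// -[RHS]mule1.
  by congr (_ * _)%E; exact: probability_setT.
have gc : couplings m m' g.
  split => A mA; rewrite gE; try exact: measurableX.
    transitivity ((m \x m')%E (A `*` setT)).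
      by rewrite integral_cst ?mul1e//; exact: measurableX.
    rewrite product_measure1E// -[RHS]mule1.
    by congr (_ * _)%E; exact: probability_setT.
  transitivity ((m \x m')%E (setT `*` A)).
    by rewrite integral_cst ?mul1e//; exact: measurableX.
  rewrite product_measure1E// -[RHS]mul1e.
  by congr (_ * _)%E; exact: probability_setT.
(* Uses |x - y|^2 <= 2 |x|^2 + 2 |y|^2 and the finite second moments. *)
have gfin : (cost g < +oo)%E.
  pose f (x : Rd) := (2 * enorm x ^+ 2)%:E.
  have mf : measurable_fun setT f.
    by apply/measurable_EFinP; apply: measurable_funM => //; exact: measurable_enorm2.
  have f0 x : (0 <= f x)%E by rewrite lee_fin mulr_ge0 ?sqr_ge0.
  apply: (@le_lt_trans _ _ (\int[g]_z (f z.1 + f z.2))%E).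
    apply: ge0_le_integral => //.
    - by move=> z _; rewrite lee_fin sqr_ge0.
    - apply/measurable_EFinP; exact: measurable_cost.
    - apply: emeasurable_funD; first exact: (measurableT_comp mf measurable_fst).
      exact: (measurableT_comp mf measurable_snd).
    - move=> z _; rewrite -EFinD lee_fin !enorm2 /dotv !mulr_sumr -big_split/=.
      apply: ler_sum => i _; rewrite !mxE.
      have := sqr_ge0 (z.1 ord0 i + z.2 ord0 i); nra.
  rewrite ge0_integralD//; last 2 first.
  - exact: (measurableT_comp mf measurable_fst).
  - exact: (measurableT_comp mf measurable_snd).
  rewrite (ge0_integral_transfer measurable_fst (coupling_fst gc))//.
  rewrite (ge0_integral_transfer measurable_snd (coupling_snd gc))//.
  rewrite /f; under eq_integral do rewrite EFinM.
  under [X in (_ + X)%E]eq_integral do rewrite EFinM.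
  have me : measurable_fun setT (fun x : Rd => (enorm x ^+ 2)%:E).
    apply/measurable_EFinP; exact: measurable_enorm2.
  have e0' (x : Rd) : setT x -> (0 <= (enorm x ^+ 2)%:E)%E by rewrite lee_fin sqr_ge0.
  by rewrite !ge0_integralZl_EFin// lte_add_pinfty// lte_mul_pinfty// ?lee_fin.
set I := ereal_inf [set (\int[g]_z (enorm (z.1 - z.2) ^+ 2)%:E)%E
                  | g in couplings m m'].
have I0 : (0 <= I)%E by apply/ereal_infP => _ [h _ <-]; exact: cost_ge0.
have If : I \is a fin_num.
  by rewrite ge0_fin_numE// (le_lt_trans _ gfin)//; apply: ereal_inf_lbound; exists g.
have WE : (I = (wasserstein 2 m m' ^+ 2)%:E)%E.
  rewrite /wasserstein powR12_sqrt ?fine_ge0// sqr_sqrtr ?fine_ge0//.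
  by rewrite fineK.
have W0 := wasserstein_ge0 m m'.
have q0 : 0 < (wasserstein 2 m m' + e) ^+ 2 - wasserstein 2 m m' ^+ 2.
  by rewrite subr_gt0 ltr_pXn2r ?nnegrE// ?ltrDl// addr_ge0// ltW.
have [_ [h hc <-] hI] := lb_ereal_inf_adherent q0 If.
exists h => //; apply/ltW/(lt_le_trans hI).
by rewrite -/I WE -EFinD lee_fin addrC subrK.
Qed.

End wasserstein_bounds.

(** * Bounded functions with bounded support *)

Section bounded_support.
Context (R : realType) (d : nat).
Local Notation Rd := 'rV[R]_d.
Local Notation leb := (lebesgue_rV R d).

Definition cball (r : R) := [set x : Rd | `|x| <= r].

Lemma measurable_cball r : measurable (cball r).
Proof.
rewrite -[cball r]setTI; apply: (@measurable_norm R d measurableT [set y | y <= r]).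
by rewrite -set_itvNyc; exact: measurable_itv.
Qed.

Lemma cball_fin r : (leb (cball r) < +oo)%E.
Proof. by apply: (lebesgue_rV_bounded (measurable_cball r)) => x; exact. Qed.

Lemma compact_cball r : compact (cball r).
Proof.
apply: bounded_closed_compact.
  exists r; split; first exact: num_real.
  by move=> M rM x /= xr; rewrite (le_trans xr)// ltW.
rewrite (_ : cball r = (fun x : Rd => `|x|) @^-1` [set y | y <= r])//.
apply: closed_comp; last exact: closed_le.
by move=> x _; exact: norm_continuous.
Qed.

Lemma integrable_cball r (c : R) : leb.-integrable setT (EFin \o (fun x => c * \1_(cball r) x)).
Proof.
have mB := measurable_cball r.
have iI : leb.-integrable setT (EFin \o (\1_(cball r) : Rd -> R)).
  apply/integrableP; split; first exact/measurable_EFinP.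
  rewrite (_ : \int[leb]_x _ = leb (cball r))%E; first exact: cball_fin.
  transitivity (\int[leb]_x (\1_(cball r) x)%:E)%E.
    by apply: eq_integral => x _ /=; rewrite ger0_norm.
  by rewrite integral_indic// setIT.
by have := integrableZl measurableT c iI.
Qed.

Variables (f : Rd -> R) (K r : R).
Hypotheses (mf : measurable_fun setT f) (fK : forall x, `|f x| <= K)
  (fr : forall x, r < `|x| -> f x = 0).

Lemma bounded_support_le x : `|f x| <= K * \1_(cball r) x.
Proof.
rewrite indicE; have [xr|xr] := leP `|x| r; first by rewrite mem_set// mulr1.
by rewrite fr// normr0 mulr_ge0//; exact: le_trans (fK x).
Qed.

Lemma bounded_support_integrable : leb.-integrable setT (EFin \o f).
Proof.
apply: (le_integrable measurableT _ _ (integrable_cball r K)).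
  exact/measurable_EFinP.
by move=> x _ /=; rewrite lee_fin (le_trans (bounded_support_le x))// ler_norm.
Qed.

Lemma bounded_support_Rintegral :
  `|\int[leb]_x f x| <= K * fine (leb (cball r)).
Proof.
have fi := bounded_support_integrable.
apply: (le_trans (le_normr_Rintegral measurableT fi)).
apply: (@le_trans _ _ (\int[leb]_x (K * \1_(cball r) x))).
  apply: le_Rintegral => //; first exact: (integrable_norm fi).
    exact: integrable_cball.
  by move=> x _; exact: bounded_support_le.
have := integrable_cball r 1; under eq_fun do rewrite mul1r.
move=> iI; rewrite RintegralZl// le_eqVlt; apply/orP; left; apply/eqP; congr (_ * _).
rewrite /Rintegral integral_indic ?setIT//; exact: measurable_cball.
Qed.

End bounded_support.

(** Minkowski's inequality in L^2 from the pointwise bound (V + H)^2 <= (1 + w / b) V^2 + (1 + b /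
    w) H^2, whose weights turn the bounds b^2 and w^2 into exactly (b + w)^2. *)
Lemma minkowski_sqr d (T : measurableType d) (R : realType)
    (mu : {measure set T -> \bar R}) (u v h : T -> R) (b w : R) :
  measurable_fun setT u -> measurable_fun setT v -> measurable_fun setT h ->
  (forall z, `|u z| <= `|v z| + h z) -> 0 < b -> 0 < w ->
  (\int[mu]_z (v z ^+ 2)%:E <= (b ^+ 2)%:E)%E ->
  (\int[mu]_z (h z ^+ 2)%:E <= (w ^+ 2)%:E)%E ->
  (\int[mu]_z (u z ^+ 2)%:E <= ((b + w) ^+ 2)%:E)%E.
Proof.
move=> mu_ mv mh uvh b0 w0 vb hw.
have mX (f : T -> R) : measurable_fun setT f ->
    measurable_fun setT (fun z => (f z ^+ 2)%:E).
  by move=> mf; apply/measurable_EFinP; exact: measurable_funX.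
have mM (c : R) (f : T -> R) : measurable_fun setT f ->
    measurable_fun setT (fun z => (c%:E * (f z ^+ 2)%:E)%E).
  by move=> mf; apply: emeasurable_funM => //; exact: mX.
have c1 : 0 <= 1 + w / b by rewrite addr_ge0// ltW// divr_gt0.
have c2 : 0 <= 1 + b / w by rewrite addr_ge0// ltW// divr_gt0.
apply: (@le_trans _ _ (\int[mu]_z ((1 + w / b)%:E * (v z ^+ 2)%:E +
    (1 + b / w)%:E * (h z ^+ 2)%:E))%E).
  apply: ge0_le_integral => //.
  - by move=> z _; rewrite lee_fin sqr_ge0.
  - exact: mX.
  - by apply: emeasurable_funD; exact: mM.
  - move=> z _; rewrite -!EFinM -EFinD lee_fin.
    have h0 : `|u z| ^+ 2 <= (`|v z| + h z) ^+ 2.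
      by rewrite ler_pXn2r ?nnegrE//; exact: le_trans (uvh z).
    rewrite real_normK ?num_real// in h0.
    apply: le_trans h0 _; rewrite -(real_normK (num_real (v z))).
    set V := `|v z|; set H := h z.
    have -> : (1 + w / b) * V ^+ 2 + (1 + b / w) * H ^+ 2 =
      (V + H) ^+ 2 + (w * V - b * H) ^+ 2 / (b * w).
      by field; rewrite !gt_eqF.
    by rewrite lerDl divr_ge0 ?sqr_ge0// mulr_ge0// ltW.
rewrite ge0_integralD//.
- rewrite !ge0_integralZl_EFin//; last 4 first.
  + by move=> z _; rewrite lee_fin sqr_ge0.
  + exact: mX.
  + by move=> z _; rewrite lee_fin sqr_ge0.
  + exact: mX.
  have -> : (b + w) ^+ 2 = (1 + w / b) * b ^+ 2 + (1 + b / w) * w ^+ 2.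
    by field; rewrite !gt_eqF.
  rewrite (EFinD (_ * _)) (EFinM (1 + w / b)) (EFinM (1 + b / w)).
  by apply: leeD; exact: lee_wpmul2l.
- by move=> z _; rewrite mule_ge0 ?lee_fin ?sqr_ge0.
- exact: mM.
- by move=> z _; rewrite mule_ge0 ?lee_fin ?sqr_ge0.
- exact: mM.
Qed.

(** * Lipschitz functions and the Wasserstein distance *)

Section lipschitz.
Context (R : realType) (d : nat).
Local Notation Rd := 'rV[R]_d.
Implicit Types (m : prob R d) (psi f : Rd -> R).

(* Lipschitz bounds are taken for the sup norm, which is dominated by the
   Euclidean one. *)
Definition lip (L : R) f := forall x y, `|f x - f y| <= L * `|x - y|.

Lemma lip_continuous L f : lip L f -> continuous f.
Proof.
move=> fL x A /nbhs_ballP[e /= e0 eA].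
apply/nbhs_ballP; exists (e / (`|L| + 1)) => /=; first by rewrite divr_gt0.
move=> y; rewrite mx_norm_ball /ball_/= ltr_pdivlMr// mulrC => xy.
apply: eA; apply: (le_lt_trans (fL x y)); apply: le_lt_trans xy.
by rewrite ler_wpM2r// (le_trans (ler_norm _))// lerDl.
Qed.

Lemma lip_measurable L f : lip L f -> measurable_fun setT f.
Proof. by move=> /lip_continuous/continuous_measurable_rV. Qed.

Lemma lip_growth L f : lip L f ->
  exists2 C, 0 <= C & forall x, f x ^+ 2 <= C * (1 + `|x| ^+ 2).
Proof.
move=> fL; exists (2 * `|f 0| ^+ 2 + 2 * `|L| ^+ 2).
  by rewrite addr_ge0// mulr_ge0// sqr_ge0.
move=> x; have := fL x 0; rewrite subr0 => h.
have {}h : `|f x| <= `|f 0| + `|L| * `|x|.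
  rewrite -lerBlDl (le_trans (lerB_dist _ _))// (le_trans h)//.
  by rewrite ler_wpM2r// ler_norm.
have h2 : `|f x| ^+ 2 <= (`|f 0| + `|L| * `|x|) ^+ 2 by rewrite ler_pXn2r ?nnegrE.
rewrite real_normK ?num_real// in h2.
apply: (le_trans h2).
have := sqr_ge0 (`|f 0| - `|L| * `|x|); have := sqr_ge0 (`|f 0| * `|x|).
have := sqr_ge0 `|L|.
set a := `|f 0|; set b := `|L|; set c := `|x|; nra.
Qed.

Lemma lip_sqr_integrable L f m : lip L f -> Pp 2 m ->
  m.-integrable setT (EFin \o (fun x => f x ^+ 2)).
Proof.
move=> fL m2; have [C C0 fC] := lip_growth fL.
apply: (Pp2_integrable m2 (C := C)).
  by apply: measurable_funX; exact: lip_measurable fL.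
by move=> x; rewrite ger0_norm ?sqr_ge0.
Qed.

Definition rms psi m : R := Num.sqrt (\int[m]_x (psi x ^+ 2)).

Lemma rms_ge0 psi m : 0 <= rms psi m. Proof. exact: sqrtr_ge0. Qed.

Lemma rms_sqr psi m : rms psi m ^+ 2 = \int[m]_x (psi x ^+ 2).
Proof. by rewrite sqr_sqrtr//; apply: Rintegral_ge0 => x _; exact: sqr_ge0. Qed.

Lemma rms_sqrE L psi m : lip L psi -> Pp 2 m ->
  ((rms psi m ^+ 2)%:E = \int[m]_x (psi x ^+ 2)%:E)%E.
Proof.
move=> pL m2; rewrite rms_sqr fineK//.
exact: integrable_fin_num (lip_sqr_integrable pL m2).
Qed.

Lemma lip1_coupling psi (z : Rd * Rd) : lip 1 psi ->
  `|psi z.1| <= `|psi z.2| + enorm (z.1 - z.2).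
Proof.
move=> p1; rewrite -lerBlDl (le_trans (lerB_dist _ _))//.
by rewrite (le_trans (p1 _ _))// mul1r norm_le_enorm.
Qed.

Lemma rms_coupling m m' g psi (w : R) : Pp 2 m -> Pp 2 m' -> couplings m m' g ->
  0 < w -> (cost g <= (w ^+ 2)%:E)%E -> lip 1 psi ->
  rms psi m <= rms psi m' + w /\ rms psi m' <= rms psi m + w.
Proof.
move=> m2 m2' gm w0 gw p1; have mp := lip_measurable p1.
have me : measurable_fun setT (fun z : Rd * Rd => enorm (z.1 - z.2)).
  have := @measurable_enorm R d _ (Rd * Rd)%type (fun z => z.1 - z.2) (@measurable_prod_sub R d) 1.
  by under eq_fun do rewrite expr1.
have mp2 : measurable_fun setT (fun x => (psi x ^+ 2)%:E).
  by apply/measurable_EFinP; exact: measurable_funX.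
have p20 x : (0 <= (psi x ^+ 2)%:E)%E by rewrite lee_fin sqr_ge0.
have E1 := ge0_integral_transfer measurable_fst (coupling_fst gm) mp2 p20.
have E2 := ge0_integral_transfer measurable_snd (coupling_snd gm) mp2 p20.
have mp1 := measurableT_comp mp (@measurable_fst _ _ Rd Rd).
have mp2' := measurableT_comp mp (@measurable_snd _ _ Rd Rd).
have T0 := rms_ge0 psi.
have le_sqr (a b : R) : 0 <= a -> a <= b -> ((a ^+ 2)%:E <= (b ^+ 2)%:E)%E.
  by move=> a0 ab; rewrite lee_fin ler_pXn2r ?nnegrE// (le_trans a0).
(* The margin [e] makes the first norm bound positive, as [minkowski_sqr] requires, even when [rms]
   vanishes. *)
split; apply/ler_addgt0Pr => e e0; rewrite addrAC; have e0' := ltW e0.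
- have A : 0 <= rms psi m' + e + w by rewrite !addr_ge0// ltW.
  rewrite -(ler_pXn2r (ltn0Sn 1)) ?nnegrE// -lee_fin (rms_sqrE p1)// -E1.
  apply: (minkowski_sqr mp1 mp2' me) => //.
  + by move=> z; exact: lip1_coupling.
  + by rewrite ltr_wpDl.
  + by rewrite E2 -(rms_sqrE p1)// le_sqr// lerDl.
- have A : 0 <= rms psi m + e + w by rewrite !addr_ge0// ltW.
  rewrite -(ler_pXn2r (ltn0Sn 1)) ?nnegrE// -lee_fin (rms_sqrE p1)// -E2.
  apply: (minkowski_sqr mp2' mp1 me) => //.
  + move=> z; rewrite -lerBlDl (le_trans (lerB_dist _ _))//.
    by rewrite (le_trans (p1 _ _))// mul1r distrC norm_le_enorm.
  + by rewrite ltr_wpDl.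
  + by rewrite E1 -(rms_sqrE p1)// le_sqr// lerDl.
Qed.

Lemma rms_wasserstein m m' psi : Pp 2 m -> Pp 2 m' -> lip 1 psi ->
  `|rms psi m - rms psi m'| <= wasserstein 2 m m'.
Proof.
move=> m2 m2' p1; apply/ler_addgt0Pr => e e0.
have [g gm gc] := wasserstein_coupling m2 m2' e0.
have w0 : 0 < wasserstein 2 m m' + e by rewrite ltr_wpDl ?wasserstein_ge0.
have [h1 h2] := rms_coupling m2 m2' gm w0 gc p1.
by rewrite ler_norml; apply/andP; split; lra.
Qed.

(** Along a coupling of cost at most w^2, the pointwise bound E <= w / 2 + E^2 / (2 w) plays the
    role of the Cauchy-Schwarz inequality between the first and second moments of the displacement
    [E]. *)
Lemma lip_integral_wasserstein m m' f (L C : R) : Pp 2 m -> Pp 2 m' ->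
  0 <= L -> lip L f -> (forall x, `|f x| <= C) ->
  `|\int[m]_x f x - \int[m']_x f x| <= L * wasserstein 2 m m'.
Proof.
move=> m2 m2' L0 fL fC; apply/ler_addgt0Pr => e e0.
(* [L + 1] covers the case [L = 0]. *)
have e1 : 0 < e / (L + 1) by rewrite divr_gt0// ltr_wpDl.
have [g gm gc] := wasserstein_coupling m2 m2' e1.
set w := wasserstein 2 m m' + e / (L + 1) in gc.
have w0 : 0 < w by rewrite ltr_wpDl ?wasserstein_ge0.
have mf := lip_measurable fL.
rewrite -(Rintegral_transfer measurable_fst (coupling_fst gm) mf).
rewrite -(Rintegral_transfer measurable_snd (coupling_snd gm) mf).
have mf1 := measurableT_comp mf (@measurable_fst _ _ Rd Rd).
have mf2 := measurableT_comp mf (@measurable_snd _ _ Rd Rd).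
have i1 : g.-integrable setT (EFin \o (fun z : Rd * Rd => f z.1)).
  apply: (@le_integrable _ _ _ _ _ _ _ (fun=> C%:E)%E) => //.
  - exact/measurable_EFinP.
  - by move=> x _ /=; rewrite lee_fin (le_trans (fC _))// ler_norm.
  - exact: finite_measure_integrable_cst.
have i2 : g.-integrable setT (EFin \o (fun z : Rd * Rd => f z.2)).
  apply: (@le_integrable _ _ _ _ _ _ _ (fun=> C%:E)%E) => //.
  - exact/measurable_EFinP.
  - by move=> x _ /=; rewrite lee_fin (le_trans (fC _))// ler_norm.
  - exact: finite_measure_integrable_cst.
rewrite -RintegralB//.
have iB := integrableB measurableT i1 i2.
apply: (le_trans (le_normr_Rintegral measurableT iB)).
have cf : cost g \is a fin_num.
  by rewrite ge0_fin_numE ?cost_ge0// (le_lt_trans gc)// ltry.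
pose h (z : Rd * Rd) := L * (w / 2) + L * (2 * w)^-1 * enorm (z.1 - z.2) ^+ 2.
have ic : g.-integrable setT (EFin \o (fun z : Rd * Rd => enorm (z.1 - z.2) ^+ 2)).
  apply/integrableP; split; first by apply/measurable_EFinP; exact: measurable_cost.
  rewrite (_ : \int[g]_x _ = cost g)%E ?ltey_eq ?cf//.
  by apply: eq_integral => z _ /=; rewrite ger0_norm ?sqr_ge0.
have icc c : g.-integrable setT (EFin \o (fun z : Rd * Rd => c)).
  exact: finite_measure_integrable_cst.
have icm : g.-integrable setT (EFin \o (fun z : Rd * Rd => L * (2 * w)^-1 * enorm (z.1 - z.2) ^+ 2)).
  by have := integrableZl measurableT (L * (2 * w)^-1) ic.
apply: (@le_trans _ _ (\int[g]_z h z)).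
  apply: le_Rintegral => //.
  - exact: (integrable_norm iB).
  - exact: (integrableD measurableT (icc _) icm).
  - move=> z _; apply: (le_trans (fL _ _)).
    apply: (@le_trans _ _ (L * enorm (z.1 - z.2))); first by rewrite ler_wpM2l// norm_le_enorm.
    rewrite /h -mulrA -mulrDr ler_wpM2l//.
    set E := enorm _; rewrite -subr_ge0.
    have -> : w / 2 + (2 * w)^-1 * E ^+ 2 - E = (w - E) ^+ 2 / (2 * w).
      by field; rewrite gt_eqF.
    by rewrite divr_ge0 ?sqr_ge0// mulr_ge0// ltW.
rewrite RintegralD// RintegralZl// Rintegral_cst//.
rewrite (_ : fine _ = 1) ?mulr1; last by have /(congr1 fine) := probability_setT g.
have gw : \int[g]_z (enorm (z.1 - z.2) ^+ 2) <= w ^+ 2.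
  by rewrite -lee_fin fineK.
apply: (@le_trans _ _ (L * (w / 2) + L * (2 * w)^-1 * w ^+ 2)).
  rewrite lerD2l RintegralZl// ler_wpM2l//.
  by rewrite mulr_ge0// invr_ge0 mulr_ge0// ltW.
have -> : L * (w / 2) + L * (2 * w)^-1 * w ^+ 2 = L * w.
  by field; rewrite gt_eqF.
rewrite /w mulrDr lerD2l mulrCA ger_pMr// ler_pdivrMr ?ltr_wpDl// mul1r.
by rewrite lerDl.
Qed.

End lipschitz.

(** * A sufficient condition for convergence in d_2 *)

Lemma ge0_integral_prod d1 d2 (X : measurableType d1) (Y : measurableType d2)
    (R : realType) (mu : {sigma_finite_measure set X -> \bar R})
    (nu : {sigma_finite_measure set Y -> \bar R})
    (u : X -> \bar R) (v : Y -> \bar R) :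
  measurable_fun setT u -> measurable_fun setT v ->
  (forall x, 0 <= u x)%E -> (forall y, 0 <= v y)%E ->
  (\int[mu \x nu]_z (u z.1 * v z.2) = \int[mu]_x u x * \int[nu]_y v y)%E.
Proof.
move=> mu_ mv u0 v0.
have muv : measurable_fun setT (fun z : X * Y => u z.1 * v z.2)%E.
  apply: emeasurable_funM; first exact: (measurableT_comp mu_ measurable_fst).
  exact: (measurableT_comp mv measurable_snd).
rewrite fubini_tonelli1//; last by move=> z; rewrite mule_ge0.
rewrite /fubini_F/=.
under eq_integral do rewrite ge0_integralZl//.
by rewrite ge0_integralZr// integral_ge0.
Qed.

Lemma ge0_integral_sum_prod d1 d2 (X : measurableType d1) (Y : measurableType d2)
    (R : realType) (mu : {sigma_finite_measure set X -> \bar R})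
    (nu : {sigma_finite_measure set Y -> \bar R}) (n : nat)
    (u : nat -> X -> R) (v : nat -> Y -> R) (A : set X) (B : set Y) :
  (forall i, measurable_fun setT (u i)) -> (forall i, measurable_fun setT (v i)) ->
  (forall i x, 0 <= u i x) -> (forall i y, 0 <= v i y) ->
  measurable A -> measurable B ->
  (\int[mu \x nu]_(z in A `*` B) (\sum_(i < n) u i z.1 * v i z.2)%:E =
   \sum_(i < n) \int[mu]_(x in A) (u i x)%:E * \int[nu]_(y in B) (v i y)%:E)%E.
Proof.
move=> mu_ mv u0 v0 mA mB.
rewrite integral_mkcond.
have -> : (fun z : X * Y => (\sum_(i < n) u i z.1 * v i z.2)%:E) \_ (A `*` B) =
   (fun z => \sum_(i < n) ((fun x => (u i x)%:E) \_ A) z.1 *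
             ((fun y => (v i y)%:E) \_ B) z.2)%E.
  apply/funext => -[x y]; rewrite /patch/=.
  case: ifPn => [/set_mem/= [xA yB]|/negP nAB].
    rewrite -sumEFin; apply: eq_bigr => i _.
    by rewrite !mem_set.
  apply/esym/big1 => i _.
  case: ifPn => xA; last by rewrite mul0e.
  case: ifPn => yB; last by rewrite mule0.
  by case: nAB; rewrite inE; split; exact: set_mem.
have mr dd (T : measurableType dd) (f : T -> R) (C : set T) :
    measurable C -> measurable_fun setT f ->
    measurable_fun setT ((fun x => (f x)%:E) \_ C).
  move=> mC mf; apply/(measurable_restrictT _ mC)/measurable_funTS.
  exact/measurable_EFinP.
have r0 T (f : T -> R) (C : set T) x : (forall x, 0 <= f x) ->
    (0 <= ((fun x => (f x)%:E) \_ C) x)%E.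
  by move=> f0; rewrite /patch; case: ifP => //; rewrite lee_fin.
rewrite ge0_integral_sum//; last 2 first.
- move=> i; apply: emeasurable_funM.
    exact: (measurableT_comp (mr _ _ _ _ mA (mu_ i)) measurable_fst).
  exact: (measurableT_comp (mr _ _ _ _ mB (mv i)) measurable_snd).
- by move=> i z _; apply: mule_ge0; exact: r0.
apply: eq_bigr => i _; rewrite ge0_integral_prod//.
- by rewrite -!integral_mkcond.
- exact: mr.
- exact: mr.
- by move=> x; exact: r0.
- by move=> x; exact: r0.
Qed.

Lemma Rintegral_sum d (T : measurableType d) (R : realType)
    (mu : {measure set T -> \bar R}) (A : set T) n (f : nat -> T -> R) :
  measurable A ->
  (forall i, mu.-integrable A (EFin \o f i)) ->
  \int[mu]_(x in A) (\sum_(i < n) f i x) = \sum_(i < n) \int[mu]_(x in A) f i x.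
Proof.
move=> mA fi; elim: n => [|n IH].
  under eq_Rintegral do rewrite big_ord0.
  by rewrite big_ord0 /Rintegral integral0.
under eq_Rintegral do rewrite big_ord_recr/=.
rewrite RintegralD//; first by rewrite IH big_ord_recr.
rewrite (_ : _ \o _ = (fun x => \sum_(i < n) (f i x)%:E)%E); last first.
  by apply/funext => x /=; rewrite sumEFin.
by apply: (@integrable_sum _ _ _ mu A mA 'I_n (index_enum _) xpredT
  (fun i x => (f i x)%:E)) => i _; exact: fi.
Qed.

(** * The coupling attached to a partition of unity *)

Section partition_coupling.
Context (R : realType) (d : nat).
Local Notation Rd := 'rV[R]_d.
Variables (m m' : prob R d) (n : nat) (phi : nat -> Rd -> R) (c : nat -> Rd)
  (eta M : R).
Hypotheses (m2 : Pp 2 m) (m2' : Pp 2 m')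
  (mphi : forall i, measurable_fun setT (phi i))
  (phi0 : forall i x, 0 <= phi i x)
  (phi_le1 : forall i x, phi i x <= 1)
  (phi1 : forall x, \sum_(i < n) phi i x <= 1)
  (phi_eta : forall i x, phi i x != 0 -> `|x - c i| <= eta)
  (phi_M : forall i x, phi i x != 0 -> `|x| <= M).

(* The coupling has density
   [sum_i q_i phi_i(x) phi_i(y) + r(x) r'(y) / th] with respect to the product of
   [m] and [m'].  Each [phi_i] lives on a small ball and carries the common mass
   [min(a_i, b_i)]; [r] and [r'] are what is left.  When [a_i], [b_i] or [th] is
   0, the division by 0 gives the term 0, which is the right value. *)
Let a i := \int[m]_x phi i x.
Let b i := \int[m']_x phi i x.
Let q i := Num.min (a i) (b i) / (a i * b i).
Let r x := 1 - \sum_(i < n) q i * b i * phi i x.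
Let r' x := 1 - \sum_(i < n) q i * a i * phi i x.
Let th := \int[m]_x r x.
Let rem x := 1 - \sum_(i < n) phi i x.

Let a0 i : 0 <= a i. Proof. by apply: Rintegral_ge0. Qed.
Let b0 i : 0 <= b i. Proof. by apply: Rintegral_ge0. Qed.

Let min_div (s t : R) : 0 <= s -> 0 <= t ->
  [/\ 0 <= Num.min s t / (s * t), Num.min s t / (s * t) * s * t = Num.min s t,
   Num.min s t / (s * t) * t <= 1 & Num.min s t / (s * t) * s <= 1].
Proof.
move=> s0 t0; have m0 : 0 <= Num.min s t by rewrite le_min s0.
split; first by rewrite divr_ge0// mulr_ge0.
- have [->|sn] := eqVneq s 0; first by rewrite mulr0 mul0r min_l.
  have [->|tn] := eqVneq t 0; first by rewrite mulr0 min_r.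
  by field; rewrite sn tn.
- have [->|sn] := eqVneq s 0; first by rewrite mul0r invr0 mulr0 mul0r.
  have [->|tn] := eqVneq t 0; first by rewrite mulr0.
  rewrite (_ : Num.min s t / (s * t) * t = Num.min s t / s); last by field; rewrite sn tn.
  by rewrite ler_pdivrMr ?lt_neqAle 1?eq_sym ?sn ?s0// mul1r ge_min lexx.
- have [->|sn] := eqVneq s 0; first by rewrite mulr0.
  have [->|tn] := eqVneq t 0; first by rewrite mulr0 invr0 mulr0 mul0r.
  rewrite (_ : Num.min s t / (s * t) * s = Num.min s t / t); last by field; rewrite sn tn.
  by rewrite ler_pdivrMr ?lt_neqAle 1?eq_sym ?tn ?t0// mul1r ge_min lexx orbT.
Qed.

Let q0 i : 0 <= q i. Proof. by have [] := min_div (a0 i) (b0 i). Qed.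
Let qab i : q i * a i * b i = Num.min (a i) (b i).
Proof. by have [] := min_div (a0 i) (b0 i). Qed.
Let qb1 i : q i * b i <= 1. Proof. by have [] := min_div (a0 i) (b0 i). Qed.
Let qa1 i : q i * a i <= 1. Proof. by have [] := min_div (a0 i) (b0 i). Qed.

(** Both summands are nonnegative: the part outside the partition, and in each cell the surplus of
    [m] over [m'], of mass a_i - min(a_i, b_i). *)
Let rE x : r x = rem x + \sum_(i < n) (1 - q i * b i) * phi i x.
Proof.
rewrite /r /rem -addrA; congr (_ + _); rewrite -sumrN -sumrN -big_split/=.
by apply: eq_bigr => i _; ring.
Qed.

Let r'E x : r' x = rem x + \sum_(i < n) (1 - q i * a i) * phi i x.
Proof.
rewrite /r' /rem -addrA; congr (_ + _); rewrite -sumrN -sumrN -big_split/=.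
by apply: eq_bigr => i _; ring.
Qed.

Let rem0 x : 0 <= rem x. Proof. by rewrite subr_ge0. Qed.

Let r0 x : 0 <= r x.
Proof.
rewrite rE addr_ge0// sumr_ge0// => i _.
by rewrite mulr_ge0// subr_ge0.
Qed.

Let r'0 x : 0 <= r' x.
Proof.
rewrite r'E addr_ge0// sumr_ge0// => i _.
by rewrite mulr_ge0// subr_ge0.
Qed.

Let r1 x : r x <= 1.
Proof.
rewrite gerBl; apply: sumr_ge0 => i _.
by apply: mulr_ge0 => //; exact: mulr_ge0.
Qed.

Let r'1 x : r' x <= 1.
Proof.
rewrite gerBl; apply: sumr_ge0 => i _.
by apply: mulr_ge0 => //; exact: mulr_ge0.
Qed.

Let msum (e : nat -> R) : measurable_fun setT (fun x => \sum_(i < n) e i * phi i x).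
Proof. by apply: measurable_sum => i; apply: measurable_funM. Qed.

Let mr : measurable_fun setT r.
Proof. by apply: measurable_funB => //; exact: (msum (fun i => q i * b i)). Qed.

Let mr' : measurable_fun setT r'.
Proof. by apply: measurable_funB => //; exact: (msum (fun i => q i * a i)). Qed.

Let mrem : measurable_fun setT rem.
Proof. by apply: measurable_funB => //; exact: measurable_sum. Qed.

Let int1 (mu : prob R d) (A : set Rd) (f : Rd -> R) : measurable A ->
  measurable_fun setT f -> (forall x, 0 <= f x) -> (forall x, f x <= 1) ->
  mu.-integrable A (EFin \o f).
Proof.
move=> mA mf f0 f1; apply: (integrableS measurableT) => //.
by apply: (bounded_integrable _ mf (C := 1)) => x; rewrite ger0_norm.
Qed.

Let ir (mu : prob R d) (A : set Rd) : measurable A -> mu.-integrable A (EFin \o r).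
Proof. by move=> mA; exact: int1. Qed.

Let ir' (mu : prob R d) (A : set Rd) : measurable A -> mu.-integrable A (EFin \o r').
Proof. by move=> mA; exact: int1. Qed.

Let iphi (mu : prob R d) (A : set Rd) e i : measurable A ->
  mu.-integrable A (EFin \o (fun x => e * phi i x)).
Proof.
move=> mA; have : mu.-integrable A (EFin \o phi i) by exact: int1.
by move=> /(integrableZl mA e).
Qed.

Let intr (mu : prob R d) (A : set Rd) (e : nat -> R) : measurable A ->
  \int[mu]_(x in A) (1 - \sum_(i < n) e i * phi i x) =
  fine (mu A) - \sum_(i < n) e i * \int[mu]_(x in A) phi i x.
Proof.
move=> mA; rewrite RintegralB//; first last.
- rewrite (_ : _ \o _ = (fun x => \sum_(i < n) (e i * phi i x)%:E)%E).
    by apply: (@integrable_sum _ _ _ mu A mA 'I_n (index_enum _) xpredT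
      (fun i x => (e i * phi i x)%:E)) => i _; exact: iphi.
  by apply/funext => x /=; rewrite sumEFin.
- by apply: int1.
rewrite Rintegral_cst// mul1r; congr (_ - _).
rewrite (@Rintegral_sum _ _ _ mu A n (fun i x => e i * phi i x))//; last first.
  by move=> i; exact: iphi.
apply: eq_bigr => i _; rewrite RintegralZl//; exact: int1.
Qed.

Let int_r (mu : prob R d) (A : set Rd) : measurable A ->
  \int[mu]_(x in A) r x =
  fine (mu A) - \sum_(i < n) q i * b i * \int[mu]_(x in A) phi i x.
Proof. by move=> mA; rewrite -(intr mu (fun i => q i * b i)). Qed.

Let int_r' (mu : prob R d) (A : set Rd) : measurable A ->
  \int[mu]_(x in A) r' x =
  fine (mu A) - \sum_(i < n) q i * a i * \int[mu]_(x in A) phi i x.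
Proof. by move=> mA; rewrite -(intr mu (fun i => q i * a i)). Qed.

(** The formula is symmetric in the two measures, so [r] and [r'] have the same mass and their
    product over [th] has the right marginals. *)
Let thE : th = 1 - \sum_(i < n) Num.min (a i) (b i).
Proof.
rewrite /th int_r// (_ : fine _ = 1); last by have /(congr1 fine) := probability_setT m.
by congr (_ - _); apply: eq_bigr => i _; rewrite -qab mulrAC.
Qed.

Let thE' : \int[m']_x r' x = th.
Proof.
rewrite thE int_r'// (_ : fine _ = 1); last by have /(congr1 fine) := probability_setT m'.
by congr (_ - _); apply: eq_bigr => i _; rewrite -qab.
Qed.

Let th0 : 0 <= th. Proof. by apply: Rintegral_ge0. Qed.

(** Index [n] carries the residual term, so that the whole density is one sum of products. *)
Let u i x := if (i < n)%N then q i * phi i x else th^-1 * r x.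
Let v i x := if (i < n)%N then phi i x else r' x.
Let k (z : Rd * Rd) := \sum_(i < n.+1) u i z.1 * v i z.2.

Let u0 i x : 0 <= u i x.
Proof. by rewrite /u; case: ifP => _; rewrite mulr_ge0// invr_ge0. Qed.

Let v0 i x : 0 <= v i x. Proof. by rewrite /v; case: ifP. Qed.

Let mu_ i : measurable_fun setT (u i).
Proof. by rewrite /u; case: (i < n)%N; exact: measurable_funM. Qed.

Let mv i : measurable_fun setT (v i).
Proof. by rewrite /v; case: (i < n)%N. Qed.

Let iu (mu : prob R d) (A : set Rd) i : measurable A -> mu.-integrable A (EFin \o u i).
Proof.
move=> mA; rewrite /u; case: (i < n)%N; first exact: iphi.
by have := integrableZl mA th^-1 (ir mu mA).
Qed.

Let iv (mu : prob R d) (A : set Rd) i : measurable A -> mu.-integrable A (EFin \o v i).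
Proof. by move=> mA; rewrite /v; case: (i < n)%N; [exact: int1|exact: ir']. Qed.

Let kE (A B : set Rd) : measurable A -> measurable B ->
  (\int[m \x m']_(z in A `*` B) (k z)%:E =
   (\sum_(i < n) q i * (\int[m]_(x in A) phi i x) * (\int[m']_(y in B) phi i y) +
   th^-1 * (\int[m]_(x in A) r x) * (\int[m']_(y in B) r' y))%R%:E)%E.
Proof.
move=> mA mB; rewrite ge0_integral_sum_prod//.
transitivity (\sum_(i < n.+1) ((\int[m]_(x in A) u i x) * \int[m']_(y in B) v i y)%R%:E)%E.
  apply: eq_bigr => i _; rewrite EFinM !fineK//.
    exact: integrable_fin_num (iv _ _ mB).
  exact: integrable_fin_num (iu _ _ mA).
rewrite sumEFin big_ord_recr/=; congr (_ + _)%:E.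
  apply: eq_bigr => i _; rewrite /u /v ltn_ord RintegralZl//; exact: int1.
by rewrite /u /v ltnn RintegralZl//; exact: ir.
Qed.

(** If [th = 0], the nonnegative [f] has total integral 0, so both sides vanish. *)
Let thK (mu : prob R d) (A : set Rd) (f : Rd -> R) : measurable A ->
   mu.-integrable setT (EFin \o f) -> (forall x, 0 <= f x) ->
   \int[mu]_x f x = th ->
   th^-1 * (\int[mu]_(x in A) f x) * th = \int[mu]_(x in A) f x.
Proof.
move=> mA intf f0 fth; have [th_0|th_neq0] := eqVneq th 0; last first.
  by rewrite mulrAC mulVf// mul1r.
rewrite th_0 mulr0; apply/eqP; rewrite eq_le Rintegral_ge0//=.
rewrite -th_0 -fth -lee_fin !fineK.
- apply: ge0_subset_integral => //; first exact: measurable_int intf.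
  by move=> x _; rewrite lee_fin.
- exact: integrable_fin_num intf.
- by apply: integrable_fin_num => //; exact: integrableS intf.
Qed.

Let k_fst (A : set Rd) : measurable A ->
  (\int[m \x m']_(z in A `*` setT) (k z)%:E = m A)%E.
Proof.
move=> mA; rewrite kE// thE' (thK mA (ir m measurableT) r0)//.
rewrite int_r// -[RHS]fineK ?fin_num_measure//; congr (_%:E).
rewrite [X in _ + X]addrC addrA -[X in _ = X]add0r; congr (_ + _).
apply/eqP; rewrite subr_eq0; apply/eqP/eq_bigr => i _.
by rewrite mulrAC.
Qed.

Let k_snd (A : set Rd) : measurable A ->
  (\int[m \x m']_(z in setT `*` A) (k z)%:E = m' A)%E.
Proof.
move=> mA; rewrite kE// -/th mulrAC (thK mA (ir' m' measurableT) r'0)//.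
rewrite int_r'// -[RHS]fineK ?fin_num_measure//; congr (_%:E).
rewrite [X in _ + X]addrC addrA -[X in _ = X]add0r; congr (_ + _).
by apply/eqP; rewrite subr_eq0.
Qed.

Let nsq (x : Rd) := `|x| ^+ 2.

Let mnsq : measurable_fun setT nsq.
Proof. by apply: measurable_funX; exact: measurable_norm. Qed.

Let insq (mu : prob R d) (f : Rd -> R) : Pp 2 mu -> measurable_fun setT f ->
  (forall x, 0 <= f x) -> (forall x, f x <= 1) ->
  mu.-integrable setT (EFin \o (fun x => nsq x * f x)).
Proof.
move=> mu2 mf f0 f1; apply: (Pp2_integrable mu2 (C := 1)).
  exact: measurable_funM.
move=> x; rewrite mul1r ger0_norm ?mulr_ge0 ?sqr_ge0//.
rewrite (@le_trans _ _ (nsq x))//; first by rewrite ler_piMr ?sqr_ge0.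
by rewrite lerDr.
Qed.

(** Second moment of the unmatched mass, for [r] and [r'] at once: the cells lie in the ball of
    radius [M], and in each cell at most [|a i - b i|] is unmatched. *)
Let int_nsq_r (mu : prob R d) (f : Rd -> R) (e : nat -> R) : Pp 2 mu ->
  measurable_fun setT f -> (forall x, 0 <= f x) -> (forall x, f x <= 1) ->
  (forall x, f x = rem x + \sum_(i < n) e i * phi i x) ->
  (forall i, 0 <= e i) ->
  (forall i, e i * \int[mu]_x phi i x <= `|a i - b i|) ->
  \int[mu]_x (nsq x * f x) <= \int[mu]_x (nsq x * rem x) +
    M ^+ 2 * \sum_(i < n) `|a i - b i|.
Proof.
move=> mu2 mf f0 f1 fE e0 eab.
have rem1 x : rem x <= 1 by rewrite gerBl sumr_ge0.
have iM i : mu.-integrable setT (EFin \o (fun x => M ^+ 2 * (e i * phi i x))).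
  by have := integrableZl measurableT (M ^+ 2) (iphi mu (e i) i measurableT).
have isum : mu.-integrable setT
    (EFin \o (fun x => \sum_(i < n) M ^+ 2 * (e i * phi i x))).
  rewrite (_ : _ \o _ = (fun x => \sum_(i < n) (M ^+ 2 * (e i * phi i x))%:E)%E).
    by apply: (@integrable_sum _ _ _ mu _ measurableT 'I_n (index_enum _) xpredT
      (fun i x => (M ^+ 2 * (e i * phi i x))%:E)) => i _; exact: iM.
  by apply/funext => x /=; rewrite sumEFin.
apply: (@le_trans _ _ (\int[mu]_x (nsq x * rem x +
   \sum_(i < n) M ^+ 2 * (e i * phi i x)))).
  apply: le_Rintegral => //.
  - exact: insq.
  - have := integrableD measurableT (insq mu2 mrem rem0 rem1) isum.
    by apply: eq_integrable.
  - move=> x _; rewrite fE mulrDr lerD2l mulr_sumr; apply: ler_sum => i _.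
    have [->|ph] := eqVneq (phi i x) 0; first by rewrite !mulr0.
    rewrite ler_wpM2r ?mulr_ge0// ler_pXn2r ?nnegrE//; first exact: phi_M ph.
    by apply: le_trans (phi_M ph).
rewrite RintegralD//; last exact: insq.
rewrite lerD2l (@Rintegral_sum _ _ _ mu setT n (fun i x => M ^+ 2 * (e i * phi i x)))//.
rewrite mulr_sumr; apply: ler_sum => i _.
rewrite RintegralZl//; last exact: iphi.
rewrite RintegralZl//; last exact: int1.
by rewrite ler_wpM2l ?sqr_ge0.
Qed.

(** Indices [n] and [n.+1] carry the two halves of the residual cost; the factor 4 eta^2 is the
    squared diameter of a cell. *)
Let U i x := if (i < n)%N then (4 * eta ^+ 2) * u i x
  else if i == n then 2 * (nsq x * u n x) else u n x.
Let V i x := if (i < n)%N then v i x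
  else if i == n then v n x else 2 * (nsq x * v n x).

(* [|x - y|^2 <= 2 |x|^2 + 2 |y|^2] on the residual term turns the cost into a sum
   of products of functions of one variable. *)
Let k_cost z : `|z.1 - z.2| ^+ 2 * k z <= \sum_(i < n.+2) U i z.1 * V i z.2.
Proof.
rewrite big_ord_recr/= big_ord_recr/= /k big_ord_recr/= mulrDr -addrA; apply: lerD.
  rewrite mulr_sumr; apply: ler_sum => i _; rewrite /U /V ltn_ord.
  rewrite -[leRHS]mulrA.
  have [->|uv] := eqVneq (u i z.1 * v i z.2) 0; first by rewrite !mulr0.
  have /andP[p1 p2] : (phi i z.1 != 0) && (phi i z.2 != 0).
    by move: uv; rewrite /u /v ltn_ord !mulf_eq0 !negb_or => /andP[/andP[_ ->]].
  rewrite ler_wpM2r ?mulr_ge0//.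
  have h : `|z.1 - z.2| <= eta + eta.
    rewrite -(subrK (c i) z.1) -addrA (le_trans (ler_normD _ _))//.
    by apply: lerD; [exact: phi_eta p1|rewrite distrC; exact: phi_eta p2].
  have -> : 4 * eta ^+ 2 = (eta + eta) ^+ 2 by ring.
  by rewrite ler_pXn2r ?nnegrE// (le_trans _ h).
rewrite /U /V ltnn eqxx ltnNge leqnSn/= gtn_eqF//.
set P := u n z.1; set Q := v n z.2; rewrite [leRHS](_ : _ = (2 * nsq z.1 + 2 * nsq z.2) * (P * Q)); last by ring.
rewrite ler_wpM2r ?(mulr_ge0 (u0 n z.1) (v0 n z.2))//.
have h : `|z.1 - z.2| ^+ 2 <= (`|z.1| + `|z.2|) ^+ 2.
  by rewrite ler_pXn2r ?nnegrE ?addr_ge0// ler_normB.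
apply: (le_trans h); rewrite /nsq.
by have := sqr_ge0 (`|z.1| - `|z.2|); set s := `|z.1|; set t := `|z.2|; nra.
Qed.

Let U0 i x : 0 <= U i x.
Proof.
have nsq0 : 0 <= nsq x by exact: sqr_ge0.
rewrite /U; case: ifP => _; first by apply: mulr_ge0 => //; rewrite mulr_ge0// sqr_ge0.
by case: ifP => _ //; apply: mulr_ge0 => //; exact: mulr_ge0.
Qed.

Let V0 i x : 0 <= V i x.
Proof.
have nsq0 : 0 <= nsq x by exact: sqr_ge0.
rewrite /V; case: ifP => _ //; case: ifP => _ //.
by apply: mulr_ge0 => //; exact: mulr_ge0.
Qed.

Let mU i : measurable_fun setT (U i).
Proof.
rewrite /U; case: (i < n)%N; first exact: measurable_funM.
by case: (i == n) => //; do 2 apply: measurable_funM => //.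
Qed.

Let mV i : measurable_fun setT (V i).
Proof.
rewrite /V; case: (i < n)%N => //.
by case: (i == n) => //; do 2 apply: measurable_funM => //.
Qed.

(** The factor [d] passes from the sup norm, in which the cells are measured, to the Euclidean
    one. *)
Definition partition_cost : R := d%:R * (4 * eta ^+ 2 +
  2 * (\int[m]_x (nsq x * rem x) + M ^+ 2 * \sum_(i < n) `|a i - b i|) +
  2 * (\int[m']_x (nsq x * rem x) + M ^+ 2 * \sum_(i < n) `|a i - b i|)).

Let th_le1 : th^-1 * th <= 1.
Proof. by have [->|t] := eqVneq th 0; rewrite ?mulr0// mulVf. Qed.

Let insq_r : m.-integrable setT (EFin \o (fun x => nsq x * r x)).
Proof. exact: insq. Qed.

Let insq_r' : m'.-integrable setT (EFin \o (fun x => nsq x * r' x)).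
Proof. exact: insq. Qed.

Let iu' (mu : prob R d) i : mu.-integrable setT (EFin \o u i).
Proof. exact: iu. Qed.

Let int_cost :
  (\int[m \x m']_z (\sum_(i < n.+2) U i z.1 * V i z.2)%:E <=
  (4 * eta ^+ 2 + 2 * \int[m]_x (nsq x * r x) + 2 * \int[m']_x (nsq x * r' x))%:E)%E.
Proof.
rewrite -setXTT ge0_integral_sum_prod//.
have iU i : m.-integrable setT (EFin \o U i).
  rewrite /U; case: (i < n)%N.
    by have := integrableZl measurableT (4 * eta ^+ 2) (iu' m i).
  case: (i == n) => //; rewrite /u ltnn.
  have := integrableZl measurableT (2 * th^-1) insq_r; apply: eq_integrable => // x _ /=.
  by congr (_%:E); ring.
have iV i : m'.-integrable setT (EFin \o V i).
  rewrite /V; case: (i < n)%N; first exact: iv.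
  case: (i == n); first exact: iv.
  rewrite /v ltnn; exact: (integrableZl measurableT 2 insq_r').
rewrite [leLHS](_ : _ = (\sum_(i < n.+2) ((\int[m]_x U i x) * \int[m']_y V i y))%:E)%E; last first.
  rewrite -sumEFin; apply: eq_bigr => i _; rewrite EFinM !fineK//.
    exact: integrable_fin_num (iV _).
  exact: integrable_fin_num (iU _).
rewrite lee_fin big_ord_recr big_ord_recr/=; apply: lerD; first apply: lerD.
- apply: (@le_trans _ _ (4 * eta ^+ 2 * \sum_(i < n) (q i * a i * b i))).
    rewrite mulr_sumr; apply: ler_sum => i _; rewrite /U /V /u /v ltn_ord.
    rewrite RintegralZl//; last exact: iphi.
    rewrite RintegralZl//; last exact: int1.
    by rewrite !mulrA.
  have e4 : 0 <= 4 * eta ^+ 2 by apply: mulr_ge0 => //; exact: sqr_ge0.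
  rewrite ler_piMr//.
  under eq_bigr do rewrite qab.
  by have := th0; rewrite thE subr_ge0.
- rewrite /U /V /u /v ltnn eqxx thE'.
  have -> : \int[m]_x (2 * (nsq x * (th^-1 * r x))) = 2 * th^-1 * \int[m]_x (nsq x * r x).
    by rewrite -RintegralZl//; apply: eq_Rintegral => x _; ring.
  set I := \int[m]_x _; rewrite [leLHS](_ : _ = th^-1 * th * (2 * I)); last by ring.
  rewrite ler_piMl//.
    by apply: mulr_ge0 => //; apply: Rintegral_ge0 => x _; apply: mulr_ge0 => //; exact: sqr_ge0.
- rewrite /U /V /u /v !ltnn (ltnNge n.+1 n) leqnSn/= (gtn_eqF (ltnSn n)).
  rewrite RintegralZl//; last exact: ir.
  rewrite RintegralZl// -/th ler_piMl//.
  by apply: mulr_ge0 => //; apply: Rintegral_ge0 => x _; apply: mulr_ge0 => //; exact: sqr_ge0.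
Qed.

Lemma wasserstein_partition : wasserstein 2 m m' <= Num.sqrt partition_cost.
Proof.
have cost0 (mu : prob R d) : 0 <= \int[mu]_x (nsq x * rem x).
  by apply: Rintegral_ge0 => x _; apply: mulr_ge0 => //; exact: sqr_ge0.
have sum0 : 0 <= M ^+ 2 * \sum_(i < n) `|a i - b i|.
  by apply: mulr_ge0; [exact: sqr_ge0|exact: sumr_ge0].
have mk : measurable_fun setT k.
  apply: measurable_sum => i; apply: measurable_funM.
    exact: (measurableT_comp (mu_ i) measurable_fst).
  exact: (measurableT_comp (mv i) measurable_snd).
have k0 z : 0 <= k z by apply: sumr_ge0 => i _; exact: mulr_ge0.
have muv : measurable_fun setT (fun z : Rd * Rd => \sum_(i < n.+2) U i z.1 * V i z.2).
  apply: measurable_sum => i; apply: measurable_funM.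
    exact: (measurableT_comp (mU i) measurable_fst).
  exact: (measurableT_comp (mV i) measurable_snd).
have uv0 (z : Rd * Rd) : 0 <= \sum_(i < n.+2) U i z.1 * V i z.2.
  by apply: sumr_ge0 => i _; exact: mulr_ge0.
apply: (@density_coupling _ _ m m' m m' k) => //.
rewrite sqr_sqrtr; last first.
  have e4 : 0 <= 4 * eta ^+ 2 by apply: mulr_ge0 => //; exact: sqr_ge0.
  by apply: mulr_ge0 => //; apply: addr_ge0; [apply: addr_ge0 => //|];
    apply: mulr_ge0 => //; exact: addr_ge0.
apply: (@le_trans _ _ (\int[m \x m']_z (d%:R%:E * (\sum_(i < n.+2) U i z.1 * V i z.2)%:E))%E).
  apply: ge0_le_integral => //.
  - by move=> z _; rewrite lee_fin; apply: mulr_ge0 => //; exact: sqr_ge0.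
  - by apply/measurable_EFinP; apply: measurable_funM => //; exact: measurable_cost.
  - by apply: emeasurable_funM => //; exact/measurable_EFinP.
  - move=> z _; rewrite -EFinM lee_fin.
    apply: (@le_trans _ _ (d%:R * (`|z.1 - z.2| ^+ 2 * k z))).
      by rewrite mulrA ler_wpM2r// enorm2_le.
    by rewrite ler_wpM2l// k_cost.
rewrite ge0_integralZl_EFin//; last 2 first.
- by move=> z _; rewrite lee_fin.
- exact/measurable_EFinP.
rewrite /partition_cost EFinM lee_wpmul2l ?lee_fin//.
apply: (le_trans int_cost); rewrite lee_fin -!addrA lerD2l.
have e1 i : 0 <= 1 - q i * b i by rewrite subr_ge0.
have e2 i : 0 <= 1 - q i * a i by rewrite subr_ge0.
have f1 i : (1 - q i * b i) * a i <= `|a i - b i|.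
  rewrite mulrBl mul1r mulrAC qab.
  by case: (leP (a i) (b i)) => _; rewrite ?subrr// ler_norm.
have f2 i : (1 - q i * a i) * b i <= `|a i - b i|.
  rewrite mulrBl mul1r qab.
  by case: (leP (a i) (b i)) => _; rewrite ?subrr// distrC ler_norm.
by rewrite lerD// ler_wpM2l//;
  [exact: (int_nsq_r m2 mr r0 r1 rE e1 f1)|exact: (int_nsq_r m2' mr' r'0 r'1 r'E e2 f2)].
Qed.

End partition_coupling.

(** * From integrals of squared Lipschitz functions to d_2 *)

Section weak_cvg.
Context (R : realType) (d : nat).
Local Notation Rd := 'rV[R]_d.
Implicit Types (m : prob R d) (psi f g : Rd -> R).

(** A 1-Lipschitz substitute for cutting [|x|] off inside a ball: [rms] sees it, and its square
    controls [|x| ^+ 2] beyond radius [2 * rho]. *)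
Definition excess (rho : R) (x : Rd) : R := Num.max 0 (`|x| - rho).

Lemma max0_lip (a b : R) : `|Num.max 0 a - Num.max 0 b| <= `|a - b|.
Proof.
rewrite /Num.max; case: ltP => a0; case: ltP => b0.
- by [].
- rewrite subr0 gtr0_norm// ler_normr; apply/orP; left; lra.
- rewrite sub0r normrN gtr0_norm// ler_normr; apply/orP; right; lra.
- by rewrite subrr normr0.
Qed.

Lemma excess_ge0 rho x : 0 <= excess rho x.
Proof. by rewrite le_max lexx. Qed.

Lemma excess_lip rho : lip 1 (excess rho).
Proof.
move=> x y; rewrite mul1r (le_trans (max0_lip _ _))//.
by rewrite opprB addrA subrK ler_dist_dist.
Qed.

Lemma excess_le rho x : 0 <= rho -> excess rho x <= `|x|.
Proof. by move=> r0; rewrite ge_max normr_ge0/= gerBl. Qed.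

Lemma sqr_le_excess rho x : 0 <= rho -> 2 * rho <= `|x| -> `|x| ^+ 2 <= 4 * excess rho x ^+ 2.
Proof.
move=> r0 rx; have -> : excess rho x = `|x| - rho.
  by rewrite /excess; apply: max_r; rewrite subr_ge0; lra.
by set t := `|x| in rx *; nra.
Qed.

Lemma excess_anti rho rho' x : rho <= rho' -> excess rho' x <= excess rho x.
Proof.
by move=> rr; rewrite /excess ge_max !le_max lexx/= lerB ?orbT.
Qed.

Lemma excess_tail m (e : R) : Pp 2 m -> 0 < e ->
  exists2 rho, 0 <= rho & \int[m]_x (excess rho x ^+ 2) <= e.
Proof.
move=> m2 e0.
have mt n : measurable_fun setT (fun x => (excess n%:R x ^+ 2)%:E).
  by apply/measurable_EFinP; apply: measurable_funX; apply: lip_measurable (excess_lip _).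
have [||||_ _ cv] := @dominated_convergence _ _ _ m setT measurableT
    (fun n x => (excess n%:R x ^+ 2)%:E) (cst 0%E) (fun x => (`|x| ^+ 2)%:E) mt.
- exact: measurable_cst.
- apply: aeW => x _; apply: cvg_near_cst.
  near=> n; congr EFin; rewrite /excess; apply/eqP; rewrite sqrf_eq0 max_l// subr_le0.
  by near: n; exact: nbhs_infty_ger.
- have : m.-integrable setT (EFin \o (fun x : Rd => `|x| ^+ 2)).
    apply: (Pp2_integrable m2 (C := 1)).
      by apply: measurable_funX; exact: measurable_norm.
    by move=> x; rewrite ger0_norm ?sqr_ge0// mul1r lerDr.
  by [].
- apply: aeW => x n _ /=; rewrite lee_fin ger0_norm ?sqr_ge0//.
  by rewrite ler_pXn2r ?nnegrE ?excess_ge0// excess_le.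
move: cv; rewrite integral0 => /fine_cvgP[_ /cvgrPdist_le/(_ _ e0)[N _ /(_ N (leqnn N))]].
rewrite /= sub0r normrN => h; exists N%:R => //.
exact: le_trans (ler_norm _) h.
Unshelve. all: by end_near. Qed.

Lemma lip_mul01 (L L' : R) f g : lip L f -> lip L' g ->
  (forall x, 0 <= f x <= 1) -> (forall x, 0 <= g x <= 1) ->
  lip (L + L') (fun x => f x * g x).
Proof.
move=> fL gL f01 g01 x y.
rewrite (_ : _ - _ = (f x - f y) * g x + f y * (g x - g y)); last by ring.
rewrite (le_trans (ler_normD _ _))// [leRHS]mulrDl !normrM lerD//.
- have /andP[g0 g1] := g01 x; rewrite (ger0_norm g0).
  by rewrite (le_trans _ (fL x y))// ler_piMr.
- have /andP[g0 g1] := f01 y; rewrite (ger0_norm g0).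
  by rewrite (le_trans _ (gL x y))// ler_piMl.
Qed.

Lemma lip_onem L f : lip L f -> lip L (fun x => 1 - f x).
Proof.
move=> fL x y; rewrite (_ : _ - _ = f y - f x); last by ring.
by rewrite distrC; exact: fL.
Qed.

Lemma lipDc L f c : lip L f -> lip L (fun x => f x + c).
Proof. by move=> fL x y; rewrite (_ : _ - _ = f x - f y); [exact: fL|ring]. Qed.

Lemma lip_cst c : lip 0 (fun _ : Rd => c).
Proof. by move=> x y; rewrite subrr normr0 mul0r. Qed.

(** A piecewise linear cut-off: a plateau of height 1 up to distance [r] from [c], then a linear
    descent to 0 at distance [2 * r]. *)
Definition tent (r : R) (c x : Rd) : R := Num.max 0 (1 - Num.max 0 (`|x - c| / r - 1)).

Lemma tent_lip r c : 0 < r -> lip r^-1 (tent r c).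
Proof.
move=> r0 x y; rewrite (le_trans (max0_lip _ _))//.
rewrite (_ : 1 - _ - _ = Num.max 0 (`|y - c| / r - 1) -
  Num.max 0 (`|x - c| / r - 1)); last by ring.
rewrite distrC (le_trans (max0_lip _ _))//.
rewrite (_ : _ - _ = (`|x - c| - `|y - c|) / r); last by ring.
have ri : 0 <= r^-1 by rewrite invr_ge0 ltW.
rewrite normrM (ger0_norm ri) [leRHS]mulrC.
rewrite ler_wpM2r// (le_trans (ler_dist_dist _ _))//.
by rewrite opprB addrA subrK.
Qed.

Lemma tent01 r c x : 0 <= tent r c x <= 1.
Proof. by rewrite le_max lexx/= ge_max ler01/= gerBl le_max lexx. Qed.

Lemma tent_eq1 r c x : 0 < r -> `|x - c| <= r -> tent r c x = 1.
Proof.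
move=> r0 xr; rewrite /tent (max_l (_ : _ / r - 1 <= 0)) ?subr0 ?max_r//.
by rewrite subr_le0 ler_pdivrMr// mul1r.
Qed.

Lemma tent_neq0 r c x : 0 < r -> tent r c x != 0 -> `|x - c| <= 2 * r.
Proof.
move=> r0; apply: contra_neqT; rewrite -ltNge => rx.
have rx' : 2 < `|x - c| / r by rewrite ltr_pdivlMr.
rewrite /tent (max_r (_ : 0 <= _ / r - 1)); first by rewrite max_l//; lra.
by lra.
Qed.

(* The sum of the [pou u i] is 1 wherever some [u i] equals 1. *)
Definition pou (u : nat -> Rd -> R) (i : nat) (x : Rd) : R :=
  u i x * \prod_(j < i) (1 - u j x).

Lemma pou_sum (u : nat -> Rd -> R) n x :
  1 - \sum_(i < n) pou u i x = \prod_(j < n) (1 - u j x).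
Proof.
elim: n => [|n IH]; first by rewrite !big_ord0 subr0.
by rewrite !big_ord_recr/= opprD addrA IH /pou; ring.
Qed.

Lemma prod_onem_lip (u : nat -> Rd -> R) n : (forall i, exists L, lip L (u i)) ->
  (forall i x, 0 <= u i x <= 1) ->
  (exists L, lip L (fun x => \prod_(j < n) (1 - u j x))) /\
  forall x, 0 <= \prod_(j < n) (1 - u j x) <= 1.
Proof.
move=> uL u01; have v01 i x : 0 <= 1 - u i x <= 1.
  by have := u01 i x; lra.
elim: n => [|n [[L IH] P01]].
  split; last by move=> x; rewrite big_ord0 ler01 lexx.
  by exists 0 => x y; rewrite !big_ord0 subrr normr0 mul0r.
split; last first.
  move=> x; rewrite big_ord_recr/=.
  have /andP[p0 p1] := P01 x; have /andP[v0 v1] := v01 n x.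
  by rewrite mulr_ge0//= mulr_ile1.
have [L' uL'] := uL n; exists (L + L') => x y.
rewrite !big_ord_recr/=.
exact: (lip_mul01 IH (lip_onem uL') P01 (v01 n)).
Qed.

Lemma pou_lip (u : nat -> Rd -> R) n : (forall i, exists L, lip L (u i)) ->
  (forall i x, 0 <= u i x <= 1) ->
  (exists L, lip L (pou u n)) /\ forall x, 0 <= pou u n x <= 1.
Proof.
move=> uL u01; have [[L PL] P01] := prod_onem_lip n uL u01.
have [L' uL'] := uL n; split; first by exists (L' + L); exact: lip_mul01.
move=> x; have /andP[p0 p1] := P01 x; have /andP[v0 v1] := u01 n x.
by rewrite /pou mulr_ge0//= mulr_ile1.
Qed.

Lemma near_sum_le (f : nat -> nat -> R) n :
  (forall i e, 0 < e -> \forall k \near \oo, f k i <= e) ->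
  forall e, 0 < e -> \forall k \near \oo, \sum_(i < n) f k i <= e.
Proof.
move=> fe; elim: n => [|n IH] e e0.
  by apply: nearW => k; rewrite big_ord0 ltW.
have e2 : 0 < e / 2 by rewrite divr_gt0.
have := IH _ e2; have := fe n _ e2; apply: filterS2 => k h1 h2.
by rewrite big_ord_recr/= [leRHS]splitr lerD.
Qed.

Lemma finite_ball_cover (rad eta : R) : 0 < eta ->
  exists s : seq Rd, (forall c, c \in s -> `|c| <= rad) /\
    forall x, `|x| <= rad -> exists2 c, c \in s & `|x - c| <= eta.
Proof.
move=> eta0; have := @compact_cball R d rad.
rewrite compact_cover => /(_ _ (@cball R d rad) (fun c => ball c eta)).
case.
- by move=> c _; exact: ball_open.
- by move=> x /= xr; exists x => //; exact: ballxx.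
- move=> D Dr Dc; exists (finmap.enum_fset D); split.
    by move=> c cD; have := Dr c cD; rewrite inE.
  move=> x /Dc[c /= cD]; rewrite mx_norm_ball /ball_/= distrC => xc.
  by exists c => //; exact: ltW.
Qed.

(* [f = ((f + 1)^2 - f^2 - 1) / 2] *)
Lemma cvg_lip01 (mk : nat -> prob R d) m f L :
  (forall k, Pp 2 (mk k)) -> Pp 2 m ->
  (forall L psi, lip L psi ->
    (fun k => \int[mk k]_x (psi x ^+ 2)) @ \oo --> \int[m]_x (psi x ^+ 2)) ->
  lip L f -> (forall x, 0 <= f x <= 1) ->
  (fun k => \int[mk k]_x f x) @ \oo --> \int[m]_x f x.
Proof.
move=> mk2 m2 cv fL f01.
have E (mu : prob R d) : Pp 2 mu -> \int[mu]_x f x =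
    (\int[mu]_x ((f x + 1) ^+ 2) - \int[mu]_x (f x ^+ 2) - 1) / 2.
  move=> mu2; have i1 := lip_sqr_integrable fL mu2.
  have fi : mu.-integrable setT (EFin \o f).
    apply: (bounded_integrable _ (lip_measurable fL) (C := 1)) => x.
    by have /andP[f0 f1] := f01 x; rewrite ger0_norm.
  have i2 : mu.-integrable setT (EFin \o (fun x => (f x + 1) ^+ 2)).
    by apply: (@lip_sqr_integrable _ _ L) => //; exact: lipDc.
  rewrite -RintegralB//.
  have -> : \int[mu]_x ((f x + 1) ^+ 2 - f x ^+ 2) = \int[mu]_x (2 * f x + 1).
    by apply: eq_Rintegral => x _; ring.
  rewrite RintegralD//; last 2 first.
  - exact: (integrableZl measurableT 2 fi).
  - exact: finite_measure_integrable_cst.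
  by rewrite RintegralZl// prob_Rintegral_cst; field.
rewrite E//; under eq_fun do rewrite E//.
apply: cvgM; last exact: cvg_cst.
apply: cvgB; last exact: cvg_cst.
apply: cvgB; first exact: (cv L (fun x => f x + 1) (@lipDc L f 1 fL)).
exact: (cv L f fL).
Qed.

(** Small cells cover a large ball. Convergence of finitely many Lipschitz integrals makes the mass
    unmatched in the cells small, and convergence of the squared [excess] makes the second moments
    outside the ball small; the partition coupling is then cheap. *)
Lemma wasserstein_cvg (mk : nat -> prob R d) m :
  (forall k, Pp 2 (mk k)) -> Pp 2 m ->
  (forall L psi, lip L psi ->
    (fun k => \int[mk k]_x (psi x ^+ 2)) @ \oo --> \int[m]_x (psi x ^+ 2)) ->
  forall e, 0 < e -> \forall k \near \oo, wasserstein 2 (mk k) m < e.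
Proof.
move=> mk2 m2 cv e e0.
(* The coupling costs at most [9 * d * t]: [t] from the cells, the rest from the unmatched mass of
   the two measures. With [d + 1] in the denominator this stays strictly below e^2. *)
pose t := e ^+ 2 / (9 * (d%:R + 1)).
have t0 : 0 < t by rewrite divr_gt0 ?exprn_gt0// mulr_gt0.
pose eta := Num.sqrt t / 2.
have eta0 : 0 < eta by rewrite divr_gt0// sqrtr_gt0.
have etaE : 4 * eta ^+ 2 = t.
  by rewrite /eta expr_div_n sqr_sqrtr ?ltW//; field.
have t8 : 0 < t / 8 by rewrite divr_gt0.
have [rho rho0 tlrho] := excess_tail m2 t8.
have eta2 : 0 < eta / 2 by rewrite divr_gt0.
have [s [sr scov]] := finite_ball_cover (2 * rho) eta2.
pose n := size s.
pose u i x := if (i < n)%N then tent (eta / 2) (nth 0 s i) x else 0 : R.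
have uL i : exists L, lip L (u i).
  rewrite /u; case: (i < n)%N; first by exists (eta / 2)^-1; exact: tent_lip.
  by exists 0; exact: lip_cst.
have u01 i x : 0 <= u i x <= 1.
  by rewrite /u; case: ifP => _; [exact: tent01|rewrite lexx ler01].
have phiL i := (pou_lip i uL u01).1.
have phi01 i := (pou_lip i uL u01).2.
have mphi i : measurable_fun setT (pou u i).
  by have [L pL] := phiL i; exact: lip_measurable pL.
have phi0 i x : 0 <= pou u i x by have /andP[] := phi01 i x.
have phi1 i x : pou u i x <= 1 by have /andP[] := phi01 i x.
have rem01 x := (prod_onem_lip n uL u01).2 x.
have phis x : \sum_(i < n) pou u i x <= 1.
  by rewrite -subr_ge0 pou_sum; have /andP[] := rem01 x.
have pu i x : pou u i x != 0 -> (i < n)%N && (tent (eta / 2) (nth 0 s i) x != 0).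
  rewrite /pou /u mulf_eq0 negb_or => /andP[+ _].
  by case: ifP => //; rewrite eqxx.
have phi_eta i x : pou u i x != 0 -> `|x - nth 0 s i| <= eta.
  move=> /pu/andP[_ /(tent_neq0 eta2)]; rewrite mulrC divfK//.
pose M := 2 * rho + eta.
have phi_M i x : pou u i x != 0 -> `|x| <= M.
  move=> px; have /andP[ni _] := pu _ _ px.
  rewrite -(subrK (nth 0 s i) x) (le_trans (ler_normD _ _))// addrC lerD//.
    by apply: sr; exact: mem_nth.
  exact: phi_eta.
(* Within radius [2 * rho] some tent equals 1, so a factor of the product in [pou_sum] vanishes. *)
have remtl x : `|x| ^+ 2 * (1 - \sum_(i < n) pou u i x) <= 4 * excess rho x ^+ 2.
  have [xr|xr] := leP `|x| (2 * rho).
    have [c cs xc] := scov _ xr; rewrite pou_sum.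
    have ic : (index c s < n)%N by rewrite index_mem.
    rewrite (bigD1 (Ordinal ic))//= {1}/u ic nth_index// tent_eq1// subrr mul0r mulr0.
    by rewrite mulr_ge0// sqr_ge0.
  apply: le_trans (sqr_le_excess rho0 (ltW xr)).
  by rewrite ler_piMr ?sqr_ge0// gerBl sumr_ge0.
have mrem : measurable_fun setT (fun x : Rd => `|x| ^+ 2 * (1 - \sum_(i < n) pou u i x)).
  apply: measurable_funM; first by apply: measurable_funX; exact: measurable_norm.
  by apply: measurable_funB => //; exact: measurable_sum.
have intrem (mu : prob R d) : Pp 2 mu ->
    \int[mu]_x (`|x| ^+ 2 * (1 - \sum_(i < n) pou u i x)) <= 4 * \int[mu]_x (excess rho x ^+ 2).
  move=> mu2; have it := lip_sqr_integrable (excess_lip rho) mu2.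
  rewrite -RintegralZl//; apply: le_Rintegral => //.
    apply: (Pp2_integrable mu2 (C := 1)) => // x.
    have r0 : 0 <= 1 - \sum_(i < n) pou u i x by rewrite subr_ge0.
    rewrite ger0_norm ?mulr_ge0 ?sqr_ge0// mul1r.
    apply: (@le_trans _ _ (`|x| ^+ 2)); last by rewrite lerDr.
    by rewrite ler_piMr ?sqr_ge0// gerBl sumr_ge0.
  exact: (integrableZl measurableT 4 it).
have M1 : 0 < M ^+ 2 + 1 by rewrite ltr_wpDl ?sqr_ge0.
have sum_small : \forall k \near \oo,
    \sum_(i < n) `|\int[mk k]_x pou u i x - \int[m]_x pou u i x| <= t / (M ^+ 2 + 1).
  apply: (near_sum_le (f := fun k i => `|\int[mk k]_x pou u i x - \int[m]_x pou u i x|));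
    last by rewrite divr_gt0.
  move=> i e' e'0; have [L pL] := phiL i.
  have /cvgrPdist_le/(_ _ e'0) := cvg_lip01 mk2 m2 cv pL (phi01 i).
  by apply: filterS => k; rewrite distrC.
have excess_small : \forall k \near \oo, \int[mk k]_x (excess rho x ^+ 2) <= t / 4.
  have /cvgrPdist_le/(_ _ t8) := cv _ _ (excess_lip rho).
  apply: filterS => k; rewrite distrC ler_norml => /andP[_].
  by move: tlrho; lra.
move: sum_small excess_small; apply: filterS2 => k hS hT.
apply: (le_lt_trans (wasserstein_partition (mk2 k) m2 mphi phi0 phi1 phis phi_eta phi_M)).
rewrite -(ltr_pXn2r (ltn0Sn 1)) ?nnegrE ?sqrtr_ge0 ?(ltW e0)//.
set C := partition_cost _ _ _ _ _ _.
suff Ce : C <= d%:R * (9 * t).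
  have Ce2 : C < e ^+ 2.
    apply: (le_lt_trans Ce).
    rewrite (_ : _ * _ = e ^+ 2 * (d%:R / (d%:R + 1))); last first.
      by rewrite /t; field; rewrite gt_eqF.
    by rewrite gtr_pMr ?exprn_gt0// ltr_pdivrMr// mul1r ltrDl.
  have [C0|C0] := leP 0 C; first by rewrite sqr_sqrtr.
  by rewrite ler0_sqrtr ?ltW// expr0n/= exprn_gt0.
rewrite /C /partition_cost etaE ler_wpM2l//.
have hM : M ^+ 2 * (\sum_(i < n) `|\int[mk k]_x pou u i x - \int[m]_x pou u i x|) <= t.
  apply: (@le_trans _ _ (M ^+ 2 * (t / (M ^+ 2 + 1)))); first by rewrite ler_wpM2l ?sqr_ge0.
  by rewrite mulrCA ger_pMr// ler_pdivrMr// mul1r lerDl.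
have h1 := intrem _ (mk2 k); have h2 := intrem _ m2.
by move: hM h1 h2 hT tlrho; lra.
Qed.

End weak_cvg.

(** * Completeness of densities with a uniform bound *)

Section hull.
Context (T : Type) (R : realType) (r : nat -> T -> R).

(* Midpoints suffice here, and spare the coefficients of convex combinations. *)
Inductive hull (n : nat) : (T -> R) -> Prop :=
| hull_in k of (n <= k)%N : hull n (r k)
| hull_mid f g of hull n f & hull n g : hull n (fun x => (f x + g x) / 2).

Lemma hull_le n p f : (n <= p)%N -> hull p f -> hull n f.
Proof.
move=> np; elim=> [k pk|g h _ gn _ hn]; last exact: hull_mid.
by apply: hull_in; exact: leq_trans pk.
Qed.

Lemma hull_inv n (P : (T -> R) -> Prop) : (forall k, (n <= k)%N -> P (r k)) ->
  (forall f g, P f -> P g -> P (fun x => (f x + g x) / 2)) ->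
  forall f, hull n f -> P f.
Proof. by move=> Pr Pm f; elim => [k /Pr//|g h _ Pg _ Ph]; exact: Pm. Qed.

End hull.

(** * Almost everywhere convergence of convex combinations *)

Section mazur.
Context d (T : measurableType d) (R : realType) (mu : {measure set T -> \bar R}).
Variables (r : nat -> T -> R) (K : R).
Hypotheses (mr : forall k, measurable_fun setT (r k))
  (K0 : 0 <= K)
  (r0 : forall k x, 0 <= r k x) (rK : forall k x, r k x <= K)
  (ir : forall k, mu.-integrable setT (EFin \o r k))
  (r1 : forall k, \int[mu]_x r k x <= 1).

Let good (f : T -> R) := [/\ measurable_fun setT f,
  forall x, 0 <= f x <= K, mu.-integrable setT (EFin \o f) & \int[mu]_x f x <= 1].

Let good_mid f g : good f -> good g -> good (fun x => (f x + g x) / 2).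
Proof.
move=> [mf f0 fi f1] [mg g0 gi g1].
have fgi : mu.-integrable setT (EFin \o (fun x => f x + g x)).
  exact: (integrableD measurableT fi gi).
split.
- by apply: measurable_funM => //; exact: measurable_funD.
- by move=> x; have := f0 x; have := g0 x; lra.
- by have := integrableZr measurableT 2^-1 fgi.
- by rewrite RintegralZr// RintegralD//; lra.
Qed.

Let goodP n f : hull r n f -> good f.
Proof.
apply: hull_inv => [k _|]; last exact: good_mid.
by split => // x; rewrite r0 rK.
Qed.

Let isq f : good f -> mu.-integrable setT (EFin \o (fun x => f x ^+ 2)).
Proof.
move=> [mf f0 fi f1].
apply: (le_integrable measurableT _ _ (integrableZl measurableT K fi)).
  by apply/measurable_EFinP; exact: measurable_funX.
move=> x _ /=; have /andP[a b] := f0 x.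
rewrite lee_fin !ger0_norm ?sqr_ge0// ?mulr_ge0//; first by rewrite expr2 ler_wpM2r.
Qed.

Let Q (f : T -> R) := \int[mu]_x (f x ^+ 2).

Let Q0 f : 0 <= Q f. Proof. by apply: Rintegral_ge0 => x _; exact: sqr_ge0. Qed.

Let QK f : good f -> Q f <= K.
Proof.
move=> gf; have [mf f0 fi f1] := gf.
apply: (@le_trans _ _ (\int[mu]_x (K * f x))).
  apply: le_Rintegral => //; first exact: isq.
    exact: (integrableZl measurableT K fi).
  by move=> x _; have /andP[a b] := f0 x; rewrite expr2 ler_wpM2r.
by rewrite RintegralZl// ler_piMr.
Qed.

Let Qsub f g : good f -> good g ->
  \int[mu]_x ((f x - g x) ^+ 2) = 2 * Q f + 2 * Q g - 4 * Q (fun x => (f x + g x) / 2).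
Proof.
move=> gf gg; have i1 := isq gf; have i2 := isq gg.
have i1' : mu.-integrable setT (EFin \o (fun x => 2 * f x ^+ 2)).
  exact: (integrableZl measurableT 2 i1).
have i2' : mu.-integrable setT (EFin \o (fun x => 2 * g x ^+ 2)).
  exact: (integrableZl measurableT 2 i2).
have i3 := isq (good_mid gf gg).
have i3' : mu.-integrable setT (EFin \o (fun x => 4 * ((f x + g x) / 2) ^+ 2)).
  exact: (integrableZl measurableT 4 i3).
have i12 : mu.-integrable setT (EFin \o (fun x => 2 * f x ^+ 2 + 2 * g x ^+ 2)).
  exact: (integrableD measurableT i1' i2').
rewrite /Q -!RintegralZl// -RintegralD// -RintegralB//.
by apply: eq_Rintegral => x _; field.
Qed.

(** Squared L^2 distance from 0 to the n-th tail hull. It is nondecreasing in [n] and at most [K];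
    [S] below is its limit. *)
Let D n := inf [set Q f | f in hull r n].

Let D_le n f : hull r n f -> D n <= Q f.
Proof.
move=> hf; apply: ge_inf; last by exists f.
by exists 0 => _ [g _ <-]; exact: Q0.
Qed.

Let D_inf n : has_inf [set Q f | f in hull r n].
Proof.
split; first by exists (Q (r n)), (r n) => //; exact: hull_in.
by exists 0 => _ [g _ <-]; exact: Q0.
Qed.

Let D_ex n e : 0 < e -> exists2 f, hull r n f & Q f < D n + e.
Proof.
move=> e0; have [_ [f hf <-] fe] := inf_adherent e0 (D_inf n).
by exists f.
Qed.

Let D_mono n p : (n <= p)%N -> D n <= D p.
Proof.
move=> np; apply: lb_le_inf; first by have [] := D_inf p.
by move=> _ [f hf <-]; apply: D_le; exact: hull_le hf.
Qed.

Let S := sup (range D).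

Let hasS : has_sup (range D).
Proof.
split; first by exists (D 0), 0%N.
exists K => _ [n _ <-]; apply: le_trans (QK (goodP (hull_in r (leqnn n)))).
by apply: D_le; exact: hull_in.
Qed.

Let D_S n : D n <= S.
Proof. by apply: (ub_le_sup hasS.2); exists n. Qed.

Let S_ex e : 0 < e -> exists N, forall n, (N <= n)%N -> S - e < D n.
Proof.
move=> e0; have [_ [N _ <-] h] := sup_adherent e0 hasS.
by exists N => n Nn; exact: lt_le_trans (D_mono Nn).
Qed.

(** The parallelogram identity gives 2 (S + ep) + 2 (S + ep) - 4 (S - ep) = 8 ep, hence the division
    by 8; the rate 8^-j remains summable after multiplication by 4^j. *)
Let ep (j : nat) : R := 8^-1 ^+ j / 8.
Let ep0 j : 0 < ep j. Proof. by rewrite /ep divr_gt0// exprn_gt0. Qed.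

(* By the parallelogram identity, elements of the hulls with nearly minimal L^2
   norm form a Cauchy sequence in L^2. *)
Let minimizing : exists (s : nat -> T -> R), (forall j, hull r j (s j)) /\
  forall j, \int[mu]_x ((s j.+1 x - s j x) ^+ 2) <= 8^-1 ^+ j.
Proof.
have [N0 N0P] := choice (fun j => S_ex (ep0 j)).
(* Partial sums make [N] monotone and at least [j], besides dominating [N0]. *)
pose N j := (\sum_(i < j.+1) (N0 i).+1)%N.
have NS j : (N j <= N j.+1)%N by rewrite /N [in X in (_ <= X)%N]big_ord_recr leq_addr.
have NN j : (N0 j <= N j)%N.
  by rewrite /N big_ord_recr/= (leq_trans (leqnSn _))// leq_addl.
have Nj j : (j <= N j)%N.
  elim: j => // j IH; rewrite /N big_ord_recr/= -/(N j).
  by rewrite -addn1 leq_add.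
have /choice[s sP] : forall j, exists f, hull r (N j) f /\ Q f < D (N j) + ep j.
  by move=> j; have [f a b] := D_ex (N j) (ep0 j); exists f.
have sh j : hull r (N j) (s j) by have [] := sP j.
have sQ j : Q (s j) < S + ep j.
  by have [_ h] := sP j; rewrite (lt_le_trans h)// lerD2r.
exists s; split; first by move=> j; exact: hull_le (sh j).
move=> j; rewrite (Qsub (goodP (sh j.+1)) (goodP (sh j))).
have hm : hull r (N j) (fun x => (s j.+1 x + s j x) / 2).
  by apply: hull_mid => //; exact: hull_le (sh j.+1).
have := D_le hm; have := N0P j _ (NN j); have := sQ j; have := sQ j.+1.
have : ep j.+1 <= ep j.
  rewrite /ep ler_pM2r// exprS ler_piMl ?exprn_ge0//.
  by rewrite invf_le1// ler1n.
have -> : 8^-1 ^+ j = 8 * ep j by rewrite /ep; field.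
lra.
Qed.

(** Weighted by 4^j, the squared increments of the minimising sequence still have a summable
    integral. Their sum is therefore finite almost everywhere, and there the increments are
    dominated by a multiple of 2^-j. *)
Lemma mazur : exists (s : nat -> T -> R) (rho : T -> R),
  [/\ forall j, hull r j (s j), measurable_fun setT rho,
      forall x, 0 <= rho x <= K &
      {ae mu, forall x, s ^~ x @ \oo --> rho x}].
Proof.
have [s [sh sQ]] := minimizing; exists s.
have sg j := goodP (sh j).
have ms j : measurable_fun setT (s j) by have [] := sg j.
have mg j : measurable_fun setT (fun x => (4 ^+ j * (s j.+1 x - s j x) ^+ 2)%:E).
  apply/measurable_EFinP; apply: measurable_funM => //.
  by apply: measurable_funX; exact: measurable_funB.
have g0 j x : (0 <= (4 ^+ j * (s j.+1 x - s j x) ^+ 2)%:E)%E.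
  by rewrite lee_fin; apply: mulr_ge0; [exact: exprn_ge0|exact: sqr_ge0].
have isub j : mu.-integrable setT (EFin \o (fun x => (s j.+1 x - s j x) ^+ 2)).
  have i12 := integrableD measurableT (isq (sg j.+1)) (isq (sg j)).
  apply: (le_integrable measurableT _ _ i12).
    by apply/measurable_EFinP; apply: measurable_funX; exact: measurable_funB.
  move=> x _ /=; rewrite lee_fin !ger0_norm ?sqr_ge0 ?addr_ge0 ?sqr_ge0//.
  have [_ /(_ x)/andP[a _] _ _] := sg j.+1; have [_ /(_ x)/andP[b _] _ _] := sg j.
  have := mulr_ge0 a b.
  by nra.
have ae_sum : {ae mu, forall x, setT x ->
    (\sum_(j <oo) (4 ^+ j * (s j.+1 x - s j x) ^+ 2)%:E)%E \is a fin_num}.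
  apply: (integrable_ae measurableT); apply/integrableP; split.
    by apply: ge0_emeasurable_sum => // j x _ _; exact: g0.
  under eq_integral do rewrite gee0_abs ?nneseries_ge0//.
  rewrite integral_nneseries//.
  apply: (@le_lt_trans _ _ (\sum_(j <oo) (2%:R / (2 ^ (j + 1))%:R)%:E)%E); last first.
    have /cvg_lim -> // := @cvg_geometric_eseries_half R 2 0.
    by rewrite ltry.
  apply: lee_nneseries => [j _ _|j _].
    by apply: integral_ge0 => x _; exact: g0.
  have i4 := integrableZl measurableT (4 ^+ j) (isub j).
  rewrite -(fineK (integrable_fin_num measurableT i4)) lee_fin.
  rewrite (_ : fine _ = 4 ^+ j * \int[mu]_x ((s j.+1 x - s j x) ^+ 2)); last first.
    exact: RintegralZl.
  have -> : 2 / (2 ^ (j + 1))%:R = 4 ^+ j * 8^-1 ^+ j :> R.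
    rewrite natrX exprD expr1 -exprMn (_ : 4 * 8^-1 = 2^-1 :> R); last by field.
    by rewrite exprVn; field; rewrite expf_neq0.
  by rewrite ler_wpM2l// exprn_ge0.
have ae_cvg : {ae mu, forall x, cvgn (s ^~ x)}.
  apply: filterS ae_sum => x /(_ I) Sfin.
  set S' := fine (\sum_(j <oo) (4 ^+ j * (s j.+1 x - s j x) ^+ 2)%:E)%E.
  have DS j : (2 ^+ j * (s j.+1 x - s j x)) ^+ 2 <= S'.
    rewrite exprMn -exprM mulnC exprM (_ : 2 ^+ 2 = 4 :> R); last by ring.
    rewrite -lee_fin /S' fineK//.
    apply: le_trans (nneseries_lim_ge (m := 0) j.+1 _) => [|i _ _]; last exact: g0.
    rewrite big_nat_recr//= leeDr// sume_ge0// => i _; exact: g0.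
  have D2 j : `|telescope (s ^~ x) j| <= geometric (Num.sqrt S') 2^-1 j.
    rewrite /telescope/= -ler_pdivrMr; last by rewrite exprn_gt0// invr_gt0.
    rewrite -exprVn invrK mulrC.
    rewrite -[X in X * _]ger0_norm ?exprn_ge0// -normrM -sqrtr_sqr.
    by rewrite ler_sqrt// (le_trans _ (DS 0%N))// sqr_ge0.
  have cv : cvgn (series (telescope (s ^~ x))).
    apply: normed_cvg; apply: (series_le_cvg _ _ D2) => //.
      by move=> n; exact: le_trans (D2 n).
    by apply: is_cvg_geometric_series; rewrite ger0_norm// invf_lt1// ltr1n.
  rewrite (_ : s ^~ x = (fun n => s 0 x + series (telescope (s ^~ x)) n)); last first.
    by apply/funext => n; rewrite -(eq_sum_telescope (s ^~ x)).
  by apply: is_cvgD => //; exact: is_cvg_cst.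
(* Setting the sequence to 0 on the null set [N] makes the limit exist everywhere, hence measurable
   and between 0 and [K] at every point. *)
have [N [mN N0 NP]] := ae_cvg.
pose s' j x := s j x * \1_(~` N) x.
have cvs' x : cvgn (s' ^~ x).
  rewrite /s'; have [xN|xN] := pselect (N x).
    rewrite (_ : (fun _ => _) = (fun=> 0)); first exact: is_cvg_cst.
    by apply/funext => j; rewrite indicE memNset ?mulr0//= => /(_ xN).
  rewrite (_ : (fun _ => _) = s ^~ x).
    by apply: contrapT => h; apply: xN; exact: NP.
  by apply/funext => j; rewrite indicE mem_set ?mulr1.
have ms' j : measurable_fun setT (s' j).
  by apply: measurable_funM => //; apply: measurable_indic; exact: measurableC.
exists (fun x => limn (s' ^~ x)); split => //.
- apply: (measurable_fun_cvg ms') => x _; exact: cvs'.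
- move=> x; have s01 j : 0 <= s' j x <= K.
    have [_ /(_ x)/andP[a b] _ _] := sg j; rewrite /s' indicE.
    by case: (x \in _); rewrite ?mulr1 ?mulr0 ?a ?b ?lexx ?K0.
  apply/andP; split.
    by apply: limr_ge => //; apply: nearW => j; have /andP[] := s01 j.
  by apply: limr_le => //; apply: nearW => j; have /andP[] := s01 j.
- exists N; split => // x /=; apply: contra_notP => xN.
  rewrite (_ : s ^~ x = s' ^~ x); first exact: cvs'.
  by apply/funext => j; rewrite /s' indicE mem_set ?mulr1.
Qed.

End mazur.

Section Loo.
Context (R : realType) (d : nat).
Local Notation Rd := 'rV[R]_d.
Local Notation leb := (lebesgue_rV R d).
Implicit Types (m : prob R d) (rho : Rd -> R).

Lemma lebesgue_rV_setT_gt0 : (0 < leb setT)%E.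
Proof.
apply: (@lt_le_trans _ _ (leb (ball 0 1))).
  by rewrite lebesgue_rV_ball// lte_fin exprn_gt0.
apply: le_measure; rewrite ?inE//.
by apply: open_mx_measurable; exact: ball_open.
Qed.

(** The L^oo norm is an essential supremum only over a space of positive measure; this settles that
    case distinction. *)
Lemma Lnorm_oo rho :
  ('N[leb]_+oo[EFin \o rho] = ess_sup leb (abse \o (EFin \o rho)))%E.
Proof. by rewrite unlock lebesgue_rV_setT_gt0. Qed.

Lemma Lfun_measurable p rho : rho \in Lfun leb p -> measurable_fun setT rho.
Proof. by move=> /sub_Lfun_mfun; rewrite inE. Qed.

Lemma Lnorm_oo_fin rho : rho \in Lfun leb +oo%E ->
  ('N[leb]_+oo[EFin \o rho])%E \is a fin_num.
Proof.
move=> /sub_Lfun_finLfun; rewrite inE/= /finite_norm => h.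
by rewrite ge0_fin_numE// Lnorm_ge0.
Qed.

Lemma Loo_norm_ae rho : rho \in Lfun leb +oo%E ->
  {ae leb, forall x, `|rho x| <= Loo_norm rho}.
Proof.
move=> rL; have := ess_sup_ge leb (abse \o (EFin \o rho)).
rewrite -Lnorm_oo -(fineK (Lnorm_oo_fin rL)).
by apply: filterS => x /=; rewrite lee_fin.
Qed.

Lemma Loo_norm_ge0 rho : 0 <= Loo_norm rho.
Proof. by rewrite fine_ge0// Lnorm_ge0. Qed.

Lemma ae_Lfun_oo rho (K : R) : measurable_fun setT rho ->
  {ae leb, forall x, `|rho x| <= K} -> rho \in Lfun leb +oo%E /\ Loo_norm rho <= K.
Proof.
move=> mrho rK.
have NK : ('N[leb]_+oo[EFin \o rho] <= K%:E)%E.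
  rewrite Lnorm_oo; apply/ess_supP.
  by apply: filterS rK => x /=; rewrite lee_fin.
have rL : rho \in Lfun leb +oo%E.
  apply/andP; rewrite !inE; split => //=.
  by rewrite /finite_norm (le_lt_trans NK)// ltry.
by split => //; rewrite -lee_fin fineK// Lnorm_oo_fin.
Qed.

Lemma density_measurable m rho : Loo_density m rho -> measurable_fun setT rho.
Proof. by move=> [_ /Lfun_measurable]. Qed.

Lemma density_integrable m rho (f : Rd -> R) : Loo_density m rho ->
  m.-integrable setT (EFin \o f) -> leb.-integrable setT (EFin \o (fun x => f x * rho x)).
Proof.
move=> mr; have [r0 _ mE] := mr.
exact: (integrable_density (density_measurable mr) r0 mE).
Qed.

Lemma density_Rintegral m rho (f : Rd -> R) : Loo_density m rho ->
  measurable_fun setT f -> \int[m]_x f x = \int[leb]_x (f x * rho x).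
Proof.
move=> mr; have [r0 _ mE] := mr.
exact: (Rintegral_density (density_measurable mr) r0 mE).
Qed.

Lemma ex_Loo_density rho (K : R) : measurable_fun setT rho -> (forall x, 0 <= rho x) ->
  {ae leb, forall x, rho x <= K} -> (\int[leb]_x (rho x)%:E = 1)%E ->
  exists2 m, Loo_density m rho & Loo_norm rho <= K.
Proof.
move=> mrho r0 rK r1; have [m mE] := ex_density_probability mrho r0 r1.
have rK' : {ae leb, forall x, `|rho x| <= K}.
  by apply: filterS rK => x; rewrite ger0_norm.
have [rL rN] := ae_Lfun_oo mrho rK'.
by exists m => //; split.
Qed.

Lemma density_eq_ae m rho rho' : Loo_density m rho -> measurable_fun setT rho' ->
  (forall x, 0 <= rho' x) -> {ae leb, forall x, rho x = rho' x} -> Loo_density m rho'.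
Proof.
move=> mr mr' r0' rr'; have [r0 rL mE] := mr.
have rK := Loo_norm_ae rL.
split => //.
  have [] // := @ae_Lfun_oo rho' (Loo_norm rho) mr'.
  by apply: filterS2 rK rr' => x h <-.
move=> A mA; rewrite mE//; apply: ae_eq_integral => //.
- apply/measurable_EFinP; apply: measurable_funTS; exact: density_measurable mr.
- exact/measurable_EFinP/measurable_funTS.
- by apply: filterS rr' => x -> _.
Qed.

End Loo.

Section complete.
Context (R : realType) (d : nat).
Local Notation Rd := 'rV[R]_d.
Local Notation leb := (lebesgue_rV R d).
Variables (mk : nat -> prob R d) (rk : nat -> Rd -> R) (K : R).
Hypotheses (K0 : 0 <= K) (mk2 : forall k, Pp 2 (mk k))
  (rkd : forall k, Loo_density (mk k) (rk k))
  (rkK : forall k, Loo_norm (rk k) <= K)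
  (cauchy : forall e : R, 0 < e -> exists N : nat, forall k l psi,
    (N <= k)%N -> (N <= l)%N -> lip 1 psi ->
    `|rms psi (mk k) - rms psi (mk l)| <= e).

(** Truncation changes the densities on a null set and turns the a.e. bound [K] into a bound
    everywhere. *)
Let r k x := Num.min (rk k x) K.

Let rd k : Loo_density (mk k) (r k).
Proof.
have [r0 rL mE] := rkd k.
apply: (density_eq_ae (rkd k)).
- by apply: measurable_minr => //; exact: density_measurable (rkd k).
- by move=> x; rewrite le_min r0.
- apply: filterS (Loo_norm_ae rL) => x; rewrite ger0_norm// => h.
  by rewrite /r min_l// (le_trans h).
Qed.

Let mr k : measurable_fun setT (r k). Proof. exact: density_measurable (rd k). Qed.
Let r0 k x : 0 <= r k x. Proof. by have [] := rd k. Qed.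
Let rK k x : r k x <= K. Proof. by rewrite ge_min lexx orbT. Qed.

Let ir k : leb.-integrable setT (EFin \o r k).
Proof.
have ic : (mk k).-integrable setT (EFin \o (fun _ : Rd => 1)).
  exact: finite_measure_integrable_cst.
have := density_integrable (rd k) ic.
by apply: eq_integrable => // x _ /=; rewrite mul1r.
Qed.

Let r1 k : \int[leb]_x r k x = 1.
Proof.
have := @density_Rintegral _ _ _ _ (fun=> 1) (rd k) (measurable_cst _).
rewrite prob_Rintegral_cst => ->.
by apply: eq_Rintegral => x _; rewrite mul1r.
Qed.

(** Uniform integrability of the second moments. The radius is chosen for the measures up to index
    [N], with [e / 4] so that [rms] is at most half the square root of [e]; the Cauchy property,
    applied to the 1-Lipschitz [excess], adds the other half for later indices. *)
Let tail (e : R) : 0 < e -> exists2 rho, 0 <= rho &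
  forall k, \int[mk k]_x (excess rho x ^+ 2) <= e.
Proof.
move=> e0; have s0 : 0 < Num.sqrt e / 2 by rewrite divr_gt0// sqrtr_gt0.
have [N NP] := cauchy s0.
have e4 : 0 < e / 4 by rewrite divr_gt0.
have /choice[rh rhP] : forall k, exists rho, 0 <= rho /\ \int[mk k]_x (excess rho x ^+ 2) <= e / 4.
  by move=> k; have [rho a b] := excess_tail (mk2 k) e4; exists rho.
pose rho := \sum_(i < N.+1) rh i.
have mono a b k : a <= b -> \int[mk k]_x (excess b x ^+ 2) <= \int[mk k]_x (excess a x ^+ 2).
  move=> ab; apply: le_Rintegral => //; try exact: lip_sqr_integrable (excess_lip _) (mk2 k).
  by move=> x _; rewrite ler_pXn2r ?nnegrE ?excess_ge0// excess_anti.
have small k : (k <= N)%N -> \int[mk k]_x (excess rho x ^+ 2) <= e / 4.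
  move=> kN; have [_ h] := rhP k; apply: le_trans h; apply: mono.
  rewrite /rho (bigD1 (Ordinal (kN : (k < N.+1)%N)))//= lerDl sumr_ge0// => i _.
  by have [] := rhP i.
exists rho; first by apply: sumr_ge0 => i _; have [] := rhP i.
move=> k; have [kN|/ltnW kN] := leqP k N.
  by apply: (le_trans (small k kN)); lra.
have := NP k N (excess rho) kN (leqnn _) (excess_lip rho).
rewrite ler_norml => /andP[_ h].
have h2 : rms (excess rho) (mk N) <= Num.sqrt e / 2.
  rewrite -(ler_pXn2r (ltn0Sn 1)) ?nnegrE ?rms_ge0// ?(ltW s0)//.
  rewrite rms_sqr expr_div_n sqr_sqrtr ?(ltW e0)// (_ : 2 ^+ 2 = 4); last by ring.
  exact: (small N (leqnn N)).
have h3 : rms (excess rho) (mk k) <= Num.sqrt e by lra.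
rewrite -rms_sqr -[leRHS]sqr_sqrtr ?(ltW e0)//.
by rewrite ler_pXn2r ?nnegrE ?rms_ge0// sqrtr_ge0.
Qed.

Let growth (phi : Rd -> R) (C : R) :=
  measurable_fun setT phi /\ forall x, `|phi x| <= C * (1 + `|x| ^+ 2).

Let gi phi C k : growth phi C -> leb.-integrable setT (EFin \o (fun x => phi x * r k x)).
Proof. by move=> [mp pC]; apply: density_integrable (rd k) (Pp2_integrable (mk2 k) mp pC). Qed.

Let hull_int phi C n f : growth phi C -> hull r n f ->
  leb.-integrable setT (EFin \o (fun x => phi x * f x)) /\
  (forall c, (forall k, (n <= k)%N -> \int[mk k]_x phi x <= c) ->
     \int[leb]_x (phi x * f x) <= c).
Proof.
move=> g; move: f; apply: (hull_inv (P := fun f =>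
  leb.-integrable setT (EFin \o (fun x => phi x * f x)) /\
  (forall c, (forall k, (n <= k)%N -> \int[mk k]_x phi x <= c) ->
     \int[leb]_x (phi x * f x) <= c))) => [k nk|f h [fi fc] [hi hc]].
  split; first exact: gi g.
  by move=> c /(_ k nk); rewrite (density_Rintegral (rd k))//; case: g.
have fhi : leb.-integrable setT (EFin \o (fun x => phi x * f x + phi x * h x)).
  exact: (integrableD measurableT fi hi).
have E x : phi x * ((f x + h x) / 2) = 2^-1 * (phi x * f x + phi x * h x).
  by field.
split.
  have := integrableZl measurableT 2^-1 fhi; apply: eq_integrable => // x _ /=.
  by rewrite E.
move=> c ck; under eq_Rintegral do rewrite E.
rewrite RintegralZl// RintegralD//.
by have := fc c ck; have := hc c ck; lra.
Qed.

Let hull_meas n f : hull r n f -> measurable_fun setT f /\ forall x, 0 <= f x <= K.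
Proof.
move: f; apply: (hull_inv (P := fun f => measurable_fun setT f /\
  forall x, 0 <= f x <= K)) => [k _|f h [mf f0] [mh h0]].
  by split => // x; rewrite r0 rK.
split; last by move=> x; have := f0 x; have := h0 x; lra.
by apply: measurable_funM => //; exact: measurable_funD.
Qed.

Section limit.
Variables (s : nat -> Rd -> R) (rho : Rd -> R).
Hypotheses (sh : forall j, hull r j (s j)) (mrho : measurable_fun setT rho)
  (rho0 : forall x, 0 <= rho x <= K)
  (s_rho : {ae leb, forall x, s ^~ x @ \oo --> rho x}).

Let ms j : measurable_fun setT (s j). Proof. exact: (hull_meas (sh j)).1. Qed.
Let s0 j x : 0 <= s j x. Proof. by have /andP[] := (hull_meas (sh j)).2 x. Qed.
Let sK j x : s j x <= K. Proof. by have /andP[] := (hull_meas (sh j)).2 x. Qed.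
Let rho0' x : 0 <= rho x. Proof. by have /andP[] := rho0 x. Qed.
Let rhoK x : rho x <= K. Proof. by have /andP[] := rho0 x. Qed.

(** By Fatou's lemma; it bounds the tail of [rho] before any convergence of integrals is known. *)
Let limit_le w C c : growth w C -> (forall x, 0 <= w x) ->
  (forall k, \int[mk k]_x w x <= c) ->
  (\int[leb]_x (w x * rho x)%:E <= c%:E)%E.
Proof.
move=> g w0 wc; have [mw _] := g.
have mws n : measurable_fun setT (fun x => (w x * s n x)%:E).
  by apply/measurable_EFinP; exact: measurable_funM.
have ws0 n x : setT x -> (0 <= (w x * s n x)%:E)%E by rewrite lee_fin mulr_ge0.
have := fatou leb measurableT mws ws0.
rewrite (_ : \int[leb]_x limn_einf _ = \int[leb]_x (w x * rho x)%:E)%E; last first.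
  apply: ae_eq_integral => //.
  - rewrite /limn_einf; apply: (@measurableT_comp _ _ _ _ _ _ (@oppe R) _
      (fun x => limn_esup (fun n => (- (w x * s n x)%:E)%E))) => //.
    by apply: measurable_fun_limn_esup => n; exact: (@measurableT_comp _ _ _ _ _ _ (@oppe R)).
  - by apply/measurable_EFinP; exact: measurable_funM.
  - apply: filterS s_rho => x sx _.
    have cv : (fun n => (w x * s n x)%:E) @ \oo --> (w x * rho x)%:E.
      by apply: cvg_EFin; [exact: nearW|apply: cvgMr].
    by have [-> _] := cvg_limn_einf_sup cv.
move=> h; apply: (le_trans h); rewrite limn_einf_lim.
apply: lime_le; first exact: is_cvg_einfs.
apply: nearW => n; rewrite /einfs.
apply: (@le_trans _ _ (\int[leb]_x (w x * s n x)%:E)%E).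
  by apply: ereal_inf_lbound; exists n => /=.
have [wi wle] := hull_int g (sh n).
rewrite -(fineK (integrable_fin_num measurableT wi)) lee_fin.
by apply: wle => k _.
Qed.

(** Inside a large ball the densities are bounded by [K] and dominated convergence applies; outside,
    the quadratic growth of [phi] is absorbed by the uniform tail estimate. *)
Let limit_int phi C : 0 <= C -> growth phi C ->
  leb.-integrable setT (EFin \o (fun x => phi x * rho x)) /\
  forall e : R, 0 < e ->
    \forall j \near \oo, `|\int[leb]_x (phi x * s j x) - \int[leb]_x (phi x * rho x)| <= e.
Proof.
move=> C0 g; have [mphi pC] := g.
have main (e : R) : 0 < e -> leb.-integrable setT (EFin \o (fun x => phi x * rho x)) /\
    \forall j \near \oo, `|\int[leb]_x (phi x * s j x) - \int[leb]_x (phi x * rho x)| <= e.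
  (* The tails of [s j] and of [rho] cost [8 * C * e'] each, the ball costs [e']. *)
  move=> e0; pose e' := e / (16 * C + 2).
  have C16 : 0 < 16 * C + 2 by rewrite ltr_wpDl// mulr_ge0.
  have e'0 : 0 < e' by rewrite divr_gt0.
  have [t t0 tP] := tail e'0.
  pose rad := 2 * t + 1.
  (* Beyond [rad >= 1] one has 1 + |x|^2 <= 2 |x|^2 <= [w x]. *)
  pose w (x : Rd) := 8 * excess t x ^+ 2.
  have mtl : measurable_fun setT (fun x : Rd => excess t x ^+ 2).
    by apply: measurable_funX; exact: lip_measurable (excess_lip t).
  have w0 x : 0 <= w x by apply: mulr_ge0 => //; exact: sqr_ge0.
  have gw : growth w 8.
    split; first exact: measurable_funM.
    move=> x; rewrite ger0_norm// ler_wpM2l//.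
    apply: (@le_trans _ _ (`|x| ^+ 2)); last by rewrite lerDr.
    by rewrite ler_pXn2r ?nnegrE ?excess_ge0// excess_le.
  have wk k : \int[mk k]_x w x <= 8 * e'.
    rewrite RintegralZl//; first by rewrite ler_wpM2l// tP.
    exact: lip_sqr_integrable (excess_lip t) (mk2 k).
  pose B := @cball R d rad.
  have mB : measurable B by exact: measurable_cball.
  have rad1 : 1 <= rad by rewrite lerDr mulr_ge0.
  pose p1 (x : Rd) := phi x * \1_B x; pose p2 (x : Rd) := phi x * (1 - \1_B x).
  have mp1 : measurable_fun setT p1 by exact: measurable_funM.
  have mp2 : measurable_fun setT p2 by apply: measurable_funM => //; exact: measurable_funB.
  have pE x : phi x = p1 x + p2 x by rewrite /p1 /p2; ring.
  have p2w x : `|p2 x| <= C * w x.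
    rewrite /p2 indicE; case: (boolP (x \in B)) => xB.
      by rewrite subrr mulr0 normr0 mulr_ge0.
    rewrite subr0 mulr1 (le_trans (pC x))// ler_wpM2l//.
    have xr : rad < `|x|.
      by rewrite ltNge; apply: contra xB => h; rewrite inE.
    have := @sqr_le_excess R d t x t0; rewrite /w.
    have -> : 2 * t <= `|x| by move: xr; rewrite /rad; lra.
    move=> /(_ isT); have : 1 <= `|x| by apply: (le_trans rad1); exact: ltW.
    by set a := `|x|; set b := excess t x; nra.
  have p1b x : `|p1 x| <= C * (1 + rad ^+ 2) * \1_B x.
    rewrite /p1 indicE; case: (boolP (x \in B)) => xB; last by rewrite !mulr0 normr0.
    rewrite !mulr1 (le_trans (pC x))// ler_wpM2l// lerD2l.
    rewrite inE in xB; rewrite ler_pXn2r ?nnegrE//.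
    exact: le_trans rad1.
  have ip1 (f : Rd -> R) : measurable_fun setT f -> (forall x, 0 <= f x <= K) ->
      leb.-integrable setT (EFin \o (fun x => p1 x * f x)).
    move=> mf f0; apply: (le_integrable measurableT _ _ (integrable_cball d rad (C * (1 + rad ^+ 2) * K))).
      by apply/measurable_EFinP; exact: measurable_funM.
    move=> x _ /=; rewrite lee_fin normrM.
    have /andP[a b] := f0 x; rewrite (ger0_norm a) mulrAC.
    by rewrite (le_trans _ (ler_norm _))// ler_pM.
  have wrho := limit_le gw w0 wk.
  have iw : leb.-integrable setT (EFin \o (fun x => w x * rho x)).
    apply/integrableP; split; first by apply/measurable_EFinP; exact: measurable_funM (gw.1) mrho.
    rewrite (_ : \int[leb]_x _ = \int[leb]_x (w x * rho x)%:E)%E.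
      by rewrite (le_lt_trans wrho)// ltry.
    by apply: eq_integral => x _ /=; rewrite ger0_norm// mulr_ge0.
  have iws j := (hull_int gw (sh j)).1.
  have ip2 (f : Rd -> R) : measurable_fun setT f -> (forall x, 0 <= f x <= K) ->
      leb.-integrable setT (EFin \o (fun x => w x * f x)) ->
      leb.-integrable setT (EFin \o (fun x => p2 x * f x)) /\
      `|\int[leb]_x (p2 x * f x)| <= C * \int[leb]_x (w x * f x).
    move=> mf f0 iwf.
    have le x : `|p2 x * f x| <= C * (w x * f x).
      have /andP[a _] := f0 x.
      by rewrite normrM (ger0_norm a) mulrA ler_wpM2r.
    have iC := integrableZl measurableT C iwf.
    have i2 : leb.-integrable setT (EFin \o (fun x => p2 x * f x)).
      apply: (le_integrable measurableT _ _ iC).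
        by apply/measurable_EFinP; exact: measurable_funM.
      by move=> x _ /=; rewrite lee_fin (le_trans (le x))// ler_norm.
    split => //; apply: (le_trans (le_normr_Rintegral measurableT i2)).
    rewrite -RintegralZl//; apply: le_Rintegral => //.
    exact: (integrable_norm i2).
  have [i2r b2r] := ip2 rho mrho rho0 iw.
  have s0K j x : 0 <= s j x <= K by rewrite s0 sK.
  have i1r := ip1 rho mrho rho0.
  have split_int (f : Rd -> R) : leb.-integrable setT (EFin \o (fun x => p1 x * f x)) ->
     leb.-integrable setT (EFin \o (fun x => p2 x * f x)) ->
     leb.-integrable setT (EFin \o (fun x => phi x * f x)) /\
     \int[leb]_x (phi x * f x) = \int[leb]_x (p1 x * f x) + \int[leb]_x (p2 x * f x).
    move=> j1 j2; split.
      have := integrableD measurableT j1 j2; apply: eq_integrable => // x _ /=.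
      by rewrite -EFinD -mulrDl -pE.
    by rewrite -RintegralD//; apply: eq_Rintegral => x _; rewrite -mulrDl -pE.
  have [ir_ Er] := split_int rho i1r i2r; split => //.
  have mps j : measurable_fun setT (fun x => (p1 x * s j x)%:E).
    by apply/measurable_EFinP; exact: measurable_funM.
  have [||||_ _ cv] := @dominated_convergence _ _ _ leb setT measurableT
      (fun j x => (p1 x * s j x)%:E) (fun x => (p1 x * rho x)%:E)
      (fun x => (C * (1 + rad ^+ 2) * K * \1_B x)%:E) mps.
  - by apply/measurable_EFinP; exact: measurable_funM.
  - apply: filterS s_rho => x sx _.
    by apply: cvg_EFin; [exact: nearW|apply: cvgMr].
  - exact: integrable_cball.
  - apply: aeW => x j _; rewrite lee_fin normrM (ger0_norm (s0 j x)) mulrAC.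
    by rewrite ler_pM.
  rewrite -(fineK (integrable_fin_num measurableT i1r)) in cv.
  move: cv => /fine_cvgP[_ /cvgrPdist_le/(_ _ e'0)].
  apply: filterS => j /= hj.
  have [i2s b2s] := ip2 (s j) (ms j) (s0K j) (iws j).
  have [_ ->] := split_int (s j) (ip1 _ (ms j) (s0K j)) i2s.
  rewrite Er.
  have h1 : \int[leb]_x (w x * s j x) <= 8 * e' by apply: (hull_int gw (sh j)).2 => k _.
  have h2 : \int[leb]_x (w x * rho x) <= 8 * e'.
    by rewrite -lee_fin fineK//; exact: integrable_fin_num iw.
  have eE : e = (16 * C + 2) * e' by rewrite /e' mulrC divfK// gt_eqF.
  have h1' := ler_wpM2l C0 h1; have h2' := ler_wpM2l C0 h2.
  move: hj; rewrite distrC => hj.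
  rewrite [leLHS](_ : _ = `|(\int[leb]_x (p1 x * s j x) - \int[leb]_x (p1 x * rho x)) +
    (\int[leb]_x (p2 x * s j x) - \int[leb]_x (p2 x * rho x))|); last by congr `|_|; ring.
  apply: (le_trans (ler_normD _ _)).
  have := ler_normB (\int[leb]_x (p2 x * s j x)) (\int[leb]_x (p2 x * rho x)).
  move: hj; rewrite /Rintegral/= => hj.
  by rewrite eE; move: b2s b2r h1' h2'; rewrite /Rintegral; lra.
by split; [exact: (main 1 ltr01).1|move=> e /main[]].
Qed.

(** An element of a late hull has integral close to [l], as the measures that enter it do; both
    one-sided bounds come from [hull_int]. *)
Let limit_eq phi C l : 0 <= C -> growth phi C ->
  (fun k => \int[mk k]_x phi x) @ \oo --> l ->
  \int[leb]_x (phi x * rho x) = l.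
Proof.
move=> C0 g cv; have [mphi pC] := g.
have gN : growth (fun x => - phi x) C.
  by split; [exact: measurable_funN|move=> x; rewrite normrN].
apply/eqP; rewrite eq_le; apply/andP; split; apply/ler_addgt0Pr => e e0.
all: have e2 : 0 < e / 2 by rewrite divr_gt0.
all: have /cvgrPdist_le/(_ _ e2)[N _ NP] := cv.
all: have [_ /(_ _ e2)[N' _ N'P]] := limit_int C0 g.
all: pose j := maxn N N'.
all: have := N'P j (leq_maxr _ _); rewrite /= ler_norml => /andP[h1 h2].
- have : \int[leb]_x (phi x * s j x) <= l + e / 2.
    apply: (hull_int g (sh j)).2 => k jk.
    have /= := NP k (leq_trans (leq_maxl _ _) jk).
    by rewrite distrC ler_norml => /andP[_]; lra.
  by lra.
- have : \int[leb]_x (- phi x * s j x) <= - l + e / 2.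
    apply: (hull_int gN (sh j)).2 => k jk.
    have /= := NP k (leq_trans (leq_maxl _ _) jk).
    rewrite ler_norml => /andP[_].
    have -> : \int[mk k]_x (- phi x) = - \int[mk k]_x phi x.
      rewrite -mulN1r -RintegralZl//; last exact: Pp2_integrable (mk2 k) mphi pC.
      by apply: eq_Rintegral => x _; rewrite mulN1r.
    by lra.
  have -> : \int[leb]_x (- phi x * s j x) = - \int[leb]_x (phi x * s j x).
    rewrite -mulN1r -RintegralZl//; last exact: (hull_int g (sh j)).1.
    by apply: eq_Rintegral => x _; ring.
  by lra.
Qed.

(** For Lipschitz [psi] the integrals of [psi ^+ 2] converge along the original sequence, since
    [rms] of a rescaled [psi] is Cauchy; [limit_eq] identifies the limit through the convex
    combinations. Thus the measures [mk] themselves converge for d_2. *)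
Lemma limit_density : exists m,
  [/\ Pp 2 m, Loo_density m rho,
   (forall e : R, 0 < e -> \forall k \near \oo, wasserstein 2 (mk k) m < e) &
   forall L, (\forall k \near \oo, Loo_norm (rk k) <= L) -> Loo_norm rho <= L].
Proof.
have g1 : growth (fun=> 1) 1.
  by split => // x; rewrite normr1 mul1r lerDl sqr_ge0.
have [i1 _] := limit_int ler01 g1.
have rho1 : (\int[leb]_x (rho x)%:E = 1)%E.
  have E : (\int[leb]_x (rho x)%:E = \int[leb]_x (1 * rho x)%:E)%E.
    by apply: eq_integral => x _; rewrite mul1r.
  rewrite E -(fineK (integrable_fin_num measurableT i1)); congr (_%:E).
  apply: (limit_eq ler01 g1); rewrite (_ : (fun k => _) = fun=> 1); first exact: cvg_cst.
  apply/funext => k; rewrite Rintegral_cst// mul1r.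
  by have /(congr1 fine) := probability_setT (mk k).
have rhoKae : {ae leb, forall x, rho x <= K} by exact: aeW.
have [m mrho_ _] := ex_Loo_density mrho rho0' rhoKae rho1.
have m2 : Pp 2 m.
  have ge : growth (fun x => enorm x ^+ 2) d%:R.
    split; first exact: measurable_enorm2.
    move=> x; rewrite ger0_norm ?sqr_ge0// (le_trans (enorm2_le x))//.
    by rewrite ler_wpM2l// lerDr.
  have [/integrableP[_ +] _] := limit_int (ler0n _ _) ge.
  rewrite /Pp/=; have [_ _ mE] := mrho_.
  rewrite (ge0_integral_density mrho rho0' mE)//; last 2 first.
  - by apply/measurable_EFinP; exact: measurable_enorm2.
  - by move=> x; rewrite lee_fin sqr_ge0.
  congr (_ < _)%E; apply: eq_integral => x _ /=.
  by rewrite ger0_norm ?EFinM// mulr_ge0// sqr_ge0.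
exists m; split => //.
- apply: wasserstein_cvg => // L psi pL.
  have [C C0 pC] := lip_growth pL.
  have gp : growth (fun x => psi x ^+ 2) C.
    split; first by apply: measurable_funX; exact: lip_measurable pL.
    by move=> x; rewrite ger0_norm ?sqr_ge0.
  have L1 : 0 < `|L| + 1 by rewrite ltr_wpDl.
  pose psi' x := psi x / (`|L| + 1).
  have p1 : lip 1 psi'.
    move=> x y; rewrite /psi' -mulrBl normrM (@ger0_norm _ _^-1) ?invr_ge0 ?(ltW L1)//.
    rewrite ler_pdivrMr// mul1r mulrC (le_trans (pL x y))// ler_wpM2r//.
    by rewrite (le_trans (ler_norm _))// lerDl.
  have E (mu : prob R d) : Pp 2 mu -> \int[mu]_x (psi x ^+ 2) = (`|L| + 1) ^+ 2 * rms psi' mu ^+ 2.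
    move=> mu2; rewrite rms_sqr -RintegralZl//; last exact: lip_sqr_integrable p1 mu2.
    by apply: eq_Rintegral => x _; rewrite /psi' -exprMn mulrC divfK// gt_eqF.
  have cT : cvgn (fun k => rms psi' (mk k)).
    apply/cauchy_cvgP/cauchy_exP => e e0.
    have e2 : 0 < e / 2 by rewrite divr_gt0.
    have [N NP] := cauchy e2.
    exists (rms psi' (mk N)); exists N => // k Nk; rewrite /ball/=.
    by apply: (le_lt_trans (NP _ _ _ (leqnn N) Nk p1)); rewrite ltr_pdivrMr// ltr_pMr// ltr1n.
  have cv : (fun k => \int[mk k]_x (psi x ^+ 2)) @ \oo -->
      (`|L| + 1) ^+ 2 * (limn (fun k => rms psi' (mk k))) ^+ 2.
    under eq_fun do rewrite E//.
    by apply: cvgM; [exact: cvg_cst|rewrite expr2; under eq_fun do rewrite expr2; exact: cvgM].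
  rewrite (density_Rintegral mrho_); last by case: gp.
  by rewrite (limit_eq C0 gp cv).
- move=> L [N _ NL].
  (* Elements of [hull r j] with [j >= N] only involve densities of index at least [N], which are at
     most [L] almost everywhere. *)
  have sL : {ae leb, forall x, forall j, (N <= j)%N -> s j x <= L}.
    apply: ae_foralln => j.
    have [Nj|jN] := leqP N j; last first.
      exact: aeW.
    suff : {ae leb, forall x, s j x <= L} by apply: filterS => x + _.
    move: (sh j); apply: (hull_inv (P := fun f => {ae leb, forall x, f x <= L})) => [k jk|f h].
      have [_ rkL _] := rkd k; apply: filterS (Loo_norm_ae rkL) => x h.
      rewrite /r ge_min (le_trans (ler_norm _))// (le_trans h)//.
      exact: NL (leq_trans Nj jk).
    by apply: filterS2 => x hf hh; lra.
  suff rL : {ae leb, forall x, `|rho x| <= L} by have [] := ae_Lfun_oo mrho rL.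
  apply: filterS2 s_rho sL => x sx sL; rewrite ger0_norm//.
  rewrite -(cvg_lim _ sx)//; apply: limr_le; first by apply/cvg_ex; exists (rho x).
  by exists N.
Qed.

End limit.

Lemma Loo_complete : exists m rho,
  [/\ Pp 2 m, Loo_density m rho,
   (forall e : R, 0 < e -> \forall k \near \oo, wasserstein 2 (mk k) m < e) &
   forall L, (\forall k \near \oo, Loo_norm (rk k) <= L) -> Loo_norm rho <= L].
Proof.
have r1' k : \int[leb]_x r k x <= 1 by rewrite r1.
have [s [rho [sh mrho rho0 srho]]] := mazur mr K0 r0 rK ir r1'.
have [m ?] := limit_density sh mrho rho0 srho.
by exists m, rho.
Qed.

End complete.

(** * Ekeland's variational principle *)

Section ekeland.
Context (R : realType) (X : Type) (Psi : X -> R) (delta : X -> X -> R)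
  (M eps : R).
Hypotheses (eps0 : 0 < eps) (PsiM : forall x, M <= Psi x)
  (delta0 : forall x y, 0 <= delta x y) (deltaxx : forall x, delta x x = 0)
  (deltaC : forall x y, delta x y = delta y x)
  (deltaT : forall x y z, delta x z <= delta x y + delta y z)
  (complete : forall x : nat -> X, (forall k, Psi (x k.+1) <= Psi (x k)) ->
    (forall e : R, 0 < e -> exists N : nat, forall k l, (N <= k)%N -> (N <= l)%N ->
      delta (x k) (x l) <= e) ->
    exists y, (forall e : R, 0 < e -> \forall k \near \oo, delta y (x k) <= e) /\
      forall k, Psi y <= Psi (x k)).

Let S x := [set y | Psi y + eps * delta y x <= Psi x].

Let Sxx x : S x x. Proof. by rewrite /S/= deltaxx mulr0 addr0. Qed.

Let S_le x y : S x y -> Psi y <= Psi x.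
Proof. by apply: le_trans; rewrite lerDl mulr_ge0// ltW. Qed.

Let S_trans x y z : S x y -> S y z -> S x z.
Proof.
rewrite /S/= => xy yz; have := ler_wpM2l (ltW eps0) (deltaT z y x).
by rewrite mulrDr; lra.
Qed.

Let next (n : nat) x : exists y, S x y /\ forall z, S x z -> Psi y <= Psi z + n.+1%:R^-1.
Proof.
have hI : has_inf [set Psi y | y in S x].
  by split; [exists (Psi x), x|exists M => _ [y _ <-]].
have n0 : 0 < n.+1%:R^-1 :> R by rewrite invr_gt0.
have [_ [y Sy <-] yI] := inf_adherent n0 hI.
exists y; split => // z Sz; apply: (le_trans (ltW yI)).
by rewrite lerD2r; apply: ge_inf; [case: hI|exists z].
Qed.

(** Each [x n.+1] nearly minimises [Psi] on [S (x n)], so these nested sets shrink to the limit [y].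
    Completeness and lower semicontinuity are joined in one hypothesis on sequences with decreasing
    [Psi], because for measures only these have bounded densities. *)
Lemma ekeland x0 : exists y, Psi y <= Psi x0 /\
  forall x, Psi y <= Psi x + eps * delta x y.
Proof.
have /choice[nx nxP] : forall p : nat * X, exists y, S p.2 y /\
    forall z, S p.2 z -> Psi y <= Psi z + p.1.+1%:R^-1 by move=> [n x]; exact: next.
pose x := fix x n := if n is k.+1 then nx (k, x k) else x0.
have xS n : S (x n) (x n.+1) by have [] := nxP (n, x n).
have xI n z : S (x n) z -> Psi (x n.+1) <= Psi z + n.+1%:R^-1.
  by have [_] := nxP (n, x n); exact.
have xS' n p : (n <= p)%N -> S (x n) (x p).
  move=> /subnK <-; elim: (p - n)%N => [|k IH]; first by rewrite add0n.
  by rewrite addSn; exact: S_trans IH (xS _).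
have close n z : S (x n.+1) z -> eps * delta z (x n.+1) <= n.+1%:R^-1.
  move=> Sz.
  have : Psi z + eps * delta z (x n.+1) <= Psi (x n.+1) := Sz.
  move: (xI n z (S_trans (xS n) Sz)).
  by set rr := _^-1; set a := delta _ _; set b := Psi (x n.+1); move=> h1 h2; lra.
have inv_small e : 0 < e -> exists N : nat, forall n, (N <= n)%N -> n.+1%:R^-1 <= e :> R.
  move=> e0; exists (Num.truncn e^-1) => n Nn; rewrite invf_ple ?posrE//.
  apply/ltW/(lt_le_trans (Num.Theory.truncnS_gt _)).
  by rewrite ler_nat ltnS.
have [||y [yx yP]] := @complete x.
- by move=> k; exact: S_le.
- move=> e e0; have e2 : 0 < eps * e by rewrite mulr_gt0.
  have [N NP] := inv_small _ e2.
  have h k l : (N < k)%N -> (k <= l)%N -> delta (x l) (x k) <= e.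
    case: k => // k Nk kl; have := close k _ (xS' _ _ kl).
    move=> /le_trans/(_ (NP k Nk)); by rewrite ler_pM2l.
  exists N.+1 => k l Nk Nl; have [kl|/ltnW lk] := leqP k l.
    by rewrite deltaC; exact: h.
  exact: h.
have yS n : S (x n) y.
  rewrite /S/=; apply/ler_addgt0Pr => e e0.
  have e2 : 0 < e / eps by rewrite divr_gt0.
  have [N _ NP] := yx _ e2.
  have h1 := NP (maxn N n) (leq_maxl _ _).
  have h2 : Psi (x (maxn N n)) + eps * delta (x (maxn N n)) (x n) <= Psi (x n) :=
    xS' _ _ (leq_maxr N n).
  have h3 := yP (maxn N n).
  have h4 := ler_wpM2l (ltW eps0) (deltaT y (x (maxn N n)) (x n)).
  move: h1; rewrite /= ler_pdivlMr// mulrC => h1.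
  by move: h4; rewrite mulrDr; lra.
exists y; split; first exact: (yP 0%N).
(* A point [z] violating the claim would lie in every [S (x n)]; near-minimality would then give
   [Psi y <= Psi z], against the violation. *)
move=> z; rewrite leNgt; apply/negP => zy.
have zS n : S (x n) z.
  rewrite /S/=.
  have h1 : Psi y + eps * delta y (x n) <= Psi (x n) := yS n.
  have h4 := ler_wpM2l (ltW eps0) (deltaT z y (x n)).
  by move: h4; rewrite mulrDr; lra.
have : Psi y <= Psi z.
  apply/ler_addgt0Pr => e e0; have [N NP] := inv_small _ e0.
  have := xI N z (zS N); have := NP N (leqnn N); have := yP N.+1.
  by set rr := _^-1; set b := Psi (x N.+1); move=> h1 h2 h3; lra.
have := mulr_ge0 (ltW eps0) (delta0 z y); lra.
Qed.

End ekeland.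

Section rms_distance.
Context (R : realType) (d : nat).
Local Notation Rd := 'rV[R]_d.
Implicit Types (m : prob R d).

(* A pseudo-distance on P_2 dominated by the Wasserstein distance; unlike for
   the latter, the triangle inequality does not require gluing couplings. *)
Definition rms_dist m m' : R :=
  sup [set `|rms psi m - rms psi m'| | psi in [set psi : Rd -> R | lip 1 psi]].

Let rms_set m m' := [set `|rms psi m - rms psi m'| | psi in [set psi : Rd -> R | lip 1 psi]].

Let lip0 : lip 1 (fun _ : Rd => 0 : R).
Proof. by move=> x y; rewrite subrr normr0 mul1r. Qed.

Let rms_has_sup m m' : Pp 2 m -> Pp 2 m' -> has_sup (rms_set m m').
Proof.
move=> m2 m2'; split; first by exists `|rms (fun=> 0) m - rms (fun=> 0) m'|, (fun=> 0).
by exists (wasserstein 2 m m') => _ [psi p1 <-]; exact: rms_wasserstein.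
Qed.

Lemma rms_dist_ge m m' psi : Pp 2 m -> Pp 2 m' -> lip 1 psi ->
  `|rms psi m - rms psi m'| <= rms_dist m m'.
Proof.
by move=> m2 m2' p1; apply: (ub_le_sup (rms_has_sup m2 m2').2); exists psi.
Qed.

Lemma rms_dist_le m m' (c : R) :
  (forall psi, lip 1 psi -> `|rms psi m - rms psi m'| <= c) -> rms_dist m m' <= c.
Proof.
move=> h; apply: ge_sup; first by exists `|rms (fun=> 0) m - rms (fun=> 0) m'|, (fun=> 0).
by move=> _ [psi p1 <-]; exact: h.
Qed.

Lemma rms_dist_ge0 m m' : Pp 2 m -> Pp 2 m' -> 0 <= rms_dist m m'.
Proof. by move=> m2 m2'; apply: le_trans (rms_dist_ge m2 m2' lip0). Qed.

Lemma rms_dist_wasserstein m m' : Pp 2 m -> Pp 2 m' ->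
  rms_dist m m' <= wasserstein 2 m m'.
Proof. by move=> m2 m2'; apply: rms_dist_le => psi; exact: rms_wasserstein. Qed.

Lemma rms_distxx m : Pp 2 m -> rms_dist m m = 0.
Proof.
move=> m2; apply/eqP; rewrite eq_le rms_dist_ge0// andbT.
by apply: rms_dist_le => psi _; rewrite subrr normr0.
Qed.

Lemma rms_distC m m' : rms_dist m m' = rms_dist m' m.
Proof.
by rewrite /rms_dist; congr sup; apply/seteqP; split => _ [psi p1 <-];
  exists psi => //; rewrite distrC.
Qed.

Lemma rms_dist_triangle m m1 m' : Pp 2 m -> Pp 2 m1 -> Pp 2 m' ->
  rms_dist m m' <= rms_dist m m1 + rms_dist m1 m'.
Proof.
move=> m2 m12 m2'; apply: rms_dist_le => psi p1.
apply: le_trans (lerD (rms_dist_ge m2 m12 p1) (rms_dist_ge m12 m2' p1)).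
exact: ler_distD.
Qed.

End rms_distance.

Section complete_liminf.
Context (R : realType) (d : nat).
Local Notation Rd := 'rV[R]_d.

Lemma rms_cvg_wasserstein (mk : nat -> prob R d) m :
  (forall k, Pp 2 (mk k)) -> Pp 2 m ->
  (forall psi, lip 1 psi -> (fun k => rms psi (mk k)) @ \oo --> rms psi m) ->
  forall e : R, 0 < e -> \forall k \near \oo, wasserstein 2 (mk k) m < e.
Proof.
move=> mk2 m2 cv; apply: wasserstein_cvg => // L psi pL.
have L1 : 0 < `|L| + 1 by rewrite ltr_wpDl.
pose psi' x := psi x / (`|L| + 1).
have p1 : lip 1 psi'.
  move=> x y; rewrite /psi' -mulrBl normrM (@ger0_norm _ _^-1) ?invr_ge0 ?(ltW L1)//.
  rewrite ler_pdivrMr// mul1r mulrC (le_trans (pL x y))// ler_wpM2r//.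
  by rewrite (le_trans (ler_norm _))// lerDl.
have E (mu : prob R d) : Pp 2 mu ->
    \int[mu]_x (psi x ^+ 2) = (`|L| + 1) ^+ 2 * (rms psi' mu * rms psi' mu).
  move=> mu2; rewrite -expr2 rms_sqr -RintegralZl//; last exact: lip_sqr_integrable p1 mu2.
  by apply: eq_Rintegral => x _; rewrite /psi' -exprMn mulrC divfK// gt_eqF.
rewrite E//; under eq_fun do rewrite E//.
by apply: cvgM; [exact: cvg_cst|apply: cvgM; exact: cv].
Qed.

(* Along the whole sequence the norm bound only has to hold infinitely often: the
   limit is built from a subsequence with nearly minimal norms. *)
Lemma Loo_complete_liminf (mk : nat -> prob R d) (rk : nat -> Rd -> R) (K : R) :
  0 <= K -> (forall k, Pp 2 (mk k)) -> (forall k, Loo_density (mk k) (rk k)) ->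
  (forall k, Loo_norm (rk k) <= K) ->
  (forall e : R, 0 < e -> exists N : nat, forall k l,
    (N <= k)%N -> (N <= l)%N -> rms_dist (mk k) (mk l) <= e) ->
  exists m rho,
  [/\ Pp 2 m, Loo_density m rho,
   (forall e : R, 0 < e -> \forall k \near \oo, wasserstein 2 (mk k) m < e) &
   forall L, (forall N, exists2 k, (N <= k)%N & Loo_norm (rk k) <= L) ->
     Loo_norm rho <= L].
Proof.
move=> K0 mk2 rkd rkK cauchy.
pose I (n : nat) := [set Loo_norm (rk k) | k in [set k | (n <= k)%N]].
have hI n : has_inf (I n).
  by split; [exists (Loo_norm (rk n)), n => /=|exists 0 => _ [k _ <-]; exact: Loo_norm_ge0].
have /choice[phi phiP] : forall n, exists k, (n <= k)%N /\
    Loo_norm (rk k) <= inf (I n) + n.+1%:R^-1.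
  move=> n; have n0 : 0 < n.+1%:R^-1 :> R by rewrite invr_gt0.
  have [_ [k /= nk <-] h] := inf_adherent n0 (hI n).
  by exists k; split => //; exact: ltW.
have phin n : (n <= phi n)%N by have [] := phiP n.
have [|m [rho [m2 mrho mW mN]]] := @Loo_complete R d (mk \o phi) (rk \o phi) K K0
  (fun k => mk2 (phi k)) (fun k => rkd (phi k)) (fun k => rkK (phi k)).
- move=> e e0; have [N NP] := cauchy e e0.
  exists N => k l psi Nk Nl p1.
  apply: (le_trans (rms_dist_ge (mk2 (phi k)) (mk2 (phi l)) p1)).
  by apply: NP; [exact: leq_trans Nk (phin k)|exact: leq_trans Nl (phin l)].
exists m, rho; split; [exact: m2|exact: mrho| |].
(* The measures [mk (phi n)] converge, and the Cauchy property carries this over to the whole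
   sequence. *)
- apply: rms_cvg_wasserstein => // psi p1; apply/cvgrPdist_le => e e0.
  have e2 : 0 < e / 2 by rewrite divr_gt0.
  have [N NP] := cauchy _ e2; have [N' _ N'P] := mW _ e2.
  exists N => // k /= Nk; set n := maxn N N'.
  have h1 : rms_dist (mk (phi n)) (mk k) <= e / 2.
    by apply: NP => //; exact: leq_trans (leq_maxl _ _) (phin n).
  have h2 := N'P n (leq_maxr _ _).
  have h3 := rms_wasserstein (mk2 (phi n)) m2 p1.
  have h4 := rms_dist_ge (mk2 (phi n)) (mk2 k) p1.
  rewrite (le_trans (ler_distD (rms psi (mk (phi n))) _ _))//.
  rewrite [leRHS]splitr lerD//; last exact: le_trans h1.
  by rewrite distrC (le_trans h3)// ltW.
- move=> L LP; apply/ler_addgt0Pr => e e0; apply: mN.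
  exists (Num.truncn e^-1) => // n Nn; rewrite /=.
  have [_ h] := phiP n; apply: (le_trans h); apply: lerD.
    have [k nk kL] := LP n; apply: le_trans kL.
    by apply: ge_inf; [case: (hI n)|exists k].
  rewrite invf_ple ?posrE//.
  apply/ltW/(lt_le_trans (Num.Theory.truncnS_gt _)).
  by rewrite ler_nat ltnS.
Qed.

End complete_liminf.

(** * Continuity of the comparison functional *)

Section regular.
Context (R : realType) (d : nat).
Local Notation Rd := 'rV[R]_d.
Local Notation leb := (lebesgue_rV R d).
Implicit Types (m n : prob R d) (U V : Rd -> prob R d -> R).

(** What is retained of a weak solution once [Jfun] is known to be nonnegative; [L] is a constant
    for the sup norm. *)
Definition regular U (M L : R) := [/\ 0 <= M, 0 <= L,
  forall x m, Pp 2 m -> `|U x m| <= M,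
  forall m, Pp 2 m -> lip L (U ^~ m) & continuous_RdP2 U].

Lemma weak_solution_regular H F U : weak_solution H F U ->
  exists M L, regular U M L.
Proof.
move=> [[M UM] cU [L UL] _ _]; exists `|M|, (`|L| * d%:R); split => //.
- by move=> x m m2; rewrite (le_trans (UM x m m2))// ler_norm.
- move=> m m2 x y; rewrite (le_trans (UL m m2 x y))//.
  apply: (@le_trans _ _ (`|L| * enorm (x - y))).
    by rewrite ler_wpM2r ?enorm_ge0// ler_norm.
  by rewrite -mulrA ler_wpM2l// enorm_le.
Qed.

Section regular_facts.
Variables (U : Rd -> prob R d -> R) (M L : R).
Hypothesis rU : regular U M L.

Lemma regular_measurable m : Pp 2 m -> measurable_fun setT (U ^~ m).
Proof. by case: rU => _ _ _ UL _ m2; exact: lip_measurable (UL m m2). Qed.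

Lemma regular_integrable m n : Pp 2 m ->
  n.-integrable setT (EFin \o (U ^~ m)).
Proof.
move=> m2; case: rU => _ _ UM _ _.
by apply: (bounded_integrable n (regular_measurable m2) (C := M)) => x; exact: UM.
Qed.

Lemma prob_Rintegral_le n (f : Rd -> R) (C : R) : measurable_fun setT f ->
  (forall x, `|f x| <= C) -> `|\int[n]_x f x| <= C.
Proof.
move=> mf fC; have fi := bounded_integrable n mf fC.
apply: (le_trans (le_normr_Rintegral measurableT fi)).
apply: (@le_trans _ _ (\int[n]_x C)).
  apply: le_Rintegral => //; first exact: (integrable_norm fi).
  exact: finite_measure_integrable_cst.
by rewrite prob_Rintegral_cst.
Qed.

(** The two limits are taken one at a time: in the measure argument of [U] by dominated convergence,
    in the integrating measure by the Lipschitz bound, which is uniform in [k]. *)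
Lemma regular_cvg (mk nk : nat -> prob R d) m n :
  (forall k, Pp 2 (mk k)) -> (forall k, Pp 2 (nk k)) -> Pp 2 m -> Pp 2 n ->
  (forall e : R, 0 < e -> \forall k \near \oo, wasserstein 2 (mk k) m < e) ->
  (forall e : R, 0 < e -> \forall k \near \oo, wasserstein 2 (nk k) n < e) ->
  (fun k => \int[nk k]_x U x (mk k)) @ \oo --> \int[n]_x U x m.
Proof.
move=> mk2 nk2 m2 n2 cm cn; case: rU => M0 L0 UM UL cU.
have cvn : (fun k => \int[n]_x U x (mk k)) @ \oo --> \int[n]_x U x m.
  have mU k : measurable_fun setT (fun x => (U x (mk k))%:E).
    by apply/measurable_EFinP; exact: regular_measurable.
  have [||||_ _ cv] := @dominated_convergence _ _ _ n setT measurableT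
      (fun k x => (U x (mk k))%:E) (fun x => (U x m)%:E) (fun=> M%:E) mU.
  - by apply/measurable_EFinP; exact: regular_measurable.
  - apply: aeW => x _; apply: cvg_EFin; first exact: nearW.
    apply/cvgrPdist_lt => e e0; have [r r0 rP] := cU x m m2 e e0.
    apply: filterS (cm r r0) => k kr /=; rewrite distrC; apply: rP => //.
    by rewrite subrr (le_lt_trans (enorm_le _))// normr0 mulr0.
  - exact: finite_measure_integrable_cst.
  - by apply: aeW => x k _; rewrite lee_fin UM.
  have im := regular_integrable n m2.
  rewrite -(fineK (integrable_fin_num measurableT im)) in cv.
  by move: cv => /fine_cvgP[].
apply/cvgrPdist_le => e e0; have e2 : 0 < e / 2 by rewrite divr_gt0.
have L1 : 0 < L + 1 by rewrite ltr_wpDl.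
have e3 : 0 < e / 2 / (L + 1) by rewrite divr_gt0.
move/cvgrPdist_le: cvn => /(_ _ e2); have := cn _ e3; apply: filterS2 => k h1 h2.
rewrite (le_trans (ler_distD (\int[n]_x U x (mk k)) _ _))// [leRHS]splitr lerD//.
rewrite distrC.
have UMk x : `|U x (mk k)| <= M by exact: UM.
apply: (le_trans (lip_integral_wasserstein (nk2 k) n2 L0 (UL _ (mk2 k)) UMk)).
apply: (@le_trans _ _ (L * (e / 2 / (L + 1)))); first by rewrite ler_wpM2l// ltW.
by rewrite mulrCA ger_pMr// ler_pdivrMr// mul1r lerDl.
Qed.

End regular_facts.

Definition Jfun U V m (rho : Rd -> R) n (sigma : Rd -> R) : R :=
  \int[leb]_x ((U x m - V x n) * (rho x - sigma x)).

(** Removes the densities: [Jfun] depends on the measures alone, and [regular_cvg] then makes it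
    continuous for d_2. *)
Lemma JfunE U V M L M' L' m rho n sigma : regular U M L -> regular V M' L' ->
  Pp 2 m -> Pp 2 n -> Loo_density m rho -> Loo_density n sigma ->
  Jfun U V m rho n sigma = (\int[m]_x U x m - \int[n]_x U x m) -
    (\int[m]_x V x n - \int[n]_x V x n).
Proof.
move=> rU rV m2 n2 mr ns.
have mU := regular_measurable rU m2; have mV := regular_measurable rV n2.
rewrite (density_Rintegral mr mU) (density_Rintegral ns mU).
rewrite (density_Rintegral mr mV) (density_Rintegral ns mV).
have i1 := density_integrable mr (regular_integrable rU m m2).
have i2 := density_integrable ns (regular_integrable rU n m2).
have i3 := density_integrable mr (regular_integrable rV m n2).
have i4 := density_integrable ns (regular_integrable rV n n2).
rewrite -!RintegralB//; last 2 first.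
- exact: (integrableB measurableT i1 i2).
- exact: (integrableB measurableT i3 i4).
by apply: eq_Rintegral => x _; ring.
Qed.

End regular.

(** * Gradients of semiconcave functions *)

Section convex_slopes.
Context (R : realType) (G : R -> R).
Hypothesis convG : forall t a b, 0 <= t <= 1 ->
  G (t * a + (1 - t) * b) <= t * G a + (1 - t) * G b.

Let sl h := (G h - G 0) / h.

Lemma slope_pos h1 h2 : 0 < h1 -> h1 <= h2 -> sl h1 <= sl h2.
Proof.
move=> h10 h12; have h20 : 0 < h2 by exact: lt_le_trans h12.
have t01 : 0 <= h1 / h2 <= 1.
  by rewrite divr_ge0 ?(ltW h10) ?(ltW h20)//= ler_pdivrMr// mul1r.
have := convG h2 0 t01; rewrite mulr0 addr0 divfK ?gt_eqF// => c.
rewrite /sl ler_pdivrMr// mulrAC -mulrA lerBlDr.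
by apply: (le_trans c); lra.
Qed.

Lemma slope_neg h1 h2 : h2 < 0 -> h1 <= h2 -> sl h1 <= sl h2.
Proof.
move=> h20 h12; have h10 : h1 < 0 by exact: le_lt_trans h20.
have t01 : 0 <= h2 / h1 <= 1.
  by rewrite -[X in 0 <= X]mulrNN -invrN divr_ge0 ?oppr_ge0 ?(ltW h10) ?(ltW h20)//= ler_ndivrMr// mul1r.
have := convG h1 0 t01; rewrite mulr0 addr0 divfK ?lt_eqF// => c.
rewrite /sl ler_ndivlMr// mulrAC -mulrA lerBlDr.
by apply: (le_trans c); lra.
Qed.

Lemma slope_neg_pos h1 h2 : h1 < 0 -> 0 < h2 -> sl h1 <= sl h2.
Proof.
move=> h10 h20; have D : 0 < h2 - h1 by lra.
have t01 : 0 <= h2 / (h2 - h1) <= 1.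
  by rewrite divr_ge0 ?(ltW h20) ?(ltW D)//= ler_pdivrMr//; lra.
have := convG h1 h2 t01.
rewrite (_ : _ * h1 + _ = 0); last by field; rewrite gt_eqF.
move=> c; rewrite /sl ler_pdivlMr// mulrAC ler_ndivrMr//.
have := ler_wpM2r (ltW D) c.
rewrite (_ : (_ + _) * (h2 - h1) = h2 * G h1 - h1 * G h2); last by field; rewrite gt_eqF.
by lra.
Qed.

Let h (n : nat) : R := n.+1%:R^-1.
Let h0 n : 0 < h n. Proof. by rewrite invr_gt0. Qed.

Let h_mono n p : (n <= p)%N -> h p <= h n.
Proof. by move=> np; rewrite /h lef_pV2 ?posrE// ler_nat ltnS. Qed.

Let gap n := sl (h n) - sl (- h n).

Lemma gap_ge0 n : 0 <= gap n.
Proof. by rewrite subr_ge0; apply: slope_neg_pos; rewrite ?oppr_lt0. Qed.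

Lemma gap_mono n p : (n <= p)%N -> gap p <= gap n.
Proof.
move=> np; apply: lerB; first by apply: slope_pos => //; exact: h_mono.
by apply: slope_neg; rewrite ?oppr_lt0// lerN2 h_mono.
Qed.

Let slN : nonincreasing_seq (fun n => sl (h n)).
Proof. by move=> n' p np; apply: slope_pos => //; exact: h_mono. Qed.

Lemma slope_is_cvg : cvgn (fun n => sl (h n)).
Proof.
apply: nonincreasing_is_cvgn; first exact: slN.
exists (sl (-1)) => _ [n _ <-]; apply: slope_neg_pos => //.
Qed.

(** Slopes of a convex function are monotone, so for 0 < |k| <= h N both [sl k] and the limit lie
    between [sl (- h N)] and [sl (h N)]: one sequence of steps decides differentiability at 0. *)
Lemma slope_cvg : gap @ \oo --> 0 -> sl h @[h --> 0^'] --> limn (fun n => sl (h n)).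
Proof.
move=> gap0; set l := limn _.
have lu n : l <= sl (h n) by exact: nonincreasing_cvgn_ge (slN) slope_is_cvg n.
have ll n : sl (- h n) <= l.
  apply: limr_ge; first exact: slope_is_cvg.
  by apply: nearW => p; apply: slope_neg_pos; rewrite ?oppr_lt0.
apply/cvgrPdist_le => e e0.
have /cvgrPdist_le/(_ _ e0)[N _ /(_ N (leqnn N))] := gap0.
rewrite /= sub0r normrN ger0_norm ?gap_ge0// => gN.
near=> k.
have k0 : k != 0 by near: k; exact: nbhs_dnbhs_neq.
have kN : `|k| <= h N.
  near: k; apply: dnbhs0_le; exact: h0.
have [kp|kn|ke] := ltgtP k 0; last by rewrite ke eqxx in k0.
- have b1 : sl (- h N) <= sl k by apply: slope_neg => //; move: kN; rewrite ltr0_norm//; lra.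
  have b2 : sl k <= l.
    apply: limr_ge; first exact: slope_is_cvg.
    by apply: nearW => p; apply: slope_neg_pos.
  rewrite ger0_norm ?subr_ge0//; apply: le_trans gN.
  by rewrite /gap; apply: lerB.
- have b1 : sl k <= sl (h N) by apply: slope_pos => //; move: kN; rewrite gtr0_norm.
  have b2 : l <= sl k.
    apply: (@le_trans _ _ (sl (h (Num.truncn k^-1)))) => //.
    apply: slope_pos => //; rewrite /h invf_ple ?posrE//.
    exact/ltW/Num.Theory.truncnS_gt.
  rewrite ler0_norm ?subr_le0// opprB; apply: le_trans gN.
  by rewrite /gap; apply: lerB.
Unshelve. all: by end_near. Qed.

End convex_slopes.

Section partial.
Context (R : realType) (d : nat).
Local Notation Rd := 'rV[R]_d.
Local Notation leb := (lebesgue_rV R d).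
Variables (f : Rd -> R) (L C : R) (i : 'I_d).
Hypotheses (L0 : 0 <= L) (fL : lip L f) (fC : semiconcave_with C f).

Let e : Rd := base R i.
Let h (n : nat) : R := n.+1%:R^-1.
Let h0 n : 0 < h n. Proof. by rewrite invr_gt0. Qed.
Let h1 n : h n <= 1. Proof. by rewrite invf_le1// ler1n. Qed.

Lemma base_norm : `|base R i| <= 1.
Proof.
apply: norm_le => // j; rewrite mxE eqxx/= ger0_norm//.
by case: (_ == _).
Qed.

Lemma enorm2_shift (x : Rd) (t : R) :
  enorm (x + t *: base R i) ^+ 2 = enorm x ^+ 2 + 2 * t * x ord0 i + t ^+ 2.
Proof.
rewrite !enorm2 /dotv (bigD1 i)//= [in RHS](bigD1 i)//= !mxE !eqxx/=.
rewrite (eq_bigr (fun j => x ord0 j * x ord0 j)); first by ring.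
by move=> j /negbTE ji; rewrite !mxE eqxx ji/= mulr0 addr0.
Qed.

Let G (x : Rd) (t : R) := C * enorm (x + t *: e) ^+ 2 - f (x + t *: e).

Let convG x t a b : 0 <= t <= 1 ->
  G x (t * a + (1 - t) * b) <= t * G x a + (1 - t) * G x b.
Proof.
move=> /andP[t0 t1]; pose tt := Itv01 t0 t1.
have := fC tt (x := x + a *: e) (y := x + b *: e) (in_setT _) (in_setT _).
have E : conv tt (x + a *: e : convex_lmodType Rd) (x + b *: e : convex_lmodType Rd) =
    x + (t * a + (1 - t) * b) *: e.
  transitivity (t *: (x + a *: e) + (1 - t) *: (x + b *: e)); first by [].
  by apply/rowP => j; rewrite !mxE; ring.
by rewrite E => H; exact: H.
Qed.

Let sl x t := (G x t - G x 0) / t.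
Let q x t := (f (x + t *: e) - f x) / t.

Let slE x t : t != 0 -> sl x t = C * (2 * x ord0 i + t) - q x t.
Proof.
move=> t0; rewrite /sl /q /G !enorm2_shift scale0r addr0.
by field.
Qed.

(* Right minus left difference quotient, at step [h n], of the convex function
   [C |.|^2 - f] in the direction [e]; it decreases to the jump of the slope. *)
Definition slope_gap (n : nat) (x : Rd) : R := sl x (h n) - sl x (- h n).

Lemma slope_gapE n x : slope_gap n x = 2 * C * h n +
  (2 * f x - f (x + h n *: e) - f (x - h n *: e)) / h n.
Proof.
have hn := h0 n; rewrite /slope_gap !slE ?oppr_eq0 ?gt_eqF// /q scaleNr.
by field; rewrite gt_eqF.
Qed.

Lemma slope_gap_ge0 n x : 0 <= slope_gap n x.
Proof. exact: gap_ge0 (convG x) n. Qed.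

Lemma slope_gap_mono x : nonincreasing_seq (slope_gap ^~ x).
Proof. by move=> n p np; exact: gap_mono (convG x) _ _ np. Qed.

Lemma slope_gap_is_cvg x : cvgn (slope_gap ^~ x).
Proof.
apply: nonincreasing_is_cvgn; first exact: slope_gap_mono.
by exists 0 => _ [n _ <-]; exact: slope_gap_ge0.
Qed.

(** It vanishes exactly where the partial derivative exists, which makes that set measurable. *)
Let slope_jump x := limn (slope_gap ^~ x).

Let f_shift v : measurable_fun setT (fun x : Rd => f (x + v)).
Proof. exact: (measurableT_comp (lip_measurable fL) (measurable_shift_rV v)). Qed.

Lemma measurable_slope_gap n : measurable_fun setT (slope_gap n).
Proof.
have -> : slope_gap n = fun x => 2 * C * h n +
  (2 * f x - f (x + h n *: e) - f (x - h n *: e)) / h n.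
  by apply/funext => x; exact: slope_gapE.
apply: measurable_funD => //; apply: measurable_funM => //.
apply: measurable_funB; last exact: f_shift.
apply: measurable_funB; last exact: f_shift.
by apply: measurable_funM => //; exact: lip_measurable fL.
Qed.

Let measurable_slope_jump : measurable_fun setT slope_jump.
Proof. by apply: (measurable_fun_cvg measurable_slope_gap) => x _; exact: slope_gap_is_cvg. Qed.

Let slope_jump_ge0 x : 0 <= slope_jump x.
Proof.
by apply: limr_ge; [exact: slope_gap_is_cvg|apply: nearW => n; exact: slope_gap_ge0].
Qed.

Let slope_jump_le n x : slope_jump x <= slope_gap n x.
Proof.
exact: (@nonincreasing_cvgn_ge R (slope_gap ^~ x) (@slope_gap_mono x) (@slope_gap_is_cvg x) n).
Qed.

Let f_base x t : `|f (x + t *: e) - f x| <= L * `|t|.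
Proof.
rewrite (le_trans (fL _ _))// addrAC subrr add0r normrZ ler_wpM2l//.
by rewrite ler_piMr// base_norm.
Qed.

(* By translation invariance of the Lebesgue measure, the second difference of [f]
   can be moved to the Lipschitz function [tent], which gains a factor [h n]. *)
Let tent_int (r : R) : 0 < r -> exists2 B, 0 <= B & forall n,
  `|\int[leb]_x (tent r (0 : Rd) x * slope_gap n x)| <= B * h n.
Proof.
move=> r0; pose psi := tent r (0 : Rd).
have mpsi : measurable_fun setT psi by exact: lip_measurable (tent_lip _ r0).
have psi1 x : `|psi x| <= 1.
  by have /andP[a b] := tent01 r 0 x; rewrite ger0_norm.
have psi0 x : 2 * r + 1 < `|x| -> psi x = 0.
  move=> xr; apply/eqP; apply: contraTT xr => /(tent_neq0 r0).
  by rewrite subr0 -leNgt; lra.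
have psi0' x v : 2 * r + 1 < `|x| -> `|v| <= 1 -> psi (x + v) = 0.
  move=> xr v1; apply/eqP; apply: contraTT xr => /(tent_neq0 r0).
  rewrite subr0 -leNgt => h'.
  by rewrite -(addrK v x) (le_trans (ler_normB _ _))//; lra.
set V := fine (leb (cball (2 * r + 1))).
have V0 : 0 <= V by exact: fine_ge0.
have r1 : 0 <= r^-1 by rewrite invr_ge0 ltW.
(* The first term comes from [2 * C * h n] in [slope_gapE], the second from the slope of the tent
   times that of [f]; [V] is the volume of a ball containing the support and its translates. *)
exists (2 * `|C| * V + r^-1 * L * V).
  by apply: addr_ge0; apply: mulr_ge0 => //; apply: mulr_ge0.
move=> n; have hn := h0 n.
have vn : `|h n *: e| <= 1.
  by rewrite normrZ gtr0_norm// mulr_ile1// ?base_norm// ltW.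
have vn' : `|- (h n *: e)| <= 1 by rewrite normrN.
have mf := lip_measurable fL.
have mshift (g : Rd -> R) v : measurable_fun setT g -> measurable_fun setT (fun x : Rd => g (x + v)).
  by move=> mg; exact: (measurableT_comp mg (measurable_shift_rV v)).
pose A1 x := psi x * (f x - f (x - h n *: e)).
pose A2 x := psi x * (f (x + h n *: e) - f x).
pose A3 x := psi (x - h n *: e) * (f x - f (x - h n *: e)).
have mA1 : measurable_fun setT A1.
  by apply: measurable_funM => //; apply: measurable_funB => //; exact: mshift.
have mA2 : measurable_fun setT A2.
  by apply: measurable_funM => //; apply: measurable_funB => //; exact: mshift.
have mA3 : measurable_fun setT A3.
  by apply: measurable_funM; [exact: mshift|apply: measurable_funB => //; exact: mshift].
have fN x : `|f x - f (x - h n *: e)| <= L * h n.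
  have := f_base (x - h n *: e) (h n); rewrite subrK (gtr0_norm hn) => h'.
  exact: h'.
have fP x : `|f (x + h n *: e) - f x| <= L * h n.
  by have := f_base x (h n); rewrite (gtr0_norm hn).
have bnd (a b : R) : `|a| <= 1 -> `|b| <= L * h n -> `|a * b| <= L * h n.
  move=> a1 bL; rewrite normrM (le_trans _ bL)// ler_piMl//.
have i1 : leb.-integrable setT (EFin \o A1).
  apply: (bounded_support_integrable mA1 (K := L * h n) (r := 2 * r + 1)).
    by move=> x; exact: bnd.
  by move=> x /psi0; rewrite /A1 => ->; rewrite mul0r.
have i2 : leb.-integrable setT (EFin \o A2).
  apply: (bounded_support_integrable mA2 (K := L * h n) (r := 2 * r + 1)).
    by move=> x; exact: bnd.
  by move=> x /psi0; rewrite /A2 => ->; rewrite mul0r.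
have i3 : leb.-integrable setT (EFin \o A3).
  apply: (bounded_support_integrable mA3 (K := L * h n) (r := 2 * r + 1)).
    by move=> x; exact: bnd.
  by move=> x xr; rewrite /A3 psi0'// mul0r.
have E23 : \int[leb]_x A2 x = \int[leb]_x A3 x.
  rewrite -(Rintegral_shift (h n *: e) mA3); apply: eq_Rintegral => x _.
  by rewrite /A3 /A2 addrK.
have ic : leb.-integrable setT (EFin \o (fun x => 2 * C * h n * psi x)).
  have ip : leb.-integrable setT (EFin \o psi).
    exact: (bounded_support_integrable mpsi psi1 psi0).
  by have := integrableZl measurableT (2 * C * h n) ip.
have i12 : leb.-integrable setT (EFin \o (fun x => A1 x - A2 x)).
  exact: (integrableB measurableT i1 i2).
have i12h : leb.-integrable setT (EFin \o (fun x => (h n)^-1 * (A1 x - A2 x))).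
  exact: (integrableZl measurableT (h n)^-1 i12).
have -> : \int[leb]_x (psi x * slope_gap n x) =
    2 * C * h n * \int[leb]_x psi x + (h n)^-1 * \int[leb]_x (A1 x - A3 x).
  rewrite RintegralB// -E23 -RintegralB// -!RintegralZl//; last first.
    exact: (bounded_support_integrable mpsi psi1 psi0).
  rewrite -RintegralD//; apply: eq_Rintegral => x _.
  by rewrite slope_gapE /A1 /A2; field; rewrite gt_eqF.
have b1 : `|\int[leb]_x psi x| <= 1 * V by exact: bounded_support_Rintegral.
have b2 : `|\int[leb]_x (A1 x - A3 x)| <= (r^-1 * h n) * (L * h n) * V.
  apply: bounded_support_Rintegral.
  - exact: measurable_funB.
  - move=> x; rewrite /A1 /A3 -mulrBl normrM ler_pM//.
    have := tent_lip (0 : Rd) r0 x (x - h n *: e).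
    rewrite opprB addrCA subrr addr0 => /le_trans; apply.
    by rewrite ler_wpM2l// normrZ gtr0_norm// ler_piMr ?(ltW hn) ?base_norm.
  - by move=> x xr; rewrite /A1 /A3 psi0// psi0'// !mul0r subr0.
apply: (le_trans (ler_normD _ _)); rewrite !normrM mulrDl; apply: lerD.
  rewrite (gtr0_norm hn) ger0_norm// -!mulrA ler_wpM2l// ler_wpM2l//.
  by rewrite [leRHS]mulrC ler_wpM2l// ?(ltW hn)// -[V]mul1r.
rewrite gtr0_norm ?invr_gt0// ler_pdivrMl//.
apply: (le_trans b2); rewrite le_eqVlt; apply/orP; left; apply/eqP; ring.
Qed.

Let slope_gap_bound n x : `|slope_gap n x| <= 2 * `|C| + 2 * L.
Proof.
have hn := h0 n; rewrite slope_gapE (le_trans (ler_normD _ _))//; apply: lerD.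
  rewrite !normrM (@ger0_norm _ 2)// -mulrA ler_wpM2l// ler_piMr//.
  by rewrite (gtr0_norm hn).
rewrite normrM normfV (gtr0_norm hn) ler_pdivrMr//.
have a1 := f_base x (h n); have a2 := f_base x (- h n).
rewrite normrN (gtr0_norm hn) scaleNr in a2; rewrite (gtr0_norm hn) in a1.
rewrite (_ : _ - _ - _ = - ((f (x + h n *: e) - f x) + (f (x - h n *: e) - f x))); last by ring.
by rewrite normrN (le_trans (ler_normD _ _))//; lra.
Qed.

(** The jump is nonnegative and below every [slope_gap n], so its integral against a tent is at most
    [B * h n] for all [n], hence 0. Tents of integer radius exhaust the space. *)
Lemma slope_jump_ae : {ae leb, forall x, slope_jump x = 0}.
Proof.
have tr (N : nat) : {ae leb, forall x, tent N.+1%:R 0 x * slope_jump x = 0}.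
  have r0 : 0 < N.+1%:R :> R by [].
  have [B B0 Bn] := tent_int r0.
  set psi := tent N.+1%:R (0 : Rd) in Bn *.
  have mpsi : measurable_fun setT psi by exact: lip_measurable (tent_lip _ r0).
  have psi_ge0 x : 0 <= psi x by have /andP[] := tent01 N.+1%:R 0 x.
  have psi1 x : psi x <= 1 by have /andP[] := tent01 N.+1%:R 0 x.
  have psi0 x : 2 * N.+1%:R < `|x| -> psi x = 0.
    move=> xr; apply/eqP; apply: contraTT xr => /(tent_neq0 r0).
    by rewrite subr0 -leNgt.
  have Gb x : `|slope_jump x| <= 2 * `|C| + 2 * L.
    rewrite ger0_norm// (le_trans (slope_jump_le 0 x))//.
    by rewrite (le_trans (ler_norm _))// slope_gap_bound.
  have mul_bnd x (b : R) : `|b| <= 2 * `|C| + 2 * L -> `|psi x * b| <= 2 * `|C| + 2 * L.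
    by move=> bb; rewrite normrM (le_trans _ bb)// ler_piMl// ger0_norm.
  have iG : leb.-integrable setT (EFin \o (fun x => psi x * slope_jump x)).
    apply: (bounded_support_integrable (K := 2 * `|C| + 2 * L) (r := 2 * N.+1%:R)).
    - exact: measurable_funM.
    - by move=> x; exact: mul_bnd.
    - by move=> x /psi0 ->; rewrite mul0r.
  have ig n : leb.-integrable setT (EFin \o (fun x => psi x * slope_gap n x)).
    apply: (bounded_support_integrable (K := 2 * `|C| + 2 * L) (r := 2 * N.+1%:R)).
    - by apply: measurable_funM => //; exact: measurable_slope_gap.
    - by move=> x; apply: mul_bnd; exact: slope_gap_bound.
    - by move=> x /psi0 ->; rewrite mul0r.
  have I0 : \int[leb]_x (psi x * slope_jump x) <= 0.
    have cv : (fun n => B * h n) @ \oo --> B * 0.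
      by apply: cvgM; [exact: cvg_cst|exact: cvg_harmonic].
    rewrite -(mulr0 B) -(cvg_lim _ cv)//; apply: limr_ge; first by apply/cvg_ex; exists (B * 0).
    apply: nearW => n; apply: le_trans (Bn n); apply: le_trans (ler_norm _).
    apply: le_Rintegral => // x _; rewrite ler_wpM2l//; exact: slope_jump_le.
  have psiG0 x : 0 <= psi x * slope_jump x by exact: mulr_ge0.
  have I0' : (\int[leb]_x `|(psi x * slope_jump x)%:E| = 0)%E.
    rewrite (eq_integral (fun x => (psi x * slope_jump x)%:E)); last first.
      by move=> x _; rewrite gee0_abs// lee_fin.
    rewrite -(fineK (integrable_fin_num measurableT iG)); congr (_%:E).
    by apply/eqP; rewrite eq_le I0/= fine_ge0// integral_ge0// => x _; rewrite lee_fin.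
  have mE : measurable_fun setT (fun x => (psi x * slope_jump x)%:E).
    by apply/measurable_EFinP; exact: measurable_funM.
  have /(ae_eq_integral_abs leb measurableT mE) := I0'.
  by apply: filterS => x /(_ I)[].
have := ae_foralln tr; apply: filterS => x /(_ (Num.truncn `|x|)) h'.
have xr : `|x - 0| <= (Num.truncn `|x|).+1%:R.
  by rewrite subr0; apply/ltW; exact: Num.Theory.truncnS_gt.
by move: h'; rewrite tent_eq1// mul1r.
Qed.

Let h_cvg0 : h @ \oo --> 0^'.
Proof.
move=> A [r /= r0 rA].
have /cvgrPdist_lt/(_ _ r0) := @cvg_harmonic R.
apply: filterS => n hn; apply: rA => /=; last by rewrite gt_eqF.
exact: hn.
Qed.

Let hN_cvg0 : (fun n => - h n) @ \oo --> 0^'.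
Proof.
move=> A [r /= r0 rA].
have /cvgrPdist_lt/(_ _ r0) := @cvg_harmonic R.
apply: filterS => n hn; apply: rA => /=; last by rewrite oppr_eq0 gt_eqF.
by move: hn; rewrite !sub0r opprK normrN.
Qed.

Let quotE (x : Rd) :
  (fun t : R => t^-1 *: ((f \o shift x) (t *: e) - f x : R^o)) = q x.
Proof. by apply/funext => t; rewrite /q/= [x + _]addrC mulrC. Qed.

Let derivable_q x : derivable f x e <-> cvg (q x @ 0^').
Proof. by rewrite -quotE. Qed.

Let derive_q x : 'D_e f x = lim (q x @ 0^').
Proof. by rewrite -quotE. Qed.

Lemma derivable_quotients x : derivable f x e ->
  (fun n => q x (h n)) @ \oo --> 'D_e f x /\
  (fun n => q x (- h n)) @ \oo --> 'D_e f x.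
Proof.
move=> /derivable_q df; rewrite derive_q; split.
  exact: (cvg_comp _ _ h_cvg0 df).
exact: (cvg_comp _ _ hN_cvg0 df).
Qed.

Lemma slope_jump0_derivable x : slope_jump x = 0 -> derivable f x e.
Proof.
move=> G0; have gap0 : (slope_gap ^~ x) @ \oo --> 0.
  by rewrite -G0; exact: slope_gap_is_cvg.
have scv := slope_cvg (convG x) gap0.
apply/derivable_q; apply/cvg_ex.
exists (C * (2 * x ord0 i + 0) - limn (fun n => sl x (h n))).
have : (fun t => C * (2 * x ord0 i + t) - sl x t) @ 0^' -->
    C * (2 * x ord0 i + 0) - limn (fun n => sl x (h n)).
  apply: cvgB; last exact: scv.
  apply: cvgM; first exact: cvg_cst.
  apply: cvgD; first exact: cvg_cst.
  exact: cvg_within_filter.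
apply: cvg_trans; apply: near_eq_cvg; near=> t.
have t0 : t != 0 by near: t; exact: nbhs_dnbhs_neq.
by rewrite slE// opprB addrCA subrr addr0.
Unshelve. all: by end_near. Qed.

Lemma derivable_slope_jump0 x : derivable f x e -> slope_jump x = 0.
Proof.
move=> /derivable_quotients[c1 c2]; apply/cvg_lim => //.
have -> : slope_gap ^~ x = (fun n => 2 * C * h n - (q x (h n) - q x (- h n))).
  apply/funext => n; rewrite slope_gapE /q scaleNr; have hn := h0 n.
  by field; rewrite gt_eqF.
rewrite -[X in _ --> X](subrr (2 * C * 0)) -[X in _ - X]addr0.
apply: cvgB; first by apply: cvgM; [exact: cvg_cst|exact: cvg_harmonic].
by rewrite mulr0 add0r -[X in _ --> X](subrr ('D_e f x)); exact: cvgB.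
Qed.

Lemma partial_ae : {ae leb, forall x, derivable f x (base R i)}.
Proof. by apply: filterS slope_jump_ae => x; exact: slope_jump0_derivable. Qed.

Lemma partial_bound x : derivable f x (base R i) -> `|'D_(base R i) f x| <= L.
Proof.
move=> /derivable_quotients[c1 _].
have hb n : `|q x (h n)| <= L.
  rewrite /q normrM normfV (gtr0_norm (h0 n)) ler_pdivrMr//.
  by have := f_base x (h n); rewrite (gtr0_norm (h0 n)).
have c : (fun n => `|q x (h n)|) @ \oo --> `|'D_e f x| by exact: cvg_norm.
rewrite -(cvg_lim _ c)//.

by apply: limr_le; [apply/cvg_ex; eexists; exact: c|exact: nearW].
Qed.

(** On the set where the jump vanishes the derivative is a limit of measurable quotients; on the
    complement it is constant. *)
Lemma partial_measurable : measurable_fun setT (fun x => 'D_(base R i) f x).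
Proof.
pose A := slope_jump @^-1` [set 0].
have mA : measurable A by rewrite -[A]setTI; exact: measurable_slope_jump.
pose u n x := q x (h n) * \1_A x.
have mu n : measurable_fun setT (u n).
  apply: measurable_funM; last exact: measurable_indic.
  apply: measurable_funM => //; apply: measurable_funB; first exact: f_shift.
  exact: lip_measurable fL.
have cu x : u ^~ x @ \oo --> 'D_(base R i) f x * \1_A x.
  rewrite /u indicE; have [xA|xA] := boolP (x \in A).
    apply: cvgM; last exact: cvg_cst.
    by have [] := derivable_quotients (slope_jump0_derivable (set_mem xA)).
  by under eq_fun do rewrite mulr0; rewrite mulr0; exact: cvg_cst.
have mD : measurable_fun setT (fun x => 'D_(base R i) f x * \1_A x).
  by apply: (measurable_fun_cvg mu) => x _; exact: cu.
(* Where the quotients diverge, [lim] returns one and the same default value. *)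
have [p pP] : exists p : R, forall x, ~ A x -> 'D_(base R i) f x = p.
  have dvg x : ~ A x -> ~ cvg (q x @ 0^').
    by move=> nA cq; apply: nA; exact: derivable_slope_jump0 ((derivable_q x).2 cq).
  have [[x0 nA0]|nA] := pselect (exists x, ~ A x); last first.
    by exists 0 => x Ax; exfalso; apply: nA; exists x.
  exists ('D_(base R i) f x0) => x Ax; rewrite !derive_q.
  exact: etrans (dvgP (dvg x Ax)) (esym (dvgP (dvg x0 nA0))).
have -> : (fun x => 'D_(base R i) f x) =
    (fun x => 'D_(base R i) f x * \1_A x + p * (1 - \1_A x)).
  apply/funext => x; rewrite indicE; have [xA|xA] := boolP (x \in A).
    by rewrite mulr1 subrr mulr0 addr0.
  rewrite mulr0 add0r subr0 mulr1; apply: pP => Ax.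
  by move: xA; rewrite mem_set.
apply: measurable_funD => //; apply: measurable_funM => //.
by apply: measurable_funB => //; exact: measurable_indic.
Qed.

End partial.

(** * Difference quotients of test functions *)

Section test_function_facts.
Context (R : realType) (d : nat).
Local Notation Rd := 'rV[R]_d.
Local Notation leb := (lebesgue_rV R d).
Variables (psi : Rd -> R) (i : 'I_d).
Hypothesis tpsi : test_function psi.

Let e : Rd := base R i.

Lemma test_differentiable x : differentiable psi x.
Proof. by have [/(_ [::] x)] := tpsi. Qed.

Lemma test_derive_continuous v : continuous (fun x => 'D_v psi x).
Proof.
by move=> x; have [/(_ [:: v] x)/= /differentiable_continuous] := tpsi.
Qed.

Lemma test_continuous : continuous psi.
Proof. by move=> x; exact: differentiable_continuous (test_differentiable x). Qed.

Lemma test_support : exists2 r, 0 <= r & forall x, r < `|x| -> psi x = 0.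
Proof.
have [_ /compact_bounded[r [_ rP]]] := tpsi.
exists (`|r| + 1); first by rewrite addr_ge0.
move=> x xr; apply/eqP; apply: contraTT xr => px; rewrite -leNgt.
apply: rP; first by rewrite (le_lt_trans (ler_norm r))// ltrDl.
exact: subset_closure.
Qed.

Lemma derive_line x t : is_derive t (1 : R) (fun s => psi (x + s *: e)) ('D_e psi (x + t *: e)).
Proof.
have dp : derivable psi (x + t *: e) e by apply: diff_derivable; exact: test_differentiable.
have E : (fun s : R => s^-1 *: (((fun s => psi (x + s *: e)) \o shift t) (s *: (1 : R)) - psi (x + t *: e) : R^o)) =
   (fun s : R => s^-1 *: ((psi \o shift (x + t *: e)) (s *: e) - psi (x + t *: e) : R^o)).
  apply/funext => s /=; congr (_ *: (psi _ - _)).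
  by rewrite [s *: 1]mulr1 scalerDl addrCA.
split.
- by rewrite /derivable E.
- by rewrite /derive E.
Qed.

Lemma bounded_on_cball (g : Rd -> R) (r : R) : continuous g ->
  exists2 B, 0 <= B & forall x, `|x| <= r -> `|g x| <= B.
Proof.
move=> cg.
have : compact (g @` @cball R d r).
  by apply: continuous_compact; [exact: continuous_subspaceT|exact: compact_cball].
move=> /compact_bounded[M [_ MP]].
exists (`|M| + 1); first by rewrite addr_ge0.
move=> x xr; apply: MP; last by exists x.
by rewrite (le_lt_trans (ler_norm M))// ltrDl.
Qed.

(** Provides the dominating function for the quotients. A step of length at most 1 enlarges the
    support to radius [r + 1]; the intermediate point of the mean value theorem stays within
    [r + 2], where [B] bounds the derivative. *)
Lemma test_quotient_bound : exists r B, [/\ 0 <= r, 0 <= B,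
  forall x, r < `|x| -> psi x = 0 &
  forall x h, 0 < h -> h <= 1 -> `|psi (x + h *: e) - psi x| <= B * h * \1_(@cball R d (r + 1)) x].
Proof.
have [r r0 rP] := test_support.
have [B B0 BP] := bounded_on_cball (r + 2) (@test_derive_continuous e).
exists r, B; split => // x h h0 h1.
have e1 : `|e| <= 1 by exact: base_norm.
have te t : 0 <= t -> t <= 1 -> `|t *: e| <= 1.
  by move=> t0 t1; rewrite normrZ ger0_norm// mulr_ile1.
rewrite indicE; have [xr|xr] := leP `|x| (r + 1); last first.
  rewrite rP; last first.
    have := lerB_dist x (- (h *: e)); rewrite opprK normrN.
    by have := te h (ltW h0) h1; lra.
  by rewrite rP ?subrr ?normr0 ?mulr_ge0// ?ltW//; lra.
rewrite mem_set// mulr1.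
have cl : {within `[0, h], continuous (fun s : R => psi (x + s *: e))}.
  apply: continuous_subspaceT => s.
  have [ds _] := derive_line x s.
  by apply: differentiable_continuous; exact/derivable1_diffP.
have [c c0h] := MVT h0 (fun t _ => derive_line x t) cl.
rewrite scale0r addr0 subr0 => ->; rewrite normrM (gtr0_norm h0) ler_wpM2r ?(ltW h0)//.
apply: BP; rewrite (le_trans (ler_normD _ _))//.
move: c0h; rewrite in_itv/= => /andP[c0 ch].
have := te c (ltW c0) (le_trans (ltW ch) h1).
lra.
Qed.

End test_function_facts.

(** * The pointwise gradient as weak gradient *)

Section weak_gradient.
Context (R : realType) (d : nat).
Local Notation Rd := 'rV[R]_d.
Local Notation leb := (lebesgue_rV R d).
Variables (f : Rd -> R) (M L C : R).
Hypotheses (fM : forall x, `|f x| <= M) (L0 : 0 <= L) (fL : lip L f)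
  (fC : semiconcave_with C f).

Let M0 : 0 <= M. Proof. exact: le_trans (fM 0). Qed.

Let h (n : nat) : R := n.+1%:R^-1.
Let h0 n : 0 < h n. Proof. by rewrite invr_gt0. Qed.
Let h1 n : h n <= 1. Proof. by rewrite invf_le1// ler1n. Qed.

Let mf : measurable_fun setT f. Proof. exact: lip_measurable fL. Qed.

(** Integration by parts for difference quotients is a translation of the Lebesgue measure: the
    forward quotient of [psi] is exchanged for the backward quotient of [f]. Both sides pass to the
    limit by dominated convergence, the second thanks to the a.e. partial derivatives. *)
Lemma weak_grad_grad : weak_grad f (grad f).
Proof.
move=> psi tpsi i; set e := base R i.
have [r [B [r0 B0 rP BP]]] := test_quotient_bound i tpsi.
have [P P0 psiP'] := bounded_on_cball r (test_continuous tpsi).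
have psiP x : `|psi x| <= P.
  by have [/psiP'//|/rP ->] := leP `|x| r; rewrite normr0.
have mpsi : measurable_fun setT psi by apply: continuous_measurable_rV; exact: test_continuous.
have mD : measurable_fun setT ('D_e psi).
  by apply: continuous_measurable_rV; exact: test_derive_continuous.
have mshift (g : Rd -> R) v : measurable_fun setT g -> measurable_fun setT (fun x : Rd => g (x + v)).
  by move=> mg; exact: (measurableT_comp mg (measurable_shift_rV v)).
have mDf := partial_measurable i fL fC.
pose A n x := f x * ((psi (x + h n *: e) - psi x) / h n).
pose Q n x := (f x - f (x - h n *: e)) / h n * psi x.
have mA n : measurable_fun setT (A n).
  apply: measurable_funM => //; apply: measurable_funM => //.
  by apply: measurable_funB => //; exact: mshift.
have mQ n : measurable_fun setT (Q n).
  apply: measurable_funM => //; apply: measurable_funM => //.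
  by apply: measurable_funB => //; exact: mshift.
have AQ n : \int[leb]_x A n x = - \int[leb]_x Q n x.
  have hn := h0 n.
  have supp_shift x : r + 1 < `|x| -> psi (x + h n *: e) = 0.
    move=> xr; apply: rP; have := lerB_dist x (- (h n *: e)); rewrite opprK normrN.
    have : `|h n *: e| <= 1 by rewrite normrZ gtr0_norm// mulr_ile1// ?base_norm// ltW.
    by lra.
  have b2 (a b : R) : `|a| <= M -> `|b| <= P -> `|a * b / h n| <= M * P / h n.
    by move=> aM bP; rewrite normrM (@ger0_norm _ (h n)^-1) ?invr_ge0 ?(ltW hn)// ler_wpM2r ?invr_ge0 ?(ltW hn)// normrM ler_pM.
  pose A1 x := f x * psi (x + h n *: e) / h n.
  pose A2 x := f x * psi x / h n.
  pose A3 x := f (x - h n *: e) * psi x / h n.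
  have mA1 : measurable_fun setT A1.
    by apply: measurable_funM => //; apply: measurable_funM => //; exact: mshift.
  have mA2 : measurable_fun setT A2.
    by apply: measurable_funM => //; exact: measurable_funM.
  have mA3 : measurable_fun setT A3.
    by apply: measurable_funM => //; apply: measurable_funM => //; exact: mshift.
  have i1 : leb.-integrable setT (EFin \o A1).
    apply: (bounded_support_integrable mA1 (K := M * P / h n) (r := r + 1)).
      by move=> x; exact: b2.
    by move=> x /supp_shift; rewrite /A1 => ->; rewrite mulr0 mul0r.
  have i2 : leb.-integrable setT (EFin \o A2).
    apply: (bounded_support_integrable mA2 (K := M * P / h n) (r := r)).
      by move=> x; exact: b2.
    by move=> x /rP; rewrite /A2 => ->; rewrite mulr0 mul0r.
  have i3 : leb.-integrable setT (EFin \o A3).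
    apply: (bounded_support_integrable mA3 (K := M * P / h n) (r := r)).
      by move=> x; exact: b2.
    by move=> x /rP; rewrite /A3 => ->; rewrite mulr0 mul0r.
  have E13 : \int[leb]_x A1 x = \int[leb]_x A3 x.
    rewrite -(Rintegral_shift (h n *: e) mA3); apply: eq_Rintegral => x _.
    by rewrite /A3 /A1 addrK.
  transitivity (\int[leb]_x (A1 x - A2 x)).
    by apply: eq_Rintegral => x _; rewrite /A /A1 /A2; ring.
  rewrite RintegralB// E13 -opprB -RintegralB//; congr (- _).
  by apply: eq_Rintegral => x _; rewrite /Q /A2 /A3; ring.
have dpsi x : (fun n => (psi (x + h n *: e) - psi x) / h n) @ \oo --> 'D_e psi x.
  have dp : derivable psi x e by apply: diff_derivable; exact: test_differentiable.
  by have [] := derivable_quotients dp.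
have df : {ae leb, forall x, (fun n => (f x - f (x - h n *: e)) / h n) @ \oo --> 'D_e f x}.
  apply: filterS (partial_ae i L0 fL fC) => x dfx.
  have [_ c] := derivable_quotients dfx.
  rewrite (_ : (fun n => _) = (fun n => (f (x + (- h n) *: e) - f x) / - h n))//.
  by apply/funext => n; rewrite scaleNr invrN mulrN -mulNr opprB.
have [|||||iA _ cA] := @dominated_convergence _ _ _ leb setT measurableT
    (fun n x => (A n x)%:E) (fun x => (f x * 'D_e psi x)%:E)
    (fun x => (M * B * \1_(@cball R d (r + 1)) x)%:E).
- by move=> n; exact/measurable_EFinP.
- by apply/measurable_EFinP; exact: measurable_funM.
- apply: aeW => x _; apply: cvg_EFin; first exact: nearW.
  by apply: cvgM; [exact: cvg_cst|exact: dpsi].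
- exact: integrable_cball.
- apply: aeW => x n _; rewrite lee_fin /A normrM -mulrA ler_pM//.
  rewrite normrM normfV (gtr0_norm (h0 n)) ler_pdivrMr// mulrAC.
  exact: BP.
have [|||||iQ _ cQ] := @dominated_convergence _ _ _ leb setT measurableT
    (fun n x => (Q n x)%:E) (fun x => ('D_e f x * psi x)%:E)
    (fun x => (L * P * \1_(@cball R d r) x)%:E).
- by move=> n; exact/measurable_EFinP.
- by apply/measurable_EFinP; exact: measurable_funM.
- apply: filterS df => x dfx _; apply: cvg_EFin; first exact: nearW.
  by apply: cvgM => //; exact: cvg_cst.
- exact: integrable_cball.
- apply: aeW => x n _; rewrite lee_fin /Q normrM -mulrA ler_pM//; last first.
    exact: bounded_support_le psiP rP x.
  rewrite normrM normfV (gtr0_norm (h0 n)) ler_pdivrMr//.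
  rewrite (le_trans (fL _ _))// opprB addrCA subrr addr0 ler_wpM2l// normrZ gtr0_norm//.
  by rewrite ler_piMr ?base_norm// ltW.
have EA' : \int[leb]_x (f x * 'D_e psi x) = limn (fun n => \int[leb]_x A n x).
  rewrite -(fineK (integrable_fin_num measurableT iA)) in cA.
  by move: cA => /fine_cvgP[_ /cvg_lim]; move=> cl; apply: esym; exact: cl.
have EQ' : (fun n => \int[leb]_x Q n x) @ \oo --> \int[leb]_x ('D_e f x * psi x).
  rewrite -(fineK (integrable_fin_num measurableT iQ)) in cQ.
  by move: cQ => /fine_cvgP[].
rewrite EA'; under eq_fun do rewrite AQ.
rewrite (cvg_lim _ (cvgN EQ'))//; congr (- _).
by apply: eq_Rintegral => x _; rewrite mxE.
Qed.

Lemma W1oo_grad : W1oo f (grad f).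
Proof.
split.
- have [] // := @ae_Lfun_oo R d f M mf.
  exact: aeW.
- move=> i; have mDf := partial_measurable i fL fC.
  rewrite (_ : (fun x => _) = (fun x => 'D_(base R i) f x)); last first.
    by apply/funext => x; rewrite mxE.
  have [] // := @ae_Lfun_oo R d _ L mDf.
  by apply: filterS (partial_ae i L0 fL fC) => x; exact: partial_bound L0 fL _.
- exact: weak_grad_grad.
Qed.

End weak_gradient.

(** * Comparison of two weak solutions *)

Section convexity.
Context (R : realType) (d : nat).
Local Notation Rd := 'rV[R]_d.

Lemma derive_dotv (f : Rd -> R) (p v : Rd) : differentiable f p ->
  'D_v f p = dotv v (grad f p).
Proof.
move=> df; rewrite deriveE// [in LHS](matrix_sum_delta v) big_ord1 raddf_sum/=.
apply: eq_bigr => i _; rewrite linearZ/= /grad mxE deriveE//.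
Qed.

(** For steps up to 1, the difference quotient from [p] towards [q] is at most [f q - f p]. *)
Lemma convex_tangent (f : Rd -> R) (p q : Rd) : differentiable f p ->
  convex_function [set: Rd] f -> f p + dotv (q - p) (grad f p) <= f q.
Proof.
move=> df fC; rewrite -derive_dotv// -lerBrDl.
have dp : derivable f p (q - p) by exact: diff_derivable.
have cv : (fun h : R => h^-1 * (f (h *: (q - p) + p) - f p)) @ 0^'+ --> ('D_(q - p) f p : R).
  exact: (cvg_dnbhs_at_right dp).
apply: (cvgr_to_le cv).
near=> h.
have h0 : 0 < h by near: h; exact: nbhs_right_gt.
have h1 : h <= 1 by near: h; exact: nbhs_right_le.
rewrite mulrC ler_pdivrMr//.
have : f (h *: q + (1 - h) *: p) <= h * f q + (1 - h) * f p.
  exact: fC (Itv01 (ltW h0) h1) q p (in_setT _) (in_setT _).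
rewrite (_ : h *: q + _ = h *: (q - p) + p); first by move=> ?; lra.
by rewrite scalerBr scalerBl scale1r addrCA addrC.
Unshelve. all: by end_near.
Qed.

Lemma C1_differentiable_left (H : Rd -> Rd -> R) (p x : Rd) :
  C1 (fun z : Rd * Rd => H z.1 z.2) -> differentiable (fun q => H q x) p.
Proof.
move=> [dH _].
rewrite (_ : (fun q => H q x) = (fun z : Rd * Rd => H z.1 z.2) \o (fun q => (q, x)))//.
apply: differentiable_comp; last exact: dH.
by apply: differentiable_pair.
Qed.

End convexity.
Section finite_moments.
Context (R : realType) (d : nat).
Local Notation Rd := 'rV[R]_d.
Implicit Types m : prob R d.

(** The diagonal coupling costs nothing. *)
Lemma wassersteinxx p m : (0 < p)%N -> wasserstein p m m = 0.
Proof.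
move=> p0; have mD : measurable_fun setT (fun x : Rd => (x, x)).
  exact: measurable_fun_pair.
pose D : {mfun Rd >-> (Rd * Rd)%type} :=
  HB.pack (fun x : Rd => (x, x)) (isMeasurableFun.Build _ _ _ _ _ mD).
have gm : couplings m m (distribution m D).
  split=> A mA; rewrite /distribution/= /pushforward; congr (m _).
    by apply/seteqP; split => x // [].
  by apply/seteqP; split => x // [].
have mc : measurable_fun setT (fun z : Rd * Rd => (enorm (z.1 - z.2) ^+ p)%:E).
  apply/measurable_EFinP; apply: measurable_enorm; exact: measurable_prod_sub.
have g0 : (\int[distribution m D]_z (enorm (z.1 - z.2) ^+ p)%:E = 0)%E.
  rewrite -(@ge0_integral_transfer _ _ _ _ R m _ D)//.
    rewrite integral0_eq// => x _ /=; rewrite subrr /enorm.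
    rewrite (_ : dotv 0 0 = 0); last by rewrite /dotv big1// => i _; rewrite mxE mul0r.
    by rewrite sqrtr0 expr0n gtn_eqF.
  by move=> z; rewrite lee_fin exprn_ge0// enorm_ge0.
rewrite /wasserstein (_ : ereal_inf _ = 0%E).
  by rewrite powR0// invr_eq0 pnatr_eq0 gtn_eqF.
apply/eqP; rewrite eq_le; apply/andP; split.
  by apply: ereal_inf_lbound; exists (distribution m D).
apply/ereal_infP => _ [h _ <-]; apply: integral_ge0 => z _.
by rewrite lee_fin exprn_ge0// enorm_ge0.
Qed.

Lemma Pp2_Pp1 m : Pp 2 m -> Pp 1 m.
Proof.
move=> m2; rewrite /Pp/=.
have me : measurable_fun setT (fun x : Rd => enorm x ^+ 1).
  by apply: measurable_enorm => i; exact: measurable_coord.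
have : m.-integrable setT (EFin \o (fun x : Rd => enorm x ^+ 1)).
  apply: (Pp2_integrable m2 (C := d%:R) me) => x; rewrite expr1 ger0_norm ?enorm_ge0//.
  rewrite (le_trans (enorm_le x))// ler_wpM2l//.
  by have := sqr_ge0 (`|x| - 1); rewrite !expr2; have := normr_ge0 x; nra.
move=> /integrableP[_]; apply: le_lt_trans; apply: ge0_le_integral => //.
- by move=> x _; rewrite lee_fin exprn_ge0// enorm_ge0.
- exact/measurable_EFinP.
- by apply/measurable_EFinP; apply: measurableT_comp.
- by move=> x _; rewrite lee_fin ler_norm.
Qed.

Lemma lipschitz_RdP1_measurable (F : Rd -> prob R d -> R) m :
  lipschitz_RdP1 F -> Pp 1 m -> measurable_fun setT (F ^~ m).
Proof.
move=> [L FL] m1; apply: (@lip_measurable R d (`|L| * d%:R)) => x y.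
rewrite (le_trans (FL x y m m m1 m1))// wassersteinxx// addr0.
apply: (@le_trans _ _ (`|L| * enorm (x - y))).
  by rewrite ler_wpM2r ?enorm_ge0// ler_norm.
by rewrite -mulrA ler_wpM2l// enorm_le.
Qed.

End finite_moments.

(** * The variational principle for pairs of measures *)

Section ekeland_pair.
Context (R : realType) (d : nat).
Local Notation Rd := 'rV[R]_d.
Implicit Types (m n : prob R d) (U V : Rd -> prob R d -> R).

Lemma JfunC U V m (rho : Rd -> R) n sigma :
  Jfun U V m rho n sigma = Jfun V U n sigma m rho.
Proof. by apply: eq_Rintegral => x _; ring. Qed.

Lemma Jfun_bound U V M L M' L' m (rho : Rd -> R) n sigma :
  regular U M L -> regular V M' L' -> Pp 2 m -> Pp 2 n ->
  Loo_density m rho -> Loo_density n sigma ->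
  `|Jfun U V m rho n sigma| <= 2 * (M + M').
Proof.
move=> rU rV m2 n2 mr ns; rewrite (JfunE rU rV)//.
have b W N K (rW : regular W N K) (k l : prob R d) : Pp 2 k -> `|\int[l]_x W x k| <= N.
  move=> k2; have mW := regular_measurable rW k2.
  have WN x : `|W x k| <= N by case: rW => _ _ h _ _; exact: h.
  exact: (@prob_Rintegral_le R d l (W ^~ k) N mW WN).
have := b _ _ _ rU m m m2; have := b _ _ _ rU m n m2.
have := b _ _ _ rV n m n2; have := b _ _ _ rV n n n2.
by rewrite !ler_norml => /andP[? ?] /andP[? ?] /andP[? ?] /andP[? ?]; lra.
Qed.

Lemma Jfun_cvg U V M L M' L' (mk nk : nat -> prob R d) rk sk m (rho : Rd -> R) n sigma :
  regular U M L -> regular V M' L' ->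
  (forall k, Pp 2 (mk k)) -> (forall k, Pp 2 (nk k)) -> Pp 2 m -> Pp 2 n ->
  (forall k, Loo_density (mk k) (rk k)) -> (forall k, Loo_density (nk k) (sk k)) ->
  Loo_density m rho -> Loo_density n sigma ->
  (forall e : R, 0 < e -> \forall k \near \oo, wasserstein 2 (mk k) m < e) ->
  (forall e : R, 0 < e -> \forall k \near \oo, wasserstein 2 (nk k) n < e) ->
  (fun k => Jfun U V (mk k) (rk k) (nk k) (sk k)) @ \oo --> Jfun U V m rho n sigma.
Proof.
move=> rU rV mk2 nk2 m2 n2 mkr nks mr ns cm cn.
rewrite (JfunE rU rV)//; under eq_fun do rewrite (JfunE rU rV)//.
have c1 := regular_cvg rU mk2 mk2 m2 m2 cm cm.
have c2 := regular_cvg rU mk2 nk2 m2 n2 cm cn.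
have c3 := regular_cvg rV nk2 mk2 n2 m2 cn cm.
have c4 := regular_cvg rV nk2 nk2 n2 n2 cn cn.
exact: cvgB (cvgB c1 c2) (cvgB c3 c4).
Qed.

(** A point is a pair of measures with chosen densities, since the norm is a function of the
    density. As [Jfun] is bounded below, the norms stay below [K] along a sequence with decreasing
    [Psi], which is the bound that completeness requires; in the limit [Jfun] is continuous and the
    norms are lower semicontinuous. *)
Lemma ekeland_pair U V M L M' L' (eps : R) m1 (rho1 : Rd -> R) n1 sigma1 :
  regular U M L -> regular V M' L' -> 0 < eps ->
  Pp 2 m1 -> Loo_density m1 rho1 -> Pp 2 n1 -> Loo_density n1 sigma1 ->
  let Psi m rho n sigma :=
    Jfun U V m rho n sigma + eps * (Loo_norm rho + Loo_norm sigma) in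
  exists m0 rho0 n0 sigma0,
  [/\ [/\ Pp 2 m0, Loo_density m0 rho0, Pp 2 n0 & Loo_density n0 sigma0],
   Psi m0 rho0 n0 sigma0 <= Psi m1 rho1 n1 sigma1,
   forall m rho, Pp 2 m -> Loo_density m rho ->
     Psi m0 rho0 n0 sigma0 <= Psi m rho n0 sigma0 + eps * wasserstein 2 m m0 &
   forall n sigma, Pp 2 n -> Loo_density n sigma ->
     Psi m0 rho0 n0 sigma0 <= Psi m0 rho0 n sigma + eps * wasserstein 2 n n0].
Proof.
move=> rU rV eps0 m12 mr1 n12 ns1 Psi.
pose X := {a : (prob R d * (Rd -> R)) * (prob R d * (Rd -> R)) |
  [/\ Pp 2 a.1.1, Loo_density a.1.1 a.1.2, Pp 2 a.2.1 & Loo_density a.2.1 a.2.2]}.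
pose P (x : X) := Psi (sval x).1.1 (sval x).1.2 (sval x).2.1 (sval x).2.2.
pose delta (x y : X) := rms_dist (sval x).1.1 (sval y).1.1 + rms_dist (sval x).2.1 (sval y).2.1.
pose B := 2 * (M + M').
have JB (x : X) : - B <= Jfun U V (sval x).1.1 (sval x).1.2 (sval x).2.1 (sval x).2.2.
  case: x => [x [/= ? ? ? ?]].
  by have := Jfun_bound rU rV; rewrite -/B => /(_ x.1.1 x.1.2 x.2.1 x.2.2); rewrite ler_norml => /(_ _ _ _ _)/andP[].
have N0 (x : X) : 0 <= eps * (Loo_norm (sval x).1.2 + Loo_norm (sval x).2.2).
  by rewrite mulr_ge0 ?(ltW eps0)// addr_ge0// Loo_norm_ge0.
have [||||||y [yx yP]] := @ekeland R X P delta (- B) eps eps0 _ _ _ _ _ _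
    (exist _ ((m1, rho1), (n1, sigma1)) (And4 m12 mr1 n12 ns1)).
- by move=> x; rewrite /P /Psi; have := JB x; have := N0 x; lra.
- by move=> [x [? ? ? ?]] [y [? ? ? ?]]; rewrite /delta/= addr_ge0// rms_dist_ge0.
- by move=> [x [? ? ? ?]]; rewrite /delta/= !rms_distxx// addr0.
- by move=> x y; rewrite /delta rms_distC [X in _ + X]rms_distC.
- move=> [x [? ? ? ?]] [y [? ? ? ?]] [z [? ? ? ?]]; rewrite /delta/= addrACA.
  by rewrite lerD// rms_dist_triangle.
- move=> x xdec xcauchy.
  pose mk k := (sval (x k)).1.1; pose rk k := (sval (x k)).1.2.
  pose nk k := (sval (x k)).2.1; pose sk k := (sval (x k)).2.2.
  have xk k : [/\ Pp 2 (mk k), Loo_density (mk k) (rk k), Pp 2 (nk k) & Loo_density (nk k) (sk k)].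
    exact: (svalP (x k)).
  have mk2 k : Pp 2 (mk k) by case: (xk k).
  have mkr k : Loo_density (mk k) (rk k) by case: (xk k).
  have nk2 k : Pp 2 (nk k) by case: (xk k).
  have nks k : Loo_density (nk k) (sk k) by case: (xk k).
  have xle k p : (k <= p)%N -> P (x p) <= P (x k).
    move=> /subnK <-; elim: (p - k)%N => [|q IH]; first by rewrite add0n.
    by rewrite addSn (le_trans (xdec _)).
  pose K := (P (x 0%N) + B) / eps.
  have NK k : Loo_norm (rk k) + Loo_norm (sk k) <= K.
    rewrite ler_pdivlMr// mulrC; have := xle 0%N k isT; rewrite {1}/P /Psi -/(rk k) -/(sk k).
    by have := JB (x k); lra.
  have K0 : 0 <= K by apply: le_trans (NK 0%N); rewrite addr_ge0// Loo_norm_ge0.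
  have [||m [rho [m2 mr cm mN]]] := @Loo_complete_liminf R d mk rk K K0 mk2 mkr.
  + by move=> k; apply: le_trans (NK k); rewrite lerDl Loo_norm_ge0.
  + move=> e e0; have [N NP] := xcauchy e e0; exists N => k l Nk Nl.
    by apply: le_trans (NP k l Nk Nl); rewrite /delta lerDl; exact: rms_dist_ge0 (nk2 k) (nk2 l).
  have [||n [sigma [n2 ns cn nN]]] := @Loo_complete_liminf R d nk sk K K0 nk2 nks.
  + by move=> k; apply: le_trans (NK k); rewrite lerDr Loo_norm_ge0.
  + move=> e e0; have [N NP] := xcauchy e e0; exists N => k l Nk Nl.
    by apply: le_trans (NP k l Nk Nl); rewrite /delta lerDr; exact: rms_dist_ge0 (mk2 k) (mk2 l).
  (* The contrapositive of [mN] and [nN]: lower bounds for all large indices, so that both norms can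
     be compared at one common index. *)
  have ev (tk : nat -> Rd -> R) (t : Rd -> R) :
      (forall l, (forall N, exists2 k, (N <= k)%N & Loo_norm (tk k) <= l) -> Loo_norm t <= l) ->
      forall l, l < Loo_norm t -> \forall k \near \oo, l < Loo_norm (tk k).
    move=> h l lt; apply: contrapT => hn; move: lt; rewrite ltNge; apply/negP/negPn.
    apply: h => N; apply: contrapT => hN; apply: hn; exists N => // k /= Nk.
    by rewrite ltNge; apply/negP => kl; apply: hN; exists k.
  exists (exist _ ((m, rho), (n, sigma)) (And4 m2 mr n2 ns)); split.
  + move=> e e0; have e2 : 0 < e / 2 by rewrite divr_gt0.
    have := cn _ e2; have := cm _ e2; apply: filterS2 => k h1 h2.
    have t1 : rms_dist m (mk k) <= e / 2.
      by rewrite rms_distC; exact: le_trans (rms_dist_wasserstein (mk2 k) m2) (ltW h1).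
    have t2 : rms_dist n (nk k) <= e / 2.
      by rewrite rms_distC; exact: le_trans (rms_dist_wasserstein (nk2 k) n2) (ltW h2).
    by rewrite [leRHS]splitr; exact: lerD t1 t2.
  + move=> k; rewrite {1}/P/= /Psi; apply/ler_addgt0Pr => e e0.
    have e2 : 0 < e / 2 by rewrite divr_gt0.
    have e4 : 0 < e / 2 / eps / 2 by rewrite !divr_gt0.
    have cJ := Jfun_cvg rU rV mk2 nk2 m2 n2 mkr nks mr ns cm cn.
    move/cvgrPdist_le : cJ => /(_ _ e2) cJ.
    have hr : Loo_norm rho - e / 2 / eps / 2 < Loo_norm rho by rewrite ltrBlDr ltrDl.
    have hs : Loo_norm sigma - e / 2 / eps / 2 < Loo_norm sigma by rewrite ltrBlDr ltrDl.
    have [N _ NP] := filterI (filterI (ev _ _ mN _ hr) (ev _ _ nN _ hs)) cJ.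
    have [[] h1 h2 h3] := NP (maxn N k) (leq_maxl _ _).
    have := xle _ _ (leq_maxr N k).
    rewrite {1}/P /Psi -/(rk _) -/(sk _) -/(mk _) -/(nk _).
    set j := maxn N k in h1 h2 h3 *.
    move: h3; rewrite ler_norml => /andP[_ h3].
    have : eps * (Loo_norm rho + Loo_norm sigma - e / 2 / eps) <= eps * (Loo_norm (rk j) + Loo_norm (sk j)).
      by rewrite ler_pM2l//; lra.
    by rewrite mulrBr [X in _ - X]mulrC divfK ?gt_eqF//; lra.
case: y yx yP => [[[m0 rho0] [n0 sigma0]] [/= m02 mr0 n02 ns0]] yx yP.
exists m0, rho0, n0, sigma0; split => //.
(* With the other component unchanged, [delta] reduces to a single [rms_dist], which d_2
   dominates. *)
- move=> m rho m2 mr.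
  have := yP (exist _ ((m, rho), (n0, sigma0)) (And4 m2 mr n02 ns0)).
  rewrite /P /delta/= => /le_trans; apply; rewrite lerD2l ler_wpM2l ?(ltW eps0)//.
  by rewrite [X in _ + X]rms_distxx// addr0 rms_dist_wasserstein.
- move=> n sigma n2 ns.
  have := yP (exist _ ((m0, rho0), (n, sigma)) (And4 m02 mr0 n2 ns)).
  rewrite /P /delta/= => /le_trans; apply; rewrite lerD2l ler_wpM2l ?(ltW eps0)//.
  by rewrite [X in X + _]rms_distxx// add0r rms_dist_wasserstein.
Qed.

End ekeland_pair.

Section comparison.
Context (R : realType) (d : nat).
Local Notation Rd := 'rV[R]_d.
Local Notation leb := (lebesgue_rV R d).
Variables (H : Rd -> Rd -> R) (F : Rd -> prob R d -> R).
Hypotheses (HC1 : C1 (fun z : Rd * Rd => H z.1 z.2))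
  (H_convex : forall x, convex_function [set: Rd] (fun p => H p x))
  (F_lipschitz : lipschitz_RdP1 F) (F_bounded : bounded_RdPp 1 F)
  (F_monotone : monotone_P1 F).
Implicit Types (m n : prob R d) (U V : Rd -> prob R d -> R).

Lemma density_RintegralB m n (rho sigma f : Rd -> R) (K : R) :
  Loo_density m rho -> Loo_density n sigma -> measurable_fun setT f ->
  (forall x, `|f x| <= K) ->
  \int[leb]_x (f x * (rho x - sigma x)) = \int[m]_x f x - \int[n]_x f x.
Proof.
move=> mr ns mf fK; rewrite (density_Rintegral mr mf) (density_Rintegral ns mf).
have i1 := density_integrable mr (bounded_integrable m mf fK).
have i2 := density_integrable ns (bounded_integrable n mf fK).
by rewrite -RintegralB//; apply: eq_Rintegral => x _; rewrite mulrBr.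
Qed.

Lemma weak_solution_W1oo U m : weak_solution H F U -> Pp 2 m ->
  W1oo (U ^~ m) (grad (U ^~ m)).
Proof.
move=> wU m2; have [M [L [M0 L0 UM UL _]]] := weak_solution_regular wU.
have [_ _ _ [C UC] _] := wU.
apply: (@W1oo_grad R d (U ^~ m) M L C) => //.
- by move=> x; exact: UM.
- exact: UL.
- exact: UC.
Qed.

(** With the minimiser itself as the reference measure of the definition, the distance term vanishes
    there; the minimum is global, so any radius serves. *)
Lemma test_local_minT U V (e : R) m (rho : Rd -> R) n sigma : 0 < e ->
  (forall m' rho', Pp 2 m' -> Loo_density m' rho' ->
    Jfun U V m rho n sigma + e * Loo_norm rho <=
    Jfun U V m' rho' n sigma + e * Loo_norm rho' + e * wasserstein 2 m' m) ->
  test_local_min U (V ^~ n) sigma m e m rho.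
Proof.
move=> e0 h; exists 1 => // m' rho' m2 mr _.
rewrite /test_functional wassersteinxx// add0r.
have := h _ _ m2 mr; rewrite /Jfun => /le_trans; apply.
by rewrite -addrA -mulrDr [Loo_norm _ + _]addrC.
Qed.

(* The coefficient of [rho] is [H(DU) - H(DV) - (DU - DV) . DpH(DU) <= 0] by
   convexity, and likewise that of [sigma]. *)
Lemma test_inequality_sum U V (C C' e : R) m (rho : Rd -> R) n sigma :
  weak_solution H F U -> weak_solution H F V ->
  Pp 2 m -> Pp 2 n -> Loo_density m rho -> Loo_density n sigma ->
  test_inequality H F C U sigma (grad (V ^~ n)) e m rho ->
  test_inequality H F C' V rho (grad (U ^~ m)) e n sigma ->
  - (C * e * (1 + Loo_norm rho)) - C' * e * (1 + Loo_norm sigma) <=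
  Jfun U V m rho n sigma.
Proof.
move=> wU wV m2 n2 mr ns [].
set DU := fun x => grad (fun y => U y m) x; set DV := fun x => grad (V ^~ n) x.
set f1 := fun x => _; set f2 := fun x => _ => if1 if2 h1 [].
set g1 := fun x => _; set g2 := fun x => _ => ig1 ig2 h2.
have [M [L rU]] := weak_solution_regular wU.
have [M' [L' rV]] := weak_solution_regular wV.
have [K FK] := F_bounded.
have m1 := Pp2_Pp1 m2; have n1 := Pp2_Pp1 n2.
have mFm := lipschitz_RdP1_measurable F_lipschitz m1.
have mFn := lipschitz_RdP1_measurable F_lipschitz n1.
have FmK x := FK x m m1; have FnK x := FK x n n1.
have UM x : `|U x m| <= M by case: rU => _ _ h _ _; exact: h.
have VM x : `|V x n| <= M' by case: rV => _ _ h _ _; exact: h.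
move: h1 h2.
rewrite (density_RintegralB mr ns mFm FmK) (density_RintegralB ns mr mFn FnK).
rewrite (density_RintegralB mr ns (regular_measurable rU m2) UM).
rewrite (density_RintegralB ns mr (regular_measurable rV n2) VM).
rewrite (JfunE rU rV)//.
have : 0 <= (\int[m]_x F x m - \int[m]_x F x n) - (\int[n]_x F x m - \int[n]_x F x n).
  have := F_monotone m1 n1.
  rewrite RintegralB//; [|exact: bounded_integrable mFm FmK|exact: bounded_integrable mFn FnK].
  rewrite RintegralB//; [exact: bounded_integrable mFm FmK|exact: bounded_integrable mFn FnK].
have : (\int[leb]_x f1 x - \int[leb]_x f2 x) + (\int[leb]_x g1 x - \int[leb]_x g2 x) <= 0.
  have i1 := integrableB measurableT if1 if2; have i2 := integrableB measurableT ig1 ig2.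
  rewrite -RintegralB// -[X in _ + X]RintegralB// -RintegralD//.
  rewrite -oppr_ge0 -[X in 0 <= - X]mul1r -mulNr -RintegralZl//; last exact: integrableD i1 i2.
  apply: Rintegral_ge0 => x _.
  have conv p q : H p x + dotv (q - p) (DpH H p x) <= H q x.
    by apply: (@convex_tangent R d (H ^~ x)) => //; exact: C1_differentiable_left.
  have r0 : 0 <= rho x by case: mr.
  have s0 : 0 <= sigma x by case: ns.
  have dN p q w : dotv (p - q) w = - dotv (q - p : Rd) w.
    by rewrite /dotv -sumrN; apply: eq_bigr => i _; rewrite !mxE; ring.
  have := conv (DU x) (DV x); rewrite dN -subr_ge0 => /(mulr_ge0 r0) cU.
  have := conv (DV x) (DU x); rewrite dN -subr_ge0 => /(mulr_ge0 s0) cV.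
  have := addr_ge0 cU cV; rewrite /f1 /f2 /g1 /g2 -/(DU x) -/(DV x).
  move: (H (DU x) x) (H (DV x) x) (rho x) (sigma x) => h1 h2 r s.
  move: (dotv _ _) (dotv _ _) => a b h; apply: le_trans h _.
  by rewrite le_eqVlt; apply/orP; left; apply/eqP; ring.
lra.
Qed.

Lemma Jfun_ge0 U V m (rho : Rd -> R) n sigma :
  weak_solution H F U -> weak_solution H F V ->
  Pp 2 m -> Pp 2 n -> Loo_density m rho -> Loo_density n sigma ->
  0 <= Jfun U V m rho n sigma.
Proof.
move=> wU wV m2 n2 mr ns.
have [M [L rU]] := weak_solution_regular wU.
have [M' [L' rV]] := weak_solution_regular wV.
have [_ _ _ _ [C C0 UC]] := wU; have [_ _ _ _ [C' C'0 VC]] := wV.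
pose P (a : (prob R d * (Rd -> R)) * (prob R d * (Rd -> R))) :=
  [/\ Pp 2 a.1.1, Loo_density a.1.1 a.1.2, Pp 2 a.2.1 & Loo_density a.2.1 a.2.2].
pose J (a : (prob R d * (Rd -> R)) * (prob R d * (Rd -> R))) :=
  Jfun U V a.1.1 a.1.2 a.2.1 a.2.2.
have hI : has_inf (J @` P).
  split; first by exists (J ((m, rho), (n, sigma))), ((m, rho), (n, sigma)).
  exists (- (2 * (M + M'))) => _ [a [? ? ? ?] <-].
  by have := Jfun_bound rU rV; move=> /(_ a.1.1 a.1.2 a.2.1 a.2.2); rewrite ler_norml => /(_ _ _ _ _)/andP[].
have Ile a : P a -> inf (J @` P) <= J a.
  by move=> Pa; apply: ge_inf; [case: hI|exists a].
suff I0 : 0 <= inf (J @` P) by apply: (le_trans I0); exact: (Ile ((m, rho), (n, sigma))).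
rewrite leNgt; apply/negP => I0; set I := inf _ in I0 Ile.
(* The two test inequalities lose at most [3 * (C + C') * eta] and the choice of the pair [2 * eta];
   [D * eta = - I] exceeds the total by [eta], which is the contradiction. *)
pose D := 3 * (C + C') + 3.
have D0 : 0 < D by rewrite /D; lra.
pose eta := - I / D.
have eta0 : 0 < eta by rewrite divr_gt0// oppr_gt0.
have etaD : eta * D = - I by rewrite divfK// gt_eqF.
have [_ [[[m1 rho1] [n1 sigma1]] [/= m12 mr1 n12 ns1] <-]] := inf_adherent eta0 hI.
rewrite -/I /J/= => J1.
set N1 := Loo_norm rho1 + Loo_norm sigma1.
have N10 : 0 <= N1 by rewrite addr_ge0// Loo_norm_ge0.
(* The penalty of the near-minimiser is then at most [eta]. *)
pose e := eta / (1 + N1).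
have e0 : 0 < e by rewrite divr_gt0// ltr_pwDl.
have eN : e + e * N1 = eta by rewrite -{1}[e]mulr1 -mulrDr divfK// gt_eqF// ltr_pwDl.
have [m0 [rho0 [n0 [sigma0 [[m02 mr0 n02 ns0] P1 Pm Pn]]]]] :=
  ekeland_pair rU rV e0 m12 mr1 n12 ns1.
have tU : test_local_min U (V ^~ n0) sigma0 m0 e m0 rho0.
  apply: (@test_local_minT U V e m0 rho0 n0 sigma0 e0) => m' rho' m'2 mr'; have := Pm _ _ m'2 mr'.
  by rewrite !mulrDr; lra.
have tV : test_local_min V (U ^~ m0) rho0 n0 e n0 sigma0.
  apply: (@test_local_minT V U e n0 sigma0 m0 rho0 e0) => n' sigma' n'2 ns'; have := Pn _ _ n'2 ns'.
  by rewrite !mulrDr !(JfunC V U); lra.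
have iU := UC _ _ _ _ _ _ _ _ n02 ns0 m02 (weak_solution_W1oo wV n02) e0 m02 mr0 tU.
have iV := VC _ _ _ _ _ _ _ _ m02 mr0 n02 (weak_solution_W1oo wU m02) e0 n02 ns0 tV.
have J0 := test_inequality_sum wU wV m02 n02 mr0 ns0 iU iV.
have I0J := Ile ((m0, rho0), (n0, sigma0)) (And4 m02 mr0 n02 ns0).
move: P1 I0J; rewrite /J/= -/N1 => P1 I0J.
have r0 := Loo_norm_ge0 rho0; have s0 := Loo_norm_ge0 sigma0.
move: J1 P1 I0J J0 r0 s0.
move: (Jfun U V m0 _ _ _) (Jfun U V m1 _ _ _) (Loo_norm rho0) (Loo_norm sigma0).
move=> J0 J1 N N' J1le P1 I0J J0ge Nge N'ge.
(* The new pair has [J0 >= I], so its penalty is at most the surplus [eta] of the near-minimiser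
   plus the penalty of the latter. *)
have eNN : e * (N + N') <= 2 * eta by lra.
have h1 : C * e * (1 + N) <= C * (3 * eta).
  rewrite -mulrA ler_pM2l// mulrDr mulr1.
  have : 0 <= e * N' by rewrite mulr_ge0// ltW.
  by rewrite mulrDr in eNN; lra.
have h2 : C' * e * (1 + N') <= C' * (3 * eta).
  rewrite -mulrA ler_pM2l// mulrDr mulr1.
  have : 0 <= e * N by rewrite mulr_ge0// ltW.
  by rewrite mulrDr in eNN; lra.
have : 0 <= e * (N + N') by rewrite mulr_ge0 ?(ltW e0)// addr_ge0.
by move: etaD; rewrite /D !mulrDr; lra.
Qed.

End comparison.

(** * Variations of the measure *)

Section mixture.
Context (R : realType) (d : nat).
Local Notation Rd := 'rV[R]_d.
Local Notation leb := (lebesgue_rV R d).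
Implicit Types (m n : prob R d) (rho sigma : Rd -> R).

Lemma mixture m rho n sigma (t : R) : 0 <= t -> t <= 1 ->
  Pp 2 m -> Loo_density m rho -> Pp 2 n -> Loo_density n sigma ->
  exists mt, [/\ Pp 2 mt,
    Loo_density mt (fun x => rho x + t * (sigma x - rho x)) &
    forall f : Rd -> R, m.-integrable setT (EFin \o f) ->
      n.-integrable setT (EFin \o f) ->
      \int[mt]_x f x = \int[m]_x f x + t * (\int[n]_x f x - \int[m]_x f x)].
Proof.
move=> t0 t1 m2 mr n2 ns; set rt : Rd -> R := fun x => rho x + t * (sigma x - rho x).
have mrho := density_measurable mr; have msigma := density_measurable ns.
have mrt : measurable_fun setT rt.
  by apply: measurable_funD => //; apply: measurable_funM => //; exact: measurable_funB.
have rho0 x : 0 <= rho x by case: mr.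
have sigma0 x : 0 <= sigma x by case: ns.
have rt0 x : 0 <= rt x.
  rewrite (_ : rt x = (1 - t) * rho x + t * sigma x); last by rewrite /rt; ring.
  by rewrite addr_ge0// mulr_ge0// subr_ge0.
have ir (f : Rd -> R) : m.-integrable setT (EFin \o f) -> n.-integrable setT (EFin \o f) ->
    leb.-integrable setT (EFin \o (fun x => f x * rt x)) /\
    \int[leb]_x (f x * rt x) = \int[m]_x f x + t * (\int[n]_x f x - \int[m]_x f x).
  move=> fm fn.
  have mf : measurable_fun setT f by apply/measurable_EFinP; exact: measurable_int fm.
  have i1 := density_integrable mr fm; have i2 := density_integrable ns fn.
  have i3 := integrableB measurableT i2 i1; have i4 := integrableZl measurableT t i3.
  have E : (fun x => f x * rt x) =
      (fun x => f x * rho x + t * (f x * sigma x - f x * rho x)).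
    by apply/funext => x; rewrite /rt; ring.
  rewrite E; split; first exact: (integrableD measurableT i1 i4).
  rewrite RintegralD// RintegralZl// RintegralB//.
  by rewrite -(density_Rintegral mr mf) -(density_Rintegral ns mf).
have i1 (p : prob R d) : p.-integrable setT (EFin \o (fun=> 1)).
  exact: finite_measure_integrable_cst.
have [j1 J1] := ir _ (i1 m) (i1 n).
have rt1 : (\int[leb]_x (rt x)%:E = 1)%E.
  rewrite -[LHS]fineK; last first.
    rewrite (_ : (fun x => _) = EFin \o (fun x => 1 * rt x)).
      exact: integrable_fin_num j1.
    by apply/funext => x; rewrite /= mul1r.
  congr (_%:E); move: J1; rewrite !prob_Rintegral_cst subrr mulr0 addr0 => <-.
  by apply: eq_Rintegral => x _; rewrite mul1r.
have rtK : {ae leb, forall x, rt x <= Loo_norm rho + Loo_norm sigma}.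
  have [_ rL _] := mr; have [_ sL _] := ns.
  apply: filterS2 (Loo_norm_ae rL) (Loo_norm_ae sL) => x.
  rewrite !ger0_norm// => h1 h2.
  rewrite (_ : rt x = (1 - t) * rho x + t * sigma x); last by rewrite /rt; ring.
  apply: lerD; first by rewrite (le_trans _ h1)// ler_piMl// lerBlDr lerDl.
  by rewrite (le_trans _ h2)// ler_piMl.
have [mt mtr _] := ex_Loo_density mrt rt0 rtK rt1.
have [_ _ mtE] := mtr.
exists mt; split => //; last first.
  move=> f fm fn; have [_ <-] := ir f fm fn.
  apply: density_Rintegral => //; apply/measurable_EFinP; exact: measurable_int fm.
have me := @measurable_enorm2 R d.
have ie p : Pp 2 p -> p.-integrable setT (EFin \o (fun x : Rd => enorm x ^+ 2)).
  move=> p2; apply: (Pp2_integrable p2 (C := d%:R)) => // x.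
  rewrite ger0_norm ?sqr_ge0// (le_trans (enorm2_le x))// ler_wpM2l// lerDr//.
have [j2 _] := ir _ (ie m m2) (ie n n2).
rewrite /Pp/= (ge0_integral_density mrt rt0 mtE).
- by move/integrable_fin_num: j2 => /(_ measurableT); rewrite fin_numElt => /andP[].
- exact/measurable_EFinP.
- by move=> x; rewrite lee_fin sqr_ge0.
Qed.

(** Integrals are affine in the weight 1 / (k + 1), so those of squared Lipschitz functions converge
    and [wasserstein_cvg] applies. *)
Lemma mixture_seq m rho n sigma :
  Pp 2 m -> Loo_density m rho -> Pp 2 n -> Loo_density n sigma ->
  exists mk : nat -> prob R d, [/\ forall k, Pp 2 (mk k),
    forall k, Loo_density (mk k) (fun x => rho x + k.+1%:R^-1 * (sigma x - rho x)),
    forall k (f : Rd -> R), m.-integrable setT (EFin \o f) ->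
      n.-integrable setT (EFin \o f) -> \int[mk k]_x f x =
      \int[m]_x f x + k.+1%:R^-1 * (\int[n]_x f x - \int[m]_x f x) &
    forall e : R, 0 < e -> \forall k \near \oo, wasserstein 2 (mk k) m < e].
Proof.
move=> m2 mr n2 ns.
have t0 k : 0 <= k.+1%:R^-1 :> R by rewrite invr_ge0.
have t1 k : k.+1%:R^-1 <= 1 :> R by rewrite invf_le1// ler1n.
have [mk mkP] := choice (fun k => mixture (t0 k) (t1 k) m2 mr n2 ns).
have mk2 k : Pp 2 (mk k) by case: (mkP k).
exists mk; split => //; try by move=> k; case: (mkP k).
apply: wasserstein_cvg => // L psi pL.
have im := lip_sqr_integrable pL m2; have ins := lip_sqr_integrable pL n2.
have E k : \int[mk k]_x (psi x ^+ 2) = \int[m]_x (psi x ^+ 2) +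
    k.+1%:R^-1 * (\int[n]_x (psi x ^+ 2) - \int[m]_x (psi x ^+ 2)).
  by case: (mkP k) => _ _ ->.
under eq_fun do rewrite E.
set a := \int[m]_x _; set b := \int[n]_x _.
suff : (fun k => a + k.+1%:R^-1 * (b - a)) @ \oo --> a + 0 * (b - a).
  by rewrite mul0r addr0.
apply: cvgD; first exact: cvg_cst.
by apply: cvgM; [exact: cvg_harmonic|exact: cvg_cst].
Qed.

End mixture.

Section constant_difference.
Context (R : realType) (d : nat).
Local Notation Rd := 'rV[R]_d.
Local Notation leb := (lebesgue_rV R d).
Implicit Types (m n : prob R d) (rho sigma : Rd -> R).
Variables (U V : Rd -> prob R d -> R) (M L M' L' : R).
Hypotheses (rU : regular U M L) (rV : regular V M' L')
  (UV : forall m rho n sigma, Pp 2 m -> Loo_density m rho -> Pp 2 n ->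
    Loo_density n sigma -> 0 <= Jfun U V m rho n sigma).

Lemma density_integral_le m (rho : Rd -> R) n1 (sigma1 : Rd -> R) n2 (sigma2 : Rd -> R) :
  Pp 2 m -> Loo_density m rho -> Pp 2 n1 -> Loo_density n1 sigma1 ->
  Pp 2 n2 -> Loo_density n2 sigma2 ->
  \int[n1]_x U x m - \int[n1]_x V x m <= \int[n2]_x U x m - \int[n2]_x V x m.
Proof.
move=> m2 mr n12 ns1 n22 ns2.
have [p [p2 pr pE pW]] := mixture_seq m2 mr n12 ns1.
have [q [q2 qr qE qW]] := mixture_seq m2 mr n22 ns2.
have le k : (\int[n1]_x U x (q k) - \int[n1]_x V x (p k)) -
    (\int[n2]_x U x (q k) - \int[n2]_x V x (p k)) <= 0.
  have k0 : 0 < k.+1%:R^-1 :> R by rewrite invr_gt0.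
  have iU (l : prob R d) : l.-integrable setT (EFin \o (U ^~ (q k))) by exact (regular_integrable rU l (q2 k)).
  have iV (l : prob R d) : l.-integrable setT (EFin \o (V ^~ (p k))) by exact (regular_integrable rV l (p2 k)).
  (* [U] is taken at the mixture with [n2] and [V] at that with [n1]; the share of [m] cancels in
     their difference, which leaves the common factor [t]. *)
  have := UV (q2 k) (qr k) (p2 k) (pr k).
  rewrite (JfunE rU rV)// qE// qE// pE// pE//.
  move: (k.+1%:R^-1 : R) k0 => t t0.
  rewrite -[X in 0 <= X]opprK oppr_ge0 (_ : - _ = t * ((\int[n1]_x U x (q k) - \int[n1]_x V x (p k)) -
    (\int[n2]_x U x (q k) - \int[n2]_x V x (p k)))); last by ring.
  by rewrite pmulr_rle0.
have cn (n : prob R d) : Pp 2 n ->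
    forall e : R, 0 < e -> \forall k \near \oo, wasserstein 2 n n < e.
  by move=> _ e e0; apply: nearW => k; rewrite wassersteinxx.
have c1 := regular_cvg rU q2 (fun=> n12) m2 n12 qW (cn n1 n12).
have c2 := regular_cvg rV p2 (fun=> n12) m2 n12 pW (cn n1 n12).
have c3 := regular_cvg rU q2 (fun=> n22) m2 n22 qW (cn n2 n22).
have c4 := regular_cvg rV p2 (fun=> n22) m2 n22 pW (cn n2 n22).
rewrite -subr_le0; apply: (cvgr_to_le (cvgB (cvgB c1 c2) (cvgB c3 c4))).
by apply: nearW => k; exact: le.
Qed.

End constant_difference.

(** * Approximation by measures with a bounded density *)

Section smoothing.
Context (R : realType) (d : nat).
Local Notation Rd := 'rV[R]_d.
Local Notation leb := (lebesgue_rV R d).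
Variables (m : prob R d) (s : R).
Hypothesis s0 : 0 < s.

Let c : R := ((s *+ 2) ^+ d)^-1.
Let c0 : 0 <= c. Proof. by rewrite invr_ge0 exprn_ge0// mulrn_wge0// ltW. Qed.
Let cE : c * (s *+ 2) ^+ d = 1.
Proof. by rewrite mulVf// expf_neq0// mulrn_eq0/= gt_eqF. Qed.

Let S : set (Rd * Rd) := [set z | `|z.1 - z.2| < s].
(** The uniform kernel on cubes of side [2 * s]. With respect to the product of the Lebesgue measure
    and [m], it is the density of a coupling of [m] with its average over such cubes. *)
Let k (z : Rd * Rd) : R := c * \1_S z.

Let mS : measurable S.
Proof.
have := @measurable_norm_rV R d _ (Rd * Rd)%type (fun z => z.1 - z.2) (@measurable_prod_sub R d).
move=> /(_ measurableT [set y | y < s]); rewrite -set_itvNyo => /(_ (measurable_itv _)).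
by rewrite setTI set_itvNyo.
Qed.

Let mk : measurable_fun setT k.
Proof. by apply: measurable_funM => //; exact: measurable_indic. Qed.

Let k0 z : 0 <= k z. Proof. by rewrite mulr_ge0. Qed.

Let mEk : measurable_fun setT (EFin \o k). Proof. exact/measurable_EFinP. Qed.

Let Ek0 z : (0 <= (k z)%:E)%E. Proof. by rewrite lee_fin. Qed.

Let mball (x : Rd) : measurable (ball x s : set Rd).
Proof. by apply: open_mx_measurable; exact: ball_open. Qed.

Let kE x y : k (x, y) = c * \1_(ball x s) y.
Proof.
rewrite /k !indicE; congr (_ * (_ : bool)%:R); apply/idP/idP => /set_mem h; apply/mem_set.
  by rewrite mx_norm_ball.
by move: h; rewrite mx_norm_ball.
Qed.

Let kE' x y : k (x, y) = c * \1_(ball y s) x.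
Proof.
rewrite kE !indicE; congr (_ * (_ : bool)%:R); apply/idP/idP => /set_mem h; apply/mem_set.
  exact: ball_sym.
exact: ball_sym.
Qed.

Let rho (x : Rd) : R := c * fine (m (ball x s)).

Let int_left x : (\int[m]_y (k (x, y))%:E = (rho x)%:E)%E.
Proof.
under eq_integral do rewrite kE EFinM.
rewrite ge0_integralZl_EFin//; last first.
  by apply/measurable_EFinP; exact: measurable_indic.
by rewrite integral_indic// setIT /rho EFinM fineK// fin_num_measure.
Qed.

Let int_right y : (\int[leb]_x (k (x, y))%:E = 1)%E.
Proof.
under eq_integral do rewrite kE' EFinM.
rewrite ge0_integralZl_EFin//; last first.
  by apply/measurable_EFinP; exact: measurable_indic.
rewrite integral_indic// setIT.
transitivity (c%:E * ((s *+ 2) ^+ d)%:E)%E; last by rewrite -EFinM cE.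
by congr (_ * _)%E; exact: lebesgue_rV_ball.
Qed.

Let mrho : measurable_fun setT rho.
Proof.
apply/measurable_EFinP; rewrite (_ : EFin \o rho = fubini_F m (EFin \o k)).
  exact: measurable_fun_fubini_tonelli_F.
by apply/funext => x; rewrite /fubini_F/= int_left.
Qed.

Let rho0 x : 0 <= rho x.
Proof. by rewrite mulr_ge0// fine_ge0. Qed.

Let int_fst (h : Rd -> R) : measurable_fun setT h -> (forall x, 0 <= h x) ->
  (\int[leb \x m]_z (h z.1 * k z)%:E = \int[leb]_x (h x * rho x)%:E)%E.
Proof.
move=> mh h0; rewrite fubini_tonelli1.
- apply: eq_integral => x _; rewrite /fubini_F/=.
  under eq_integral do rewrite EFinM.
  rewrite ge0_integralZl_EFin//; first by rewrite int_left EFinM.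
  exact: (measurableT_comp mEk (measurable_pair1 x)).
- apply/measurable_EFinP; apply: measurable_funM => //.
  exact: (measurableT_comp mh measurable_fst).
- by move=> z; rewrite lee_fin mulr_ge0.
Qed.

Let int_snd (h : Rd -> R) : measurable_fun setT h -> (forall x, 0 <= h x) ->
  (\int[leb \x m]_z (h z.2 * k z)%:E = \int[m]_y (h y)%:E)%E.
Proof.
move=> mh h0; rewrite fubini_tonelli2.
- apply: eq_integral => y _; rewrite /fubini_G/=.
  under eq_integral do rewrite EFinM.
  rewrite ge0_integralZl_EFin//; first by rewrite int_right mule1.
  exact: (measurableT_comp mEk (measurable_pair2 y)).
- apply/measurable_EFinP; apply: measurable_funM => //.
  exact: (measurableT_comp mh measurable_snd).
- by move=> z; rewrite lee_fin mulr_ge0.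
Qed.

Let int_cst (a : R) : (\int[m]_y a%:E = a%:E)%E.
Proof.
rewrite -[RHS]mule1 (_ : 1 = m setT)%E; first exact: integral_cst.
by apply/esym; exact: probability_setT.
Qed.

(** The density [rho] is at most [c], as [m] has mass 1. The kernel couples points at sup distance
    less than [s], hence at Euclidean distance at most [d%:R * s]. *)
Lemma smoothing : Pp 2 m -> exists n rho,
  [/\ Pp 2 n, Loo_density n rho & wasserstein 2 n m <= d%:R * s].
Proof.
move=> m2.
have rho1 : (\int[leb]_x (rho x)%:E = 1)%E.
  have := int_fst (measurable_cst (1:R)) (fun=> ler01); under [X in _ = X -> _]eq_integral do rewrite mul1r.
  move=> <-; rewrite (int_snd (measurable_cst (1:R)) (fun=> ler01)).
  by rewrite int_cst.
have rhoc : {ae leb, forall x, rho x <= c}.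
  apply: aeW => x; rewrite /rho ler_piMr// -lee_fin fineK ?fin_num_measure//.
  exact: probability_le1.
have [n nr _] := ex_Loo_density mrho rho0 rhoc rho1.
have [_ _ nE] := nr.
exists n, rho; split => //.
- have me := @measurable_enorm2 R d.
  pose h (y : Rd) : R := d%:R * (2 * enorm y ^+ 2 + 2 * s ^+ 2).
  have mh : measurable_fun setT h.
    apply: measurable_funM => //; apply: measurable_funD => //.
    exact: measurable_funM.
  have h0 y : 0 <= h y.
    by rewrite mulr_ge0// addr_ge0// mulr_ge0// sqr_ge0.
  rewrite /Pp/= (ge0_integral_density mrho rho0 nE)//; last 2 first.
    exact/measurable_EFinP.
    by move=> x; rewrite lee_fin sqr_ge0.
  rewrite -(int_fst me (fun x => sqr_ge0 _)).
  apply: (@le_lt_trans _ _ (\int[leb \x m]_z (h z.2 * k z)%:E)%E).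
    apply: ge0_le_integral => //.
    + by move=> z _; rewrite lee_fin mulr_ge0// sqr_ge0.
    + apply/measurable_EFinP; apply: measurable_funM => //.
      exact: (measurableT_comp me measurable_fst).
    + apply/measurable_EFinP; apply: measurable_funM => //.
      exact: (measurableT_comp mh measurable_snd).
    + move=> z _; rewrite lee_fin; have [zS|zS] := pselect (S z); last first.
        by rewrite /k indicE memNset// !mulr0.
      rewrite ler_wpM2r// (le_trans (enorm2_le _))// /h ler_wpM2l//.
      have t : `|z.1| <= `|z.2| + s.
        have := ler_normD (z.1 - z.2) z.2; rewrite subrK => /le_trans; apply.
        by rewrite addrC lerD2l ltW.
      have := norm_le_enorm z.2; have := normr_ge0 z.1; have := normr_ge0 z.2.
      have := sqr_ge0 (`|z.2| - s); have := enorm_ge0 z.2.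
      by rewrite !expr2; nra.
  rewrite (int_snd mh h0).
  have hi : m.-integrable setT (EFin \o h).
    apply: (Pp2_integrable m2 (C := d%:R * (2 * d%:R + 2 * s ^+ 2))) => // x.
    rewrite ger0_norm// /h -mulrA ler_wpM2l//.
    have := enorm2_le x; have := sqr_ge0 s; have := sqr_ge0 `|x|; have : 0 <= d%:R :> R by [].
    by nra.
  by move/integrable_fin_num: hi => /(_ measurableT); rewrite fin_numElt => /andP[].
- have ind (A : set Rd) : measurable A -> measurable_fun setT (\1_A : Rd -> R).
    exact: measurable_indic.
  apply: (@density_coupling R d n m leb m k) => //.
  + by rewrite mulr_ge0// ltW.
  + move=> A mA; rewrite nE//.
    transitivity (\int[leb \x m]_z (\1_A z.1 * k z)%:E)%E.
      rewrite integral_mkcond; apply: eq_integral => z _; rewrite /patch indicE.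
      case: ifPn => [/set_mem[/= zA _]|zA]; first by rewrite mem_set// mul1r.
      rewrite memNset ?mul0r// => zA'; move/negP: zA; apply; exact/mem_set.
    rewrite (int_fst (ind _ mA))// [RHS]integral_mkcond; apply: eq_integral => x _.
    by rewrite /patch indicE; case: ifPn; rewrite ?mul1r ?mul0r.
  + move=> A mA.
    transitivity (\int[leb \x m]_z (\1_A z.2 * k z)%:E)%E.
      rewrite integral_mkcond; apply: eq_integral => z _; rewrite /patch indicE.
      case: ifPn => [/set_mem[/= _ zA]|zA]; first by rewrite mem_set// mul1r.
      rewrite memNset ?mul0r// => zA'; move/negP: zA; apply; exact/mem_set.
    by rewrite (int_snd (ind _ mA))// integral_indic// setIT.
  + apply: (@le_trans _ _ (\int[leb \x m]_z ((d%:R * s) ^+ 2 * k z)%:E)%E).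
      apply: ge0_le_integral => //.
      * by move=> z _; rewrite lee_fin mulr_ge0// sqr_ge0.
      * apply/measurable_EFinP; apply: measurable_funM => //; exact: measurable_cost.
      * by apply/measurable_EFinP; exact: measurable_funM.
      * move=> z _; rewrite lee_fin; have [zS|zS] := pselect (S z); last first.
          by rewrite /k indicE memNset// !mulr0.
        rewrite ler_wpM2r// ler_pXn2r ?nnegrE ?enorm_ge0 ?mulr_ge0 ?(ltW s0)//.
        by rewrite (le_trans (enorm_le _))// ler_wpM2l// ltW.
    have := int_snd (measurable_cst ((d%:R * s) ^+ 2 : R)) (fun=> sqr_ge0 _).
    by move=> ->; rewrite int_cst.
Qed.

End smoothing.

(** * Constancy of the difference in the space variable *)

Section uniqueness.
Context (R : realType) (d : nat).
Local Notation Rd := 'rV[R]_d.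
Implicit Types (m n : prob R d) (rho sigma : Rd -> R).

(** Smoothing of a Dirac mass. The measure does not depend on [f], so that one measure serves both
    solutions. *)
Lemma dirac_approx (x : Rd) (e : R) : 0 < e ->
  exists n sigma, [/\ Pp 2 n, Loo_density n sigma &
    forall (f : Rd -> R) (L K : R), 0 <= L -> lip L f -> (forall y, `|f y| <= K) ->
      `|\int[n]_y f y - f x| <= L * e].
Proof.
move=> e0; pose dx : prob R d := \d_x.
have s0 : 0 < e / (d%:R + 1) by rewrite divr_gt0// ltr_wpDl.
have dx2 : Pp 2 dx.
  rewrite /Pp/= integral_dirac//; first by rewrite diracT mul1e ltry.
  by apply/measurable_EFinP; exact: measurable_enorm2.
have [n [sigma [n2 ns nW]]] := smoothing s0 dx2.
exists n, sigma; split => // f L K L0 fL fK.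
have -> : f x = \int[dx]_y f y.
  rewrite /Rintegral integral_dirac//; last by apply/measurable_EFinP; exact: lip_measurable fL.
  by rewrite diracT mul1e.
apply: (le_trans (lip_integral_wasserstein n2 dx2 L0 fL fK)).
rewrite ler_wpM2l// (le_trans nW)// mulrCA ger_pMr// ler_pdivrMr ?ltr_wpDl// mul1r.
by rewrite lerDl.
Qed.

Variables (U V : Rd -> prob R d -> R) (M L M' L' : R).
Hypotheses (rU : regular U M L) (rV : regular V M' L')
  (UV : forall m rho n sigma, Pp 2 m -> Loo_density m rho -> Pp 2 n ->
    Loo_density n sigma -> 0 <= Jfun U V m rho n sigma).

Lemma density_difference_le m (rho : Rd -> R) x y :
  Pp 2 m -> Loo_density m rho -> U x m - V x m <= U y m - V y m.
Proof.
move=> m2 mr; case: (rU) => _ L0 UM /(_ m m2) UL _; case: (rV) => _ L'0 VM' /(_ m m2) VL _.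
apply/ler_addgt0Pr => e e0.
(* Replacing point values by integrals costs [(L + L') * s] at each of the two points. *)
have D0 : 0 < 2 * (L + L') + 1 by rewrite ltr_wpDl// mulr_ge0// addr_ge0.
have s0 : 0 < e / (2 * (L + L') + 1) by rewrite divr_gt0.
set s := e / _ in s0.
have [n1 [s1 [n12 ns1 n1P]]] := dirac_approx x s0.
have [n2 [s2 [n22 ns2 n2P]]] := dirac_approx y s0.
have := density_integral_le rU rV UV m2 mr n12 ns1 n22 ns2.
have := n1P _ _ _ L0 UL (fun z => UM z m m2); have := n1P _ _ _ L'0 VL (fun z => VM' z m m2).
have := n2P _ _ _ L0 UL (fun z => UM z m m2); have := n2P _ _ _ L'0 VL (fun z => VM' z m m2).
rewrite !ler_norml => /andP[a1 a2] /andP[b1 b2] /andP[c1 c2] /andP[d1 d2].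
have : s * (2 * (L + L') + 1) = e by rewrite divfK// gt_eqF.
clearbody s; move: a1 a2 b1 b2 c1 c2 d1 d2.
move: (\int[n1]_z _) (\int[n1]_z _) (\int[n2]_z _) (\int[n2]_z _) => i1 i2 i3 i4.
by move=> *; lra.
Qed.

Lemma difference_le m x y : Pp 2 m -> U x m - V x m <= U y m - V y m.
Proof.
(* One quarter for each of the four values carried over from the smoothed measure to [m]. *)
move=> m2; apply/ler_addgt0Pr => e e0; have e4 : 0 < e / 4 by rewrite divr_gt0.
case: (rU) => _ _ _ _ cU; case: (rV) => _ _ _ _ cV.
have [r1 r10 r1P] := cU x m m2 _ e4; have [r2 r20 r2P] := cV x m m2 _ e4.
have [r3 r30 r3P] := cU y m m2 _ e4; have [r4 r40 r4P] := cV y m m2 _ e4.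
pose r := Num.min (Num.min r1 r2) (Num.min r3 r4).
have r0 : 0 < r by rewrite !lt_min r10 r20 r30 r40.
have s0 : 0 < r / (d%:R + 1) by rewrite divr_gt0// ltr_wpDl.
have [n [sigma [n2 ns nW]]] := smoothing s0 m2.
have nr : wasserstein 2 n m < r.
  apply: (le_lt_trans nW); rewrite mulrCA gtr_pMr// ltr_pdivrMr ?ltr_wpDl// mul1r.
  by rewrite ltrDl.
move: nr; rewrite !lt_min => /andP[/andP[nr1 nr2] /andP[nr3 nr4]].
have z (v : Rd) t : 0 < t -> enorm (v - v) < t.
  by move=> t0; rewrite subrr (le_lt_trans (enorm_le _))// normr0 mulr0.
have := r1P x n n2 (z x _ r10) nr1; have := r2P x n n2 (z x _ r20) nr2.
have := r3P y n n2 (z y _ r30) nr3; have := r4P y n n2 (z y _ r40) nr4.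
have := density_difference_le x y n2 ns.
rewrite !ltr_norml => h /andP[a1 a2] /andP[b1 b2] /andP[c1 c2] /andP[d1 d2].
lra.
Qed.

Lemma continuous_difference : continuous_P2 (fun m => U 0 m - V 0 m).
Proof.
case: (rU) => _ _ _ _ cU; case: (rV) => _ _ _ _ cV.
move=> m m2 e e0; have e2 : 0 < e / 2 by rewrite divr_gt0.
have [r1 r10 r1P] := cU 0 m m2 _ e2; have [r2 r20 r2P] := cV 0 m m2 _ e2.
exists (Num.min r1 r2); first by rewrite lt_min r10.
move=> n n2; rewrite lt_min => /andP[nr1 nr2].
have z t : 0 < t -> enorm (0 - 0 : Rd) < t.
  by move=> t0; rewrite subrr (le_lt_trans (enorm_le _))// normr0 mulr0.
have := r1P 0 n n2 (z _ r10) nr1; have := r2P 0 n n2 (z _ r20) nr2.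
rewrite !ltr_norml => /andP[a1 a2] /andP[b1 b2].
by apply/andP; split; lra.
Qed.

End uniqueness.

Theorem theorem2p4 (R : realType) (d : nat) (hd : (0 < d)%N)
  (H : 'rV[R]_d -> 'rV[R]_d -> R) (F : 'rV[R]_d -> prob R d -> R)
  (HC1 : C1 (fun z : 'rV[R]_d * 'rV[R]_d => H z.1 z.2))
  (H0_bounded : exists M : R, forall x, `|H 0 x| <= M)
  (H_convex : forall x, convex_function [set: 'rV[R]_d] (fun p => H p x))
  (F_lipschitz : lipschitz_RdP1 F)
  (F_bounded : bounded_RdPp 1 F)
  (F_monotone : monotone_P1 F)
  (U Ut : 'rV[R]_d -> prob R d -> R) :
  weak_solution H F U -> weak_solution H F Ut ->
  exists2 c : prob R d -> R, continuous_P2 c &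
    forall x m, Pp 2 m -> U x m = Ut x m + c m.
Proof.
move=> wU wUt.
have [M [L rU]] := weak_solution_regular wU.
have [M' [L' rUt]] := weak_solution_regular wUt.
have UUt m rho n sigma : Pp 2 m -> Loo_density m rho -> Pp 2 n ->
    Loo_density n sigma -> 0 <= Jfun U Ut m rho n sigma.
  by move=> m2 mr n2 ns; exact: (Jfun_ge0 HC1 H_convex F_lipschitz F_bounded F_monotone wU wUt m2 n2 mr ns).
(* As the difference is constant in space, its value at the origin serves as [c]. *)
exists (fun m => U 0 m - Ut 0 m); first exact: continuous_difference rU rUt.
move=> x m m2; apply/eqP; rewrite addrC -subr_eq eq_le.
by rewrite !(difference_le rU rUt UUt).
Qed.
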